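(* Let $n \geq 1$ and suppose the compact set $K \subset \mathbb{R}^n$ has the same $(n-1)$-capacity as a closed ball $B \subset \mathbb{R}^n$ centered at the origin, meaning $\mathrm{Cap}_{n-1}(K)=\mathrm{Cap}_{n-1}(B)>0$. Then $$\int_K |x|^q \, d\mu \geq \int_B |x|^q \, d\nu , \qquad q \in (0,2] ,$$ where $\mu$ and $\nu$ are the $(n-1)$-equilibrium measures of $K$ and $B$, respectively. Equality holds if and only if $K=B \cup Z$ for some set $Z$ with inner $(n-1)$-capacity zero. Further, the logarithmic moments satisfy $$\int_K \log |x| \, d\mu \geq \int_B \log |x| \, d\nu .$$ When $n \geq 2$, equality holds for the logarithmic moments if and only if $K=B \cup Z$ for some $Z$ with inner $(n-1)$-capacity zero. When $n=1$, equality holds for the logarithmic moments if and only if the origin is a regular point of $K$, meaning $\int_K \log \frac{1}{|x|} \, d\mu = V_{log}(K)$.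
   Context: For a compact set $K \subset \mathbb{R}^n$, the logarithmic energy is $V_{log}(K)=\inf_\mu \int_K\int_K \log\frac{1}{|x-y|}\,d\mu(x)d\mu(y)$ and, for $p>0$, the Riesz $p$-energy is $V_p(K)=\inf_\mu \int_K\int_K \frac{1}{|x-y|^p}\,d\mu(x)d\mu(y)$, where the infimum is over all Borel probability measures $\mu$ on $K$ (the energy of the empty set is $+\infty$). The infimum is attained, and when the energy is finite the minimizing measure is unique; it is called the logarithmic equilibrium measure (also called the $0$-equilibrium measure), respectively the $p$-equilibrium measure, of $K$. The capacity is $\mathrm{Cap}_p(K)=V_p(K)^{-1/p}$ for $p>0$ and $\mathrm{Cap}_0(K)=\exp(-V_{log}(K))$ for $p=0$ (logarithmic capacity); it is positive if and only if the corresponding energy is finite. A set $Z$ has inner $p$-capacity zero if $\mathrm{Cap}_p(Z')=0$ for every compact $Z'\subset Z$. *)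

(* Defs.v *)
From HB Require Import structures.
From mathcomp Require Import all_boot all_order all_algebra.
From mathcomp Require Import all_classical all_reals all_analysis.

Set Implicit Arguments.
Unset Strict Implicit.
Unset Printing Implicit Defensive.

Import Order.TTheory GRing.Theory Num.Theory.
Import numFieldNormedType.Exports.

Local Open Scope classical_set_scope.
Local Open Scope ring_scope.
Local Open Scope ereal_scope.

Section capacity.
Context {R : realType} {n : nat}.

Definition borel_rV := g_sigma_algebraType (@open 'rV[R]_n).

(* The norm [`|x|] of the library on ['rV[R]_n] is the sup norm; it induces the
   same topology, so [open] and [compact] have their usual meaning. *)
Definition enorm (x : 'rV[R]_n) : R :=
  Num.sqrt (\sum_(i < n) x ord0 i ^+ 2)%R.

Definition origin_ball (r : R) : set 'rV[R]_n := [set x | (enorm x <= r)%R].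

(* On the diagonal both kernels are +oo, since [0^-1 = +oo] in [\bar R] and
   [lne +oo = +oo]. *)
Definition log_kernel (x y : 'rV[R]_n) : \bar R := lne (enorm (x - y))%:E^-1.

Definition riesz_kernel (p : R) (x y : 'rV[R]_n) : \bar R :=
  (enorm (x - y) `^ p)%:E^-1.

Definition pkernel (p : R) : 'rV[R]_n -> 'rV[R]_n -> \bar R :=
  if p == 0%R then log_kernel else riesz_kernel p.

(* A probability measure on a compact set [K] is encoded as a Borel probability
   measure on the whole space that gives [K] mass 1. *)
Definition kernel_energy (k : 'rV[R]_n -> 'rV[R]_n -> \bar R)
    (K : set 'rV[R]_n) (mu : probability borel_rV R) : \bar R :=
  \int[mu]_(x in K) \int[mu]_(y in K) k x y.

Definition min_energy (k : 'rV[R]_n -> 'rV[R]_n -> \bar R)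
    (K : set 'rV[R]_n) : \bar R :=
  ereal_inf [set kernel_energy k K mu |
    mu in [set mu : probability borel_rV R | mu K = 1]].

Definition log_energy : set 'rV[R]_n -> \bar R := min_energy log_kernel.

Definition riesz_energy (p : R) : set 'rV[R]_n -> \bar R :=
  min_energy (riesz_kernel p).

(* [V^-1 `^ p^-1] rather than [V `^ (- p^-1)]: the library sets
   [+oo `^ a = +oo] for all [a != 0], whereas infinite energy must give
   capacity 0. *)
Definition cap (p : R) (K : set 'rV[R]_n) : \bar R :=
  if p == 0%R then expeR (- log_energy K) else (riesz_energy p K)^-1 `^ p^-1.

Definition equilibrium_measure (p : R) (K : set 'rV[R]_n)
    (mu : probability borel_rV R) : Prop :=
  [/\ mu K = 1, min_energy (pkernel p) K < +oo
    & kernel_energy (pkernel p) K mu = min_energy (pkernel p) K].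

Definition inner_cap_zero (p : R) (Z : set 'rV[R]_n) : Prop :=
  forall Z', compact Z' -> Z' `<=` Z -> cap p Z' = 0.

(* [mu] is meant to be the logarithmic equilibrium measure of [K]. *)
Definition origin_regular (K : set 'rV[R]_n) (mu : probability borel_rV R) :
    Prop :=
  \int[mu]_(x in K) lne (enorm x)%:E^-1 = log_energy K.

End capacity.

Arguments borel_rV : clear implicits.

(* Main.v *)
From HB Require Import structures.
Require Import Defs.
From mathcomp Require Import all_boot all_order all_algebra.
From mathcomp Require Import all_classical all_reals all_analysis.
From mathcomp Require Import measurable_realfun.
From mathcomp Require Import ring lra.
Import Order.TTheory GRing.Theory Num.Theory.
Import numFieldNormedType.Exports.
Set Implicit Arguments.
Unset Strict Implicit.
Unset Printing Implicit Defensive.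
Local Open Scope classical_set_scope.
Local Open Scope ring_scope.

(** Put p = n - 1 and let U_t denote the potential of a measure t. Away from the origin the kernel
    |x|^(-p), or -log|x| when n = 1, is strictly subharmonic. A potential therefore has no maximum
    at positive distance from a carrier of its measure ([no_interior_max]). This yields a maximum
    principle: a bound for the potential on a carrier extends to a whole box ([max_principle]), and
    a bound on the box is strict off a closed carrier ([potential_lt]). For an equilibrium measure
    the first variation bounds the potential almost everywhere by the energy V
    ([minimizer_potential_ae]), hence everywhere in the box ([minimizer_potential_le]).

    The unit ball carries an explicit probability measure whose potential is constant on the ball:
    density proportional to (1 - |y|^2)^(-1/2) for n >= 2, the arcsine law for n = 1
    ([exists_ball_measure]). Let nu_s be its dilation to radius s, with potential u_s. The gap
    G_s(x) = s^p (u_s(0) - u_s(x)) vanishes for |x| <= s, is positive beyond, and satisfies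
    G_(ls)(lx) = G_s(x). Hence the integral of s^(q-1) G_s(x) ds equals N_q |x|^q ([layerE]), and by
    Fubini N_q times the q-th moment of t is the integral of s^(q-1) times the average of G_s under
    t ([moment_layer]). That average is s^p (u_s(0) - I(t, nu_s)), with I the mutual energy. For s
    >= r the average under nu is zero. For s < r one has I(mu, nu_s) <= V since U_mu <= V, and I(nu,
    nu_s) >= V by the first variation for nu. So the averages, and with them the moments, are
    ordered ([average_le], [ball_moment_le]).

    The equality criterion is mu(B) = 1. If mu charges the outside of B, its averages are positive
    for s slightly larger than r while those of nu vanish, so the moments differ
    ([ball_moment_gap]). If mu(B) = 1, then mu is also a minimiser for B, and exchanging the roles
    gives equal moments ([ball_moment_eq]). [ball_structure] and [full_of_structure] translate mu(B)
    = 1 into K = B union a set of inner capacity zero.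

    The logarithmic moment is the limit of the moments of (|x|^q - 1) / q as q tends to 0. For n >=
    2 the constant N_q is O(1/q), so a strict gap survives the limit ([log_defect_ball_lt]). For n =
    1, -log|x| is the kernel seen from the origin, so the logarithmic moment of nu is -V and
    equality becomes regularity of the origin ([log_defect_ball_energy]). *)

(** * Borel measurability on row vectors *)

Section borel.
Context {R : realType} {n : nat}.
Local Notation E := (borel_rV R n).

Lemma open_borel (U : set 'rV[R]_n) : open U -> measurable (U : set E).
Proof. by move=> oU; apply: sub_sigma_algebra. Qed.

Lemma closed_borel (F : set 'rV[R]_n) : closed F -> measurable (F : set E).
Proof.
by move=> cF; rewrite -[F]setCK; apply: measurableC; apply: open_borel; apply: closed_openC.
Qed.

Lemma compact_borel (F : set 'rV[R]_n) : compact F -> measurable (F : set E).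
Proof.
by move=> cF; apply: closed_borel; apply: compact_closed => //; exact: norm_hausdorff.
Qed.

Lemma measurable_coord (i : 'I_n) :
  measurable_fun [set: E] (fun x : E => (x : 'rV[R]_n) ord0 i).
Proof.
apply: (measurability _ (RGenOpens.measurableE R)) => _ [_ [a [b ->]] <-].
rewrite setTI; apply: open_borel.
by apply: open_comp => [x _|]; [exact: coord_continuous|exact: interval_open].
Qed.

Lemma rV_norm_lt (x : 'rV[R]_n) (e : R) : 0 < e ->
  (forall i, `|x ord0 i| < e) -> `|x| < e.
Proof.
move=> e0 xe; rewrite (_ : `|x| = mx_norm x) // mx_normrE.
by apply: bigmax_lt => //= -[i j] _ /=; rewrite (ord1 i).
Qed.

Lemma rV_norm_leP (x : 'rV[R]_n) (e : R) : 0 <= e ->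
  `|x| <= e <-> forall i, `|x ord0 i| <= e.
Proof.
move=> e0; rewrite (_ : `|x| = mx_norm x) // mx_normrE; split => [xe i|xe].
  by apply: le_trans xe; exact: (le_bigmax _ (fun ij => `|x ij.1 ij.2|) (ord0, i)).
by apply: bigmax_le => //= -[i j] _ /=; rewrite (ord1 i).
Qed.

(** An open set is the union of the boxes with rational centre and radius that it contains. There
    are countably many of them, and the preimage of a box is a finite intersection of coordinate
    preimages. *)
Lemma measurable_rVP d (T : measurableType d) (f : T -> E) :
  (forall i : 'I_n, measurable_fun setT (fun t => (f t : 'rV[R]_n) ord0 i)) ->
  measurable_fun setT f.
Proof.
move=> mf.
apply: (@measurability _ _ T E setT f (@open 'rV[R]_n)) => // _ [U oU <-].
pose box (q : 'rV[rat]_n * rat) : set 'rV[R]_n :=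
  [set x | forall i, (`| x ord0 i - ratr (q.1 ord0 i)| < ratr q.2)%R].
have -> : setT `&` f @^-1` U =
    \bigcup_(q in [set q | box q `<=` U]) (f @^-1` box q).
  rewrite setTI; apply/seteqP; split => [t Ut|t [q qU] /qU//].
  have /nbhs_ballP[e /= e0 eU] : nbhs (f t : 'rV[R]_n) U.
    by apply: open_nbhs_nbhs.
  have [d0 /itvP d0e] : exists q, ratr q \in `]0, (e / 2)[%R.
    by apply: rat_in_itvoo; rewrite divr_gt0.
  have d0gt : (0 < ratr d0 :> R)%R by rewrite d0e.
  have hc i : exists q : rat, ratr q \in `]((f t : 'rV[R]_n) ord0 i - ratr d0), ((f t : 'rV[R]_n) ord0 i + ratr d0)[%R.
    by apply: rat_in_itvoo; rewrite ltrD2l gtrN.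
  pose c : 'rV[rat]_n := \row_i projT1 (cid (hc i)).
  have hcb : box (c, d0) (f t).
    move=> i /=; rewrite mxE; case: cid => q /= /itvP qi.
    by rewrite distrC ltr_distl !qi.
  exists (c, d0) => //= y yb; apply: eU.
  rewrite -ball_normE /=.
  apply: rV_norm_lt => // j; rewrite !mxE.
  have := hcb j; have := yb j => /= h1 h2.
  have -> : (f t : 'rV[R]_n) ord0 j - y ord0 j = ((f t : 'rV[R]_n) ord0 j - ratr (c ord0 j)) - (y ord0 j - ratr (c ord0 j)) by ring.
  apply: (le_lt_trans (ler_normB _ _)).
  apply: (lt_le_trans (ltrD h2 h1)).
  have : ratr d0 < e / 2 by rewrite d0e.
  lra.
rewrite bigcup_mkcond; apply: countable_bigcupT_measurable => [|q].
  exact: countableP.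
case: ifPn => // _.
suff -> : f @^-1` box q = \bigcap_(i in [set: 'I_n]) ((fun t => (f t : 'rV[R]_n) ord0 i) @^-1` [set y | `|y - ratr (q.1 ord0 i)| < ratr q.2]).
  apply: fin_bigcap_measurable => [|i _]; first exact: finite_finset.
  rewrite -[X in measurable X]setTI; apply: mf => //.
  rewrite (_ : [set _ | _] = `](ratr (q.1 ord0 i) - ratr q.2), (ratr (q.1 ord0 i) + ratr q.2)[%classic) //.
  by apply/seteqP; split => y /=; rewrite in_itv /= ltr_distl.
by apply/seteqP; split => t /= h i => [_|]; have := h i => //; apply.
Qed.

Lemma measurable_enorm : measurable_fun [set: E] (@enorm R n : E -> R).
Proof.
rewrite /enorm; apply: measurableT_comp; last first.
  by apply: measurable_sum => i; apply: measurable_funX; exact: measurable_coord.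
exact: (continuous_measurable_fun (@sqrt_continuous R)).
Qed.

Lemma measurable_funBrV d (T : measurableType d) (f g : T -> E) :
  measurable_fun setT f -> measurable_fun setT g ->
  measurable_fun setT (fun t => (f t : 'rV[R]_n) - (g t : 'rV[R]_n) : E).
Proof.
move=> mf mg; apply: measurable_rVP => i.
under eq_fun do rewrite mxE mxE.
by apply: measurable_funB; apply: measurableT_comp (measurable_coord i) _.
Qed.

Lemma measurable_funDrV d (T : measurableType d) (f g : T -> E) :
  measurable_fun setT f -> measurable_fun setT g ->
  measurable_fun setT (fun t => (f t : 'rV[R]_n) + (g t : 'rV[R]_n) : E).
Proof.
move=> mf mg; apply: measurable_rVP => i.
under eq_fun do rewrite mxE.
by apply: measurable_funD; apply: measurableT_comp (measurable_coord i) _.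
Qed.

Lemma measurable_funZrV d (T : measurableType d) (f : T -> R) (g : T -> E) :
  measurable_fun setT f -> measurable_fun setT g ->
  measurable_fun setT (fun t => f t *: (g t : 'rV[R]_n) : E).
Proof.
move=> mf mg; apply: measurable_rVP => i.
under eq_fun do rewrite mxE.
by apply: measurable_funM => //; apply: measurableT_comp (measurable_coord i) _.
Qed.

End borel.

(** * Densities, restrictions, mixtures and images of measures *)

Section density.
Local Open Scope ereal_scope.
Context d (T : measurableType d) (R : realType).
Variables (m : {measure set T -> \bar R}) (g : T -> R).
Hypotheses (g0 : forall x, (0 <= g x)%R) (mg : measurable_fun setT g).

(** The two proofs are arguments of the set function, so that a measure structure can be attached to
    [density g0 mg]. *)
Definition density of (forall x, (0 <= g x)%R) & measurable_fun setT g :=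
  fun A : set T => \int[m]_(x in A) (g x)%:E.

Local Notation dens := (density g0 mg).

Let density0 : dens set0 = 0.
Proof. by rewrite /density integral_set0. Qed.

Let density_ge0 A : 0 <= dens A.
Proof. by apply: integral_ge0 => x _; rewrite lee_fin. Qed.

Let density_sigma_additive : semi_sigma_additive dens.
Proof.
move=> F mF tF mUF; rewrite /density; apply: cvg_toP.
  apply: ereal_nondecreasing_is_cvgn => i j ij.
  by apply: lee_sum_nneg_natr => // k _ _; apply: integral_ge0 => x _; rewrite lee_fin.
rewrite ge0_integral_bigcup//.
  exact/measurable_EFinP/measurable_funTS.
by move=> x _; rewrite lee_fin.
Qed.

HB.instance Definition _ := isMeasure.Build _ _ _ dens
  density0 density_ge0 density_sigma_additive.

Import HBNNSimple.

(** Monotone convergence along simple functions below [f], applied on both sides, reduces the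
    formula to indicators. *)
Lemma integral_density (f : T -> \bar R) : (forall x, 0 <= f x) ->
  measurable_fun setT f -> \int[dens]_x f x = \int[m]_x (f x * (g x)%:E).
Proof.
move=> f0 mf; pose f_ := nnsfun_approx measurableT mf.
have f_lim x : EFin \o f_ ^~ x @ \oo --> f x by apply: cvg_nnsfun_approx.
transitivity (limn (fun n => \int[dens]_x (f_ n x)%:E)).
  rewrite -monotone_convergence//=.
  - by apply: eq_integral => x _; apply/esym/cvg_lim => //; exact: f_lim.
  - by move=> n; exact/measurable_EFinP/measurable_funTS.
  - by move=> n x _; rewrite lee_fin.
  - by move=> x _ a b ab; rewrite lee_fin; exact/lefP/nd_nnsfun_approx.
transitivity (limn (fun n => \int[m]_x ((f_ n x)%:E * (g x)%:E))); last first.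
  rewrite -monotone_convergence//=.
  - apply: eq_integral => x _; apply/cvg_lim => //.
    by apply: cvgeZr => //; exact: f_lim.
  - by move=> n; apply: emeasurable_funM; apply/measurable_EFinP => //; exact/measurable_funTS.
  - by move=> n x _; rewrite mule_ge0// ?lee_fin.
  - by move=> x _ a b ab; apply: lee_wpmul2r; rewrite lee_fin//; exact/lefP/nd_nnsfun_approx.
congr (limn _); apply/funext => n.
have rf0 r x : (0 <= r * \1_(f_ n @^-1` [set r]) x)%R.
  have [r0|r0] := leP 0%R r; first by rewrite mulr_ge0.
  by rewrite preimage_nnfun0// indic0 mulr0.
have fE x : (f_ n x)%:E = \sum_(r \in range (f_ n)) (r * \1_(f_ n @^-1` [set r]) x)%:E.
  by rewrite fimfunE -fsumEFin.
transitivity (\int[dens]_x \sum_(r \in range (f_ n)) (r * \1_(f_ n @^-1` [set r]) x)%:E).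
  by apply: eq_integral => x _.
rewrite ge0_integral_fsum//; last 2 first.
  - by move=> r; apply/measurable_EFinP/measurable_funM.
  - by move=> r x _; rewrite nnfun_muleindic_ge0.
transitivity (\sum_(r \in range (f_ n))
    \int[m]_x ((r * \1_(f_ n @^-1` [set r]) x)%:E * (g x)%:E)); last first.
  rewrite -ge0_integral_fsum//; last 2 first.
  - move=> r; apply: emeasurable_funM; last exact/measurable_EFinP.
    by apply/measurable_EFinP/measurable_funM.
  - by move=> r x _; rewrite mule_ge0// ?lee_fin// nnfun_muleindic_ge0.
  apply: eq_integral => x _; rewrite fE ge0_mule_fsuml// => r.
  by rewrite nnfun_muleindic_ge0.
apply: eq_fsbigr => r _; rewrite integralZl_indic_nnsfun// integral_indic// setIT.
have [r0|r0] := leP 0%R r; last first.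
  rewrite preimage_nnfun0// measure0 mule0; apply/esym/integral0_eq => x _.
  by rewrite indic0/= mulr0 mul0e.
under [RHS]eq_integral do rewrite EFinM -muleA.
rewrite ge0_integralZl//=.
- congr (_ * _).
  rewrite /density integral_mkcond; apply: eq_integral => x _.
  by rewrite patchE indicE; case: ifPn => _; rewrite ?mul1e ?mul0e.
- by apply: emeasurable_funM; exact/measurable_EFinP.
- by move=> x _; rewrite mule_ge0// ?lee_fin.
Qed.

End density.

Section measures.
Local Open Scope ereal_scope.
Context d (T : measurableType d) (R : realType).

Lemma probability_of (m : {measure set T -> \bar R}) : m setT = 1 ->
  {P : probability T R | forall A, P A = m A}.
Proof.
move=> m1.
exists (mnormalize m (dirac point : probability T R)).
move=> A; rewrite /= /mnormalize m1 /= onee_eq0/= invr1 mule1//.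
Qed.

Lemma integral_EFin_indic_mul (m : {measure set T -> \bar R}) (A : set T) (f : T -> \bar R) :
  measurable A -> \int[m]_x ((\1_A x)%:E * f x) = \int[m]_(x in A) f x.
Proof.
move=> mA; rewrite [RHS]integral_mkcond; apply: eq_integral => x _.
by rewrite patchE indicE; case: ifPn => _; rewrite ?mul1e ?mul0e.
Qed.

Lemma integral_gt0 (m : {measure set T -> \bar R}) (A : set T) (f : T -> \bar R) :
  measurable A -> measurable_fun A f -> (forall x, A x -> 0 < f x) -> 0 < m A ->
  0 < \int[m]_(x in A) f x.
Proof.
move=> mA mf f0 mA0; rewrite lt_neqAle integral_ge0 ?andbT; last first.
  by move=> x /f0/ltW.
apply/eqP => If.
have /(ae_eq_integral_abs m mA mf)[N [mN N0 AN]] : \int[m]_(x in A) `|f x| = 0.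
  by rewrite [RHS]If; apply: eq_integral => x /set_mem/f0/ltW/gee0_abs.
have AleN : m A <= m N.
  apply: le_measure; rewrite ?inE// => x Ax.
  apply: AN => /(_ Ax) /= fx0; have := f0 _ Ax.
  by rewrite fx0 ltxx.
have : m A <= 0 by apply: (le_trans AleN); rewrite le_eqVlt; apply/orP; left; apply/eqP.
by rewrite leNgt mA0.
Qed.

Lemma lt_integral (m : {measure set T -> \bar R}) (A : set T) (f g : T -> \bar R) :
  measurable A -> measurable_fun A f -> measurable_fun A g ->
  (forall x, A x -> 0 <= f x) -> (forall x, A x -> f x < g x) -> 0 < m A ->
  \int[m]_(x in A) f x < +oo -> \int[m]_(x in A) f x < \int[m]_(x in A) g x.
Proof.
move=> mA mf mg f0 fg mA0 If.
have fA x : A x -> f x \is a fin_num.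
  by move=> Ax; rewrite ge0_fin_numE ?f0// (lt_le_trans (fg x Ax))// leey.
have -> : \int[m]_(x in A) g x = \int[m]_(x in A) (f x + (g x - f x)).
  by apply: eq_integral => x /set_mem/fA fx; rewrite addeC subeK.
have mgf : measurable_fun A (fun x => g x - f x) by exact: emeasurable_funB.
rewrite ge0_integralD//; last by move=> x Ax; rewrite sube_ge0 ?fA// ltW// fg.
rewrite lteDl; last first.
  by rewrite ge0_fin_numE//; apply: integral_ge0.
by apply: integral_gt0 => // x Ax; rewrite sube_gt0 fg.
Qed.

(* normalised restriction *)
Lemma restriction_probability (m : {measure set T -> \bar R}) (A : set T) (c : R) :
  measurable A -> (0 < c)%R -> m A = c%:E ->
  exists P : probability T R, [/\ forall X, measurable X -> P X = c^-1%:E * m (X `&` A) &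
   forall f : T -> \bar R, (forall x, 0 <= f x) -> measurable_fun setT f ->
    \int[P]_x f x = c^-1%:E * \int[m]_(x in A) f x].
Proof.
move=> mA c0 mAc.
have ci0 : (0 <= c^-1)%R by rewrite invr_ge0 ltW.
pose m' := mscale (NngNum ci0) (mrestr m mA).
have m'1 : m' setT = 1.
  by rewrite /m' /mscale /= /mrestr setTI mAc -EFinM mulVf// gt_eqF.
have [P PE] := probability_of m'1.
exists P; split => [X mX|f f0 mf]; first by rewrite PE.
rewrite [LHS](eq_measure_integral m') => [|X mX _]; last exact: PE.
rewrite ge0_integral_mscale//=; congr (_ * _).
have g0 x : (0 <= \1_A x :> R)%R by [].
have mg : measurable_fun setT (\1_A : T -> R) by exact: measurable_indic.
rewrite [LHS](eq_measure_integral (density m g0 mg)) => [|X mX _]; last first.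
  by rewrite /= /mrestr setIC; apply/esym; exact: integral_indic.
rewrite integral_density//; under eq_integral do rewrite muleC.
by rewrite integral_EFin_indic_mul.
Qed.

(** Convex combinations are the admissible variations of a minimiser of the energy. *)
Lemma mixture_probability (P Q : probability T R) (e : R) :
  (0 <= e <= 1)%R ->
  exists M : probability T R, [/\ forall X, measurable X -> M X = (1 - e)%:E * P X + e%:E * Q X &
   forall f : T -> \bar R, (forall x, 0 <= f x) -> measurable_fun setT f ->
    \int[M]_x f x = (1 - e)%:E * \int[P]_x f x + e%:E * \int[Q]_x f x].
Proof.
move=> /andP[e0 e1].
have e1' : (0 <= 1 - e)%R by rewrite subr_ge0.
pose m := measure_add (mscale (NngNum e1') P) (mscale (NngNum e0) Q).
have m1 : m setT = 1.
  rewrite /m measure_addE /= /mscale /= !probability_setT !mule1 -EFinD.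
  by rewrite subrK.
have [M ME] := probability_of m1.
exists M; split => [X mX|f f0 mf]; first by rewrite ME; exact: measure_addE.
rewrite [LHS](eq_measure_integral m) => [|X mX _]; last exact: ME.
by rewrite ge0_integral_measure_add// !ge0_integral_mscale.
Qed.

End measures.

Section full_measure.
Local Open Scope ereal_scope.
Context d (T : measurableType d) (R : realType) (P : probability T R).

Lemma probability1_setC (K : set T) : measurable K -> P K = 1 -> P (~` K) = 0.
Proof. by move=> mK PK; rewrite probability_setC// PK subee. Qed.

Lemma probability_setI1 (K A : set T) : measurable K -> measurable A ->
  P K = 1 -> P (K `&` A) = P A.
Proof.
move=> mK mA PK; rewrite setIC.
suff AK : P (A `\` K) = 0.
  have /esym := measureDI P mA mK.
  by rewrite [X in X + _](_ : _ = 0)// add0e.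
apply/eqP; rewrite eq_le measure_ge0 andbT -(probability1_setC mK PK).
by apply: le_measure; rewrite ?inE; [exact: measurableD|exact: measurableC|move=> x []].
Qed.

Lemma integral_probability1 (K : set T) (f : T -> \bar R) : measurable K ->
  P K = 1 -> measurable_fun setT f -> (forall x, 0 <= f x) ->
  \int[P]_(x in K) f x = \int[P]_x f x.
Proof.
move=> mK PK mf f0.
rewrite [RHS](ge0_negligible_integral (measurableC mK) measurableT mf)//.
  by rewrite setTD setCK.
exact: probability1_setC.
Qed.

Lemma le_integral_full (K : set T) (f g : T -> \bar R) : measurable K -> P K = 1 ->
  measurable_fun setT f -> (forall x, 0 <= f x) -> measurable_fun setT g -> (forall x, 0 <= g x) ->
  (forall x, K x -> f x <= g x) -> \int[P]_x f x <= \int[P]_x g x.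
Proof.
move=> mK PK mf f0 mg g0 fg.
rewrite -(integral_probability1 mK PK mf f0) -(integral_probability1 mK PK mg g0).
by apply: ge0_le_integral => //; exact: measurable_funTS.
Qed.

End full_measure.

Section pushforward_measures.
Local Open Scope ereal_scope.
Context d (T : measurableType d) (R : realType).

Lemma pushforward_probability d' (T' : measurableType d') (P : probability T R)
  (phi : T -> T') : measurable_fun setT phi ->
  exists Q : probability T' R, [/\ forall X, measurable X -> Q X = P (phi @^-1` X) &
   forall f : T' -> \bar R, (forall x, 0 <= f x) -> measurable_fun setT f ->
    \int[Q]_x f x = \int[P]_x f (phi x)].
Proof.
move=> mphi.
pose m : {measure set T' -> \bar R} := measure_function_pushforward__canonical__measure_function_Measure P mphi.
have m1 : m setT = 1 by rewrite /m/= /pushforward preimage_setT probability_setT.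
have [Q QE] := probability_of m1.
exists Q; split => [X mX|f f0 mf]; first by rewrite QE.
rewrite [LHS](eq_measure_integral m) => [|X mX _]; last exact: QE.
by rewrite ge0_integral_pushforward.
Qed.

End pushforward_measures.

(** * Minimisers of the energy of a nonnegative symmetric kernel *)

Section energy.
Local Open Scope ereal_scope.
Context d (T : measurableType d) (R : realType).
Variable h : T -> T -> \bar R.
Hypotheses (h0 : forall x y, 0 <= h x y) (hC : forall x y, h x y = h y x)
  (mh : measurable_fun [set: T * T] (fun z => h z.1 z.2)).

Definition potential (Q : {measure set T -> \bar R}) (x : T) := \int[Q]_y h x y.
Definition mutual (P Q : {measure set T -> \bar R}) := \int[P]_x potential Q x.

Lemma measurable_ker_section x : measurable_fun setT (h x).
Proof. have mx : measurable_fun setT (pair x : T -> T * T) by exact: measurable_fun_pair.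
exact: (measurableT_comp mh mx). Qed.

Lemma potential_ge0 (Q : {measure set T -> \bar R}) x : 0 <= potential Q x.
Proof. by apply: integral_ge0. Qed.

Lemma measurable_potential (Q : {sigma_finite_measure set T -> \bar R}) :
  measurable_fun setT (potential Q).
Proof.
exact: (measurable_fun_fubini_tonelli_F (m2 := Q) (fun z => h z.1 z.2)).
Qed.

Lemma mutual_ge0 (P Q : {measure set T -> \bar R}) : 0 <= mutual P Q.
Proof. by apply: integral_ge0 => x _; exact: potential_ge0. Qed.

Lemma mutualC (P Q : {sigma_finite_measure set T -> \bar R}) : mutual P Q = mutual Q P.
Proof.
rewrite /mutual /potential (fubini_tonelli (m1 := P) (m2 := Q) (fun z => h z.1 z.2))//.
by apply: eq_integral => y _; apply: eq_integral => x _; rewrite /= hC.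
Qed.

Definition minimizer (K : set T) (P : probability T R) :=
  [/\ P K = 1, mutual P P < +oo &
    forall Q : probability T R, Q K = 1 -> mutual P P <= mutual Q Q].

Section minimizer.
Variables (K : set T) (P : probability T R).
Hypotheses (mK : measurable K) (minP : minimizer K P).

(** First variation: the energy of (1 - e) P + e Q is a quadratic polynomial in e, minimal at e = 0
    on [0, 1], so its derivative at 0, twice the difference of the two sides, is nonnegative. *)
Lemma minimizer_mutual_ge (Q : probability T R) : Q K = 1 ->
  mutual Q Q < +oo -> mutual P P <= mutual P Q.
Proof.
move=> QK QQ; case: minP => PK PP Pmin.
have [->|PQ] := eqVneq (mutual P Q) +oo; first by rewrite leey.
have fin X Y : mutual X Y < +oo -> mutual X Y \is a fin_num.
  by move=> ?; rewrite ge0_fin_numE// mutual_ge0.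
have fPP := fin _ _ PP; have fQQ := fin _ _ QQ.
have fPQ : mutual P Q \is a fin_num by apply: fin; rewrite ltey.
set a := fine (mutual P P); set b := fine (mutual P Q); set c := fine (mutual Q Q).
have aE : mutual P P = a%:E by rewrite fineK.
have bE : mutual P Q = b%:E by rewrite fineK.
have cE : mutual Q Q = c%:E by rewrite fineK.
have key (e : R) : (0 <= e <= 1)%R -> (a <= (1 - e) ^+ 2 * a + 2 * e * (1 - e) * b + e ^+ 2 * c)%R.
  move=> e01; have [M [ME MI]] := mixture_probability P Q e01.
  have MK : M K = 1 by rewrite ME// PK QK !mule1 -EFinD subrK.
  have := Pmin M MK.
  have potM x : potential M x = (1 - e)%:E * potential P x + e%:E * potential Q x.
    by rewrite /potential MI//; exact: measurable_ker_section.
  have e1 : (0 <= 1 - e)%R by case/andP: e01; rewrite subr_ge0.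
  have e0 : (0 <= e)%R by case/andP: e01.
  have IM (X : probability T R) : mutual X M = (1 - e)%:E * mutual X P + e%:E * mutual X Q.
    rewrite /mutual; under eq_integral do rewrite potM.
    rewrite ge0_integralD//.
    - by rewrite !ge0_integralZl_EFin//;
        do ?[by move=> x _; exact: potential_ge0]; exact: measurable_potential.
    - by move=> x _; rewrite mule_ge0 ?lee_fin// potential_ge0.
    - by apply: emeasurable_funM => //; exact: measurable_potential.
    - by move=> x _; rewrite mule_ge0 ?lee_fin// potential_ge0.
    - by apply: emeasurable_funM => //; exact: measurable_potential.
  rewrite IM (mutualC M P) (mutualC M Q) !IM (mutualC Q P).
  rewrite aE bE cE.
  rewrite -(EFinM (1 - e) a) -(EFinM e b) -(EFinM (1 - e) b) -(EFinM e c).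
  rewrite -(EFinD ((1 - e) * a) (e * b)) -(EFinD ((1 - e) * b) (e * c)).
  rewrite -(EFinM (1 - e)) -(EFinM e) -EFinD lee_fin.
  by move=> /le_trans; apply; rewrite le_eqVlt; apply/orP; left; apply/eqP; ring.
rewrite aE bE lee_fin leNgt; apply/negP => ba.
(* [D] is the coefficient of [e ^+ 2] in the quadratic of [key], whose linear coefficient is -2(a -
   b). The [e] chosen below makes the quadratic term at most half of the linear one. *)
pose D := (a - 2 * b + c)%R.
have D1 : (0 < `|D| + 1)%R by rewrite ltr_wpDl.
pose e := Num.min 1%R ((a - b) / (`|D| + 1))%R.
have e0 : (0 < e)%R by rewrite lt_min ltr01/= divr_gt0// subr_gt0.
have e1 : (e <= 1)%R by rewrite ge_min lexx.
have eD : (e * (`|D| + 1) <= a - b)%R by rewrite -ler_pdivlMr// ge_min lexx orbT.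
have := key e; rewrite e1 (ltW e0) => /(_ isT).
have DD : (e * D <= e * (`|D| + 1))%R.
  by rewrite ler_pM2l// (le_trans (ler_norm D))// lerDl.
have eDe : (e * (e * D) <= e * (a - b))%R.
  by rewrite ler_pM2l// (le_trans DD).
have : (0 < e * (a - b))%R by rewrite mulr_gt0// subr_gt0.
by rewrite /D in eDe *; lra.
Qed.

(** If the potential were below the energy V on a set of positive mass, the normalised restriction
    of [P] to it would have finite energy and mutual energy with [P] below V, against the first
    variation. So the potential is at least V almost everywhere; its mean being V, it exceeds V only
    on a null set. *)
Lemma minimizer_potential_ae : P (K `&` [set x | potential P x <= mutual P P]) = 1.
Proof.
case: minP => PK PP Pmin.
set V := mutual P P.
have fV : V \is a fin_num by rewrite ge0_fin_numE// mutual_ge0.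
have mP := measurable_potential P.
have mA : measurable [set x | potential P x < V].
  by rewrite -[X in measurable X]setTI; exact: emeasurable_fun_infty_o.
have mC : measurable [set x | potential P x <= V].
  by rewrite -[X in measurable X]setTI; exact: emeasurable_fun_infty_c.
have A0 : P [set x | potential P x < V] = 0.
  apply/eqP; rewrite eq_le measure_ge0 andbT leNgt; apply/negP => Apos.
  set A := [set x | _] in mA Apos.
  have fA : P A \is a fin_num by rewrite fin_num_measure.
  have c0 : (0 < fine (P A))%R by rewrite fine_gt0// Apos ltey_eq fA.
  have [Q [QE QI]] := restriction_probability mA c0 (esym (fineK fA)).
  have ci : (0 < (fine (P A))^-1)%R by rewrite invr_gt0.
  have QK : Q K = 1.
    transitivity ((fine (P A))^-1%:E * P A).
      by rewrite QE//; congr (_ * _); exact: probability_setI1.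
    by rewrite -[X in _ * X](fineK fA) -EFinM mulVf// gt_eqF.
  have potQ x : potential Q x <= (fine (P A))^-1%:E * potential P x.
    rewrite /potential QI//; last exact: measurable_ker_section.
    apply: lee_wpmul2l; first by rewrite lee_fin ltW.
    apply: ge0_subset_integral => //; exact: measurable_ker_section.
  have QQ : mutual Q Q < +oo.
    rewrite /mutual QI; last 2 first.
      by move=> x; exact: potential_ge0.
      exact: measurable_potential.
    have le1 : \int[P]_(x in A) potential Q x <= (fine (P A))^-1%:E * V.
      apply: (@le_trans _ _ (\int[P]_(x in A) ((fine (P A))^-1%:E * potential P x))).
        apply: ge0_le_integral => //.
        - by move=> x _; exact: potential_ge0.
        - by apply: measurable_funTS; exact: measurable_potential.
        - by apply: measurable_funTS; apply: emeasurable_funM => //.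
      rewrite ge0_integralZl//; last 3 first.
      - exact: measurable_funTS.
      - by move=> x _; exact: potential_ge0.
      - by rewrite lee_fin ltW.
      apply: lee_wpmul2l; first by rewrite lee_fin ltW.
      apply: ge0_subset_integral => // x _; exact: potential_ge0.
    apply: (le_lt_trans (lee_wpmul2l _ le1)); first by rewrite lee_fin ltW.
    by rewrite -(fineK fV) -!EFinM ltry.
  have := minimizer_mutual_ge QK QQ.
  have -> : mutual P Q = (fine (P A))^-1%:E * \int[P]_(x in A) potential P x.
    by rewrite mutualC; apply: QI => // x; exact: potential_ge0.
  apply/negP; rewrite -ltNge.
  have : \int[P]_(x in A) potential P x < \int[P]_(x in A) V.
    apply: lt_integral => //; first exact: measurable_funTS.
    - by move=> x _; exact: potential_ge0.
    - apply: le_lt_trans PP; apply: ge0_subset_integral => // x _.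
      exact: potential_ge0.
  rewrite integral_cst// => H.
  rewrite lte_pdivrMl// muleC; apply: (lt_le_trans H).
  by rewrite le_eqVlt; apply/orP; left; apply/eqP; congr (_ * _); rewrite fineK.
have geV : P [set x | V <= potential P x] = 1.
  have -> : [set x | V <= potential P x] = ~` [set x | potential P x < V].
    by apply/seteqP; split => x /=; rewrite leNgt => /negP.
  by rewrite probability_setC// A0 sube0.
have mG : measurable [set x | V <= potential P x].
  by rewrite -[X in measurable X]setTI; exact: emeasurable_fun_c_infty.
have mN : measurable [set x | V < potential P x].
  by rewrite -[X in measurable X]setTI; exact: emeasurable_fun_o_infty.
have gt0 : P [set x | V < potential P x] = 0.
  apply/eqP; rewrite eq_le measure_ge0 andbT leNgt; apply/negP => Npos.
  set N := [set x | _] in mN Npos.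
  have : mutual P P <= V by [].
  apply/negP; rewrite -ltNge.
  have mNC : measurable ([set x | V <= potential P x] `\` N) by exact: measurableD.
  have GE : [set x | V <= potential P x] = N `|` ([set x | V <= potential P x] `\` N).
    by rewrite setDUK// => x /= /ltW.
  rewrite /mutual -(integral_probability1 mG geV) //; last first.
    by move=> x; exact: potential_ge0.
  rewrite GE.
  rewrite ge0_integral_setU//; last 3 first.
  - by rewrite -GE; exact: measurable_funTS.
  - by move=> x _; exact: potential_ge0.
  - by apply/disj_setPS => x [/= + []].
  have PN : V * P N < \int[P]_(x in N) potential P x.
    rewrite -integral_cst//; apply: lt_integral => //; first exact: measurable_funTS.
    - by move=> x _; exact: mutual_ge0.
    - rewrite integral_cst//; apply: lte_mul_pinfty => //; first exact: mutual_ge0.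
      by rewrite ltey_eq fin_num_measure.
  have PG : V * P ([set x | V <= potential P x] `\` N) <= \int[P]_(x in [set x | V <= potential P x] `\` N) potential P x.
    rewrite -integral_cst//; apply: ge0_le_integral => //.
    - by move=> x _; exact: mutual_ge0.
    - exact: measurable_funTS.
    - by move=> x [].
  have VE : V = V * P N + V * P ([set x | V <= potential P x] `\` N).
    rewrite -muleDr//; last first.
      by apply: ge0_adde_def; rewrite inE.
    rewrite -measureU//; last by rewrite setDE setIC -setIA setICl setI0.
    rewrite -GE -[LHS]mule1; congr (_ * _); exact/esym.
  rewrite {1}VE; apply: lte_leD => //.
  by rewrite fin_numM// fin_num_measure.
have CE : [set x | potential P x <= V] = ~` [set x | V < potential P x].
  by apply/seteqP; split => x /=; rewrite leNgt => /negP.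
have PC : P [set x | potential P x <= V] = 1.
  by rewrite CE probability_setC// gt0 sube0.
transitivity (P [set x | potential P x <= V]) => //.
exact: probability_setI1.
Qed.


End minimizer.

End energy.

(** * Taylor lower bounds for negative powers *)

Section real_powers.
Context {R : realType}.
Implicit Types x b d : R.

Lemma powRN_bernoulli b d : 0 <= b -> -1 < d -> 1 - b * d <= (1 + d) `^ (- b).
Proof.
move=> b0 d1; have d0 : 0 < 1 + d by rewrite -ltrBlDl sub0r.
rewrite /powR gt_eqF// mulNr; apply: le_trans (expR_ge1Dx _).
by rewrite lerD2l lerN2 ler_wpM2l// le_ln1Dx.
Qed.

Lemma derive_sign (F F' : R -> R) :
  (forall x, -1 < x -> is_derive x 1 F (F' x)) -> (forall x, -1 < x -> 0 <= F' x) ->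
  forall x, -1 < x -> (0 <= x -> F 0 <= F x) /\ (x <= 0 -> F x <= F 0).
Proof.
move=> dF F'0 x x1.
have cF a b : -1 < a -> {within `[a, b], continuous F}.
  move=> a1; apply: derivable_within_continuous => y.
  by rewrite in_itv/= => /andP[ay _]; have /dF[] : -1 < y by exact: lt_le_trans ay.
split; rewrite le_eqVlt => /predU1P[e|x0].
- by rewrite -e.
- have [||c] := @MVT _ F F' 0 x x0.
  + by move=> y; rewrite in_itv/= => /andP[y0 _]; apply: dF; lra.
  + by apply: cF; lra.
  + rewrite in_itv/= => /andP[c0 _] E; rewrite -subr_ge0 E mulr_ge0 ?F'0//; lra.
- by rewrite e.
- have [||c] := @MVT _ F F' x 0 x0.
  + by move=> y; rewrite in_itv/= => /andP[y0 _]; apply: dF; lra.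
  + by apply: cF; lra.
  + rewrite in_itv/= => /andP[c0 _] E; rewrite -subr_ge0 E mulr_ge0 ?F'0//; lra.
Qed.

Lemma derive_min (F F' : R -> R) :
  (forall x, -1 < x -> is_derive x 1 F (F' x)) ->
  (forall x, 0 <= x -> 0 <= F' x) -> (forall x, -1 < x -> x <= 0 -> F' x <= 0) ->
  forall x, -1 < x -> F 0 <= F x.
Proof.
move=> dF F'p F'n x x1.
have cF a b : -1 < a -> {within `[a, b], continuous F}.
  move=> a1; apply: derivable_within_continuous => y.
  by rewrite in_itv/= => /andP[ay _]; have /dF[] : -1 < y by exact: lt_le_trans ay.
have [x0|x0|->//] := ltgtP 0 x.
- have [||c] := @MVT _ F F' 0 x x0.
  + by move=> y; rewrite in_itv/= => /andP[y0 _]; apply: dF; lra.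
  + by apply: cF; lra.
  + rewrite in_itv/= => /andP[c0 _] E; rewrite -subr_ge0 E mulr_ge0 ?F'p//; lra.
- have [||c] := @MVT _ F F' x 0 x0.
  + by move=> y; rewrite in_itv/= => /andP[y0 _]; apply: dF; lra.
  + by apply: cF; lra.
  + rewrite in_itv/= => /andP[xc c0] E; rewrite -subr_le0 E.
    by apply: mulr_le0_ge0; [apply: F'n; lra|lra].
Qed.

(** The difference [F] of the two sides has F(0) = F'(0) = 0, and F'' >= 0 is Bernoulli's inequality
    with exponent b + 2; so 0 is a minimum of [F], whatever the sign of [d]. *)
Lemma powRN_taylor3 b d : 0 <= b -> -1 < d ->
  1 - b * d + b * (b + 1) / 2 * d ^+ 2 - b * (b + 1) * (b + 2) / 6 * d ^+ 3
    <= (1 + d) `^ (- b).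
Proof.
move=> b0 d1.
pose F x := (1 + x) `^ (- b) + (- 1 + b * x - b * (b + 1) / 2 * x ^+ 2 + b * (b + 1) * (b + 2) / 6 * x ^+ 3).
pose F' x := - b * (1 + x) `^ (- b - 1) + (b - b * (b + 1) * x + b * (b + 1) * (b + 2) / 2 * x ^+ 2).
pose F'' x := b * (b + 1) * (1 + x) `^ (- (b + 2)) + (- (b * (b + 1)) + b * (b + 1) * (b + 2) * x).
have dpow a x : -1 < x -> is_derive x 1 (fun y => (1 + y) `^ a) (a * (1 + x) `^ (a - 1)).
  move=> x1; have x0 : 0 < 1 + x by lra.
  have H1 : is_derive (1 + x) 1 (@powR R ^~ a) (a * (1 + x) `^ (a - 1)) by exact: is_derive1_powR.
  have H2 : is_derive x 1 (cst 1 + id) (0 + 1) by apply: is_deriveD.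
  have := is_derive1_comp H1 H2.
  by rewrite add0r mulr1.
have dpol (a0 a1 a2 a3 x : R) : is_derive x 1 (fun y => a0 + a1 * y + a2 * y ^+ 2 + a3 * y ^+ 3) (a1 + 2 * a2 * x + 3 * a3 * x ^+ 2).
  have Hi n := is_deriveX n (is_derive_id x (1 : R)).
  have := is_deriveD (is_deriveD (is_deriveD (is_derive_cst a0 x (1 : R))
    (is_deriveZ a1 (is_derive_id x (1 : R)))) (is_deriveZ a2 (Hi 2%N))) (is_deriveZ a3 (Hi 3%N)).
  rewrite (_ : _ + _ = fun y => a0 + a1 * y + a2 * y ^+ 2 + a3 * y ^+ 3); last by apply/funext.
  by move=> H; apply: is_derive_eq; rewrite /GRing.scale /=; ring.
have dF x : -1 < x -> is_derive x 1 F (F' x).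
  move=> x1; have H := dpow (- b) x x1.
  have := is_deriveD H (dpol (- 1) b (- (b * (b + 1) / 2)) (b * (b + 1) * (b + 2) / 6) x).
  rewrite (_ : _ + _ = F); last first.
    by apply/funext => y; rewrite /F !fctE; field.
  by move=> ?; apply: is_derive_eq; rewrite /F'; field.
have dF' x : -1 < x -> is_derive x 1 F' (F'' x).
  move=> x1; have H := dpow (- b - 1) x x1.
  have := is_deriveD (is_deriveZ (- b) H) (dpol b (- (b * (b + 1))) (b * (b + 1) * (b + 2) / 2) 0 x).
  rewrite (_ : _ + _ = F'); last first.
    by apply/funext => y; rewrite /F' !fctE -[X in X + _ = _]/(- b * _); field.
  move=> ?; apply: is_derive_eq; rewrite /F'' -[X in X + _ = _]/(- b * _).
  rewrite (_ : - b - 1 - 1 = - (b + 2)); last by ring.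
  by field.
have F''0 x : -1 < x -> 0 <= F'' x.
  move=> x1; have b2 : 0 <= b + 2 by lra.
  have bb : 0 <= b * (b + 1) by rewrite mulr_ge0//; lra.
  have := ler_wpM2l bb (powRN_bernoulli b2 x1); rewrite /F''.
  lra.
have F'00 : F' 0 = 0 by rewrite /F' addr0 powR1; ring.
have := derive_min dF _ _ d1.
rewrite {1}/F addr0 powR1 => H.
have {H}: 0 <= F d.
  apply: le_trans (H _ _); first by rewrite !expr0n/=; lra.
  - by move=> x x0; rewrite -F'00; apply: (derive_sign dF' F''0 _).1 => //; lra.
  - by move=> x x0 x1; rewrite -F'00; apply: (derive_sign dF' F''0 _).2 => //; lra.
rewrite /F; lra.
Qed.

End real_powers.

(** * The Euclidean norm *)

Section enorm.
Context {R : realType} {n : nat}.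
Implicit Types x y z : 'rV[R]_n.

Lemma enorm_ge0 x : 0 <= enorm x.
Proof. exact: sqrtr_ge0. Qed.

Lemma sqr_enorm x : enorm x ^+ 2 = \sum_(i < n) x ord0 i ^+ 2.
Proof. by rewrite sqr_sqrtr// sumr_ge0// => i _; exact: sqr_ge0. Qed.

Lemma ler_enorm x y : (forall i, `|x ord0 i| <= `|y ord0 i|) -> enorm x <= enorm y.
Proof.
move=> xy; rewrite ler_wsqrtr// ler_sum// => i _.
by rewrite -(real_normK (num_real (x _ _))) -(real_normK (num_real (y _ _))) lerXn2r ?nnegrE.
Qed.

Lemma enorm_eq x y : (forall i, `|x ord0 i| = `|y ord0 i|) -> enorm x = enorm y.
Proof. by move=> xy; apply/eqP; rewrite eq_le !ler_enorm// => i; rewrite xy. Qed.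

Lemma ler_coord_enorm x i : `|x ord0 i| <= enorm x.
Proof.
rewrite -sqrtr_sqr ler_wsqrtr// (bigD1 i)//= lerDl sumr_ge0// => j _.
exact: sqr_ge0.
Qed.

Lemma ler_norm_enorm x : `|x| <= enorm x.
Proof. by apply/rV_norm_leP => [|i]; [exact: enorm_ge0|exact: ler_coord_enorm]. Qed.

Lemma enorm0 : enorm (0 : 'rV[R]_n) = 0.
Proof. by rewrite /enorm big1 ?sqrtr0// => i _; rewrite mxE expr0n. Qed.

Lemma enorm_eq0 x : (enorm x == 0) = (x == 0).
Proof.
apply/eqP/eqP => [x0|->]; last exact: enorm0.
by apply/eqP; rewrite -normr_le0 -x0 ler_norm_enorm.
Qed.

Lemma enorm_gt0 x : (0 < enorm x) = (x != 0).
Proof. by rewrite lt_neqAle enorm_ge0 andbT eq_sym enorm_eq0. Qed.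

Lemma enormZ (c : R) x : enorm (c *: x) = `|c| * enorm x.
Proof.
rewrite -sqrtr_sqr -sqrtrM ?sqr_ge0//; congr Num.sqrt.
by rewrite mulr_sumr; apply: eq_bigr => i _; rewrite mxE exprMn.
Qed.

Lemma enormN x : enorm (- x) = enorm x.
Proof. by apply: enorm_eq => i; rewrite mxE normrN. Qed.

Lemma enormB x y : enorm (x - y) = enorm (y - x).
Proof. by rewrite -enormN opprB. Qed.

Lemma dot_le_enorm x y : \sum_(i < n) x ord0 i * y ord0 i <= enorm x * enorm y.
Proof.
have [x0|x0] := eqVneq x 0.
  by rewrite x0 enorm0 mul0r big1// => i _; rewrite mxE mul0r.
have [y0|y0] := eqVneq y 0.
  by rewrite y0 enorm0 mulr0 big1// => i _; rewrite mxE mulr0.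
rewrite -!enorm_gt0 in x0 y0.
set a := enorm x in x0 *; set b := enorm y in y0 *.
suff: (2 * (a * b)) * \sum_(i < n) x ord0 i * y ord0 i <= (2 * (a * b)) * (a * b).
  by rewrite ler_pM2l// !mulr_gt0.
apply: (@le_trans _ _ (b ^+ 2 * \sum_(i < n) x ord0 i ^+ 2 + a ^+ 2 * \sum_(i < n) y ord0 i ^+ 2)); last first.
  by rewrite -!sqr_enorm -/a -/b; lra.
rewrite !mulr_sumr -big_split ler_sum// => i _ /=.
have := sqr_ge0 (b * x ord0 i - a * y ord0 i); lra.
Qed.

Lemma ler_enormD x y : enorm (x + y) <= enorm x + enorm y.
Proof.
rewrite -(@ler_pXn2r _ 2)// ?nnegrE ?addr_ge0 ?enorm_ge0//.
rewrite sqr_enorm sqrrD !sqr_enorm.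
under eq_bigr do rewrite mxE sqrrD.
rewrite !big_split /= lerD2r lerD2l mulr2n.
by rewrite lerD// dot_le_enorm.
Qed.

Lemma ler_enorm_dist x y z : enorm (x - z) <= enorm (x - y) + enorm (y - z).
Proof. by rewrite -[x - z](subrKA y) ler_enormD. Qed.

Lemma enorm_le x : enorm x <= n%:R * `|x|.
Proof.
have x0 := normr_ge0 x.
rewrite -(@ler_pXn2r _ 2)// ?nnegrE ?mulr_ge0 ?enorm_ge0//.
rewrite sqr_enorm.
apply: (@le_trans _ _ (\sum_(i < n) `|x| ^+ 2)).
  apply: ler_sum => i _.
  rewrite -(real_normK (num_real (x _ _))) lerXn2r ?nnegrE//.
  exact: ((rV_norm_leP x x0).1 (lexx _)).
rewrite sumr_const card_ord -[leLHS]mulr_natl exprMn ler_wpM2r ?sqr_ge0//.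
by rewrite -natrX ler_nat; case: (n) => // k; rewrite -[leqLHS]expn1 leq_pexp2l.
Qed.

Lemma continuous_enorm : continuous (@enorm R n).
Proof.
move=> x; have FF := nbhs_filter (x : 'rV[R]_n); apply/(@cvgrPdist_lt _ _ _ (nbhs x) FF) => e e0.
near=> y.
have xy : `|x - y| < e / n.+1%:R.
  near: y; apply/nbhs_ballP; exists (e / n.+1%:R) => /=; first by rewrite divr_gt0.
  by move=> y; rewrite -ball_normE.
apply: (@le_lt_trans _ _ (enorm (x - y))).
  have := ler_enormD (x - y) y; have := ler_enormD (y - x) x; rewrite !subrK.
  rewrite (enormB y x) ler_norml; lra.
apply: (le_lt_trans (enorm_le _)).
apply: (@le_lt_trans _ _ (n.+1%:R * `|x - y|)).
  by rewrite ler_wpM2r// ler_nat.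
by rewrite mulrC -ltr_pdivlMr.
Unshelve. all: by end_near. Qed.

Lemma closed_origin_ball (r : R) : closed (origin_ball r : set 'rV[R]_n).
Proof.
rewrite (_ : origin_ball r = @enorm R n @^-1` [set t | t <= r])//.
by apply: closed_comp => [x _|]; [exact: continuous_enorm|exact: closed_le].
Qed.

Lemma compact_origin_ball (r : R) : compact (origin_ball r : set 'rV[R]_n).
Proof.
apply: bounded_closed_compact; last exact: closed_origin_ball.
exists r; split; first exact: num_real.
move=> M rM x /= xr; apply: (le_trans (ler_norm_enorm x)).
exact: (le_trans xr (ltW rM)).
Qed.

End enorm.

(** * Radial profile of the kernel *)

Section profile.
Context {R : realType}.
Implicit Types (p m t : R).

Definition raw_profile p t : R := if p == 0 then - ln t else t `^ (- p).

(** Clamping at 0 keeps every kernel nonnegative, so that Tonelli applies throughout. Under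
    [admissible] the clamp is inactive up to distance [D] ([profileE]). *)
Definition profile p m t : R := Num.max 0 (raw_profile p t + m).

Lemma profile_ge0 p m t : 0 <= profile p m t.
Proof. by rewrite le_max lexx. Qed.

Lemma measurable_profile p m : measurable_fun setT (profile p m).
Proof.
apply: measurable_maxr => //; apply: measurable_funD => //.
rewrite /raw_profile; case: eqP => _; last exact: measurable_powR.
by apply: measurableT_comp => //; exact: measurable_ln.
Qed.

Lemma raw_profile_lip p d a b : 0 <= p -> 0 < d -> d <= a -> a <= b ->
  0 <= raw_profile p a - raw_profile p b <= (d^-1 + p * d `^ (- p - 1)) * (b - a).
Proof.
move=> p0 d0 da ab; have a0 : 0 < a by exact: lt_le_trans da.
have b0 : 0 < b by exact: lt_le_trans ab.
have lnab : 0 <= ln b - ln a <= (b - a) / a.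
  rewrite subr_ge0 ler_ln ?posrE// ab/= -ln_div ?posrE//.
  rewrite (_ : b / a = 1 + (b - a) / a); last by field; rewrite gt_eqF.
  apply: le_ln1Dx; apply: (@lt_le_trans _ _ 0); first by rewrite ltrN10.
  by rewrite divr_ge0 ?subr_ge0// ltW.
have ba0 : 0 <= b - a by rewrite subr_ge0.
have aV : (b - a) / a <= d^-1 * (b - a).
  by rewrite mulrC ler_wpM2r// lef_pV2 ?posrE.
have dp0 : 0 <= p * d `^ (- p - 1) by rewrite mulr_ge0 ?powR_ge0.
rewrite /raw_profile; case: eqP => [p00|/eqP pn0].
  rewrite mulrDl; have := mulr_ge0 dp0 ba0; case/andP: lnab; lra.
have pp : 0 < p by rewrite lt_neqAle eq_sym pn0.
have da' : a `^ (- p - 1) <= d `^ (- p - 1).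
  rewrite -opprD !powRN lef_pV2 ?posrE ?powR_gt0//.
  apply: ge0_ler_powR; rewrite ?nnegrE ?(ltW d0) ?(ltW a0)//; lra.
have E : b `^ (- p) = a `^ (- p) * expR (- p * (ln b - ln a)).
  by rewrite /powR !gt_eqF// -expRD; congr expR; ring.
have apa : a `^ (- p) = a `^ (- p - 1) * a.
  by rewrite -[X in _ * X](powRr1 (ltW a0)) -powRD ?subrK//; apply/implyP => _; rewrite gt_eqF.
have ap0 := powR_ge0 a (- p); have ap10 := powR_ge0 a (- p - 1).
apply/andP; split.
  rewrite E -[X in X - _]mulr1 -mulrBr mulr_ge0// subr_ge0 -[leRHS]expR0 ler_expR.
  by case/andP: lnab => ? _; rewrite mulNr oppr_le0 mulr_ge0.
have := expR_ge1Dx (- p * (ln b - ln a)) => /(ler_wpM2l ap0); rewrite -E => H.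
have lnp : p * (ln b - ln a) <= p * ((b - a) / a).
  by case/andP: lnab => _ ?; rewrite ler_wpM2l.
have := ler_wpM2l ap0 lnp => H2.
have E2 : a `^ (- p) * (p * ((b - a) / a)) = p * a `^ (- p - 1) * (b - a).
  by rewrite apa; field; rewrite gt_eqF.
have H3 : p * a `^ (- p - 1) * (b - a) <= p * d `^ (- p - 1) * (b - a).
  by rewrite ler_wpM2r// ler_wpM2l.
have H4 : 0 <= d^-1 * (b - a) by rewrite mulr_ge0// invr_ge0 ltW.
lra.
Qed.

Lemma profile_nincr p m a b : 0 <= p -> 0 < a -> a <= b -> profile p m b <= profile p m a.
Proof.
move=> p0 a0 ab; have /andP[+ _] := raw_profile_lip p0 a0 (lexx a) ab.
rewrite subr_ge0 => H; rewrite /profile ge_max le_max lexx/=.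
by rewrite le_max lerD2r H orbT.
Qed.

Lemma profile_lip p m d : 0 <= p -> 0 < d -> exists2 L, 0 <= L &
  forall a b, d <= a -> d <= b -> `|profile p m a - profile p m b| <= L * `|a - b|.
Proof.
move=> p0 d0; exists (d^-1 + p * d `^ (- p - 1)).
  by rewrite addr_ge0// ?mulr_ge0// ?powR_ge0// invr_ge0 ltW.
move=> a b; wlog ab : a b / a <= b => [H da db|da db].
  by case/orP: (le_total a b) => ?; [exact: H|rewrite distrC (distrC a); exact: H].
have a0 : 0 < a by exact: lt_le_trans da.
have /andP[h1 h2] := raw_profile_lip p0 d0 da ab.
have h3 := profile_nincr m p0 a0 ab.
rewrite ger0_norm ?subr_ge0// ler0_norm ?subr_le0// opprB.
apply: le_trans h2; rewrite /profile.
case: (leP 0 (raw_profile p a + m)) => ?; case: (leP 0 (raw_profile p b + m)) => ?; lra.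
Qed.

(* The additive constant [m] only serves the logarithmic kernel, where it makes the
   kernel at least 1 up to distance [D]; the Riesz kernels need no correction. *)
Definition admissible p m (D : R) :=
  (p = 0 /\ forall t, 0 < t -> t <= D -> 1 <= m - ln t) \/ (0 < p /\ m = 0).

Lemma profileE p m D t : admissible p m D -> 0 < t -> t <= D ->
  profile p m t = raw_profile p t + m.
Proof.
move=> + t0 tD; rewrite /profile /raw_profile => -[[-> H]|[p0 ->]].
  by rewrite eqxx max_r//; have := H _ t0 tD; lra.
by rewrite gt_eqF// max_r// addr0 powR_ge0.
Qed.

(** The factor 3 is the one lost in [far_nearest]. For the logarithm the additive loss [ln 3]
    becomes a multiplicative one because the shifted profile is at least 1. *)
Lemma profile_comparable p m D : admissible p m D -> exists2 C, 0 < C &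
  forall t t', 0 < t -> t <= D -> 0 < t' -> t' <= D -> t' <= 3 * t ->
   profile p m t <= C * profile p m t'.
Proof.
move=> adm; case: (adm) => [[p0 H]|[p0 m0]].
  have l3 : 0 <= ln 3 :> R by rewrite ln_ge0// ler1n.
  exists (1 + ln 3); first by lra.
  move=> t t' t0 tD t'0 t'D tt'; rewrite !(profileE adm)// /raw_profile p0 eqxx.
  have h1 := H _ t'0 t'D.
  have : ln t' <= ln 3 + ln t by rewrite -lnM ?posrE// ler_ln ?posrE ?mulr_gt0.
  have : ln 3 * 1 <= ln 3 * (m - ln t') by rewrite ler_wpM2l.
  lra.
exists (3 `^ p); first by rewrite powR_gt0.
move=> t t' t0 tD t'0 t'D tt'; rewrite !(profileE adm)// /raw_profile gt_eqF// m0 !addr0.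
rewrite !powRN ler_pdivlMr ?powR_gt0// mulrC ler_pdivrMr ?powR_gt0//.
rewrite -powRM ?(ltW t0)//.
by apply: ge0_ler_powR; rewrite ?nnegrE ?mulr_ge0 ?(ltW p0) ?(ltW t0) ?(ltW t'0).
Qed.

End profile.

(** * Strict subharmonicity as a discrete mean inequality *)

Section strict_mean.
Context {R : realType} {n : nat}.
Implicit Types (p m D s : R) (u : 'rV[R]_n).

Local Notation e_ i := (delta_mx ord0 i : 'rV[R]_n).

Lemma sqr_enorm_addZ_delta u s i :
  enorm (u + s *: e_ i) ^+ 2 = enorm u ^+ 2 + 2 * s * u ord0 i + s ^+ 2.
Proof.
rewrite !sqr_enorm (bigD1 i)//= [in RHS](bigD1 i)//= !mxE !eqxx mulr1.
rewrite (eq_bigr (fun j => u ord0 j ^+ 2)); last first.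
  by move=> j ji; rewrite !mxE (negbTE ji) andbF mulr0 addr0.
by ring.
Qed.

(** In the sum of the lower bounds the part linear in [k] is b k (4 (b + 1) - 2 N) = 2 b k, as N = 2
    b + 1. This is the positive Laplacian of |x|^(-(n-1)); the bound on [k] makes the higher powers
    of [k] too small to cancel it. *)
Lemma sum_powRN_gt (N b k : R) (w : 'I_n -> R) (T : 'I_n -> R) :
  N = n%:R -> 2 <= N -> N = 2 * b + 1 -> 0 < k -> k <= (64 * N ^+ 2)^-1 ->
  \sum_(i < n) w i = 1 ->
  (forall i, 2 - 2 * b * k + b * (b + 1) / 2 * (2 * k ^+ 2 + 8 * k * w i)
     - b * (b + 1) * (b + 2) / 6 * (2 * k ^+ 3 + 24 * k ^+ 2 * w i) <= T i) ->
  2 * N < \sum_(i < n) T i.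
Proof.
move=> Nn N2 Nb k0 kN w1 HT.
have N0 : 0 < N by lra.
have {}kN : k * N ^+ 2 <= 64^-1.
  by move: kN; rewrite invfM -ler_pdivrMr ?invr_gt0 ?exprn_gt0// invrK.
apply: lt_le_trans (ler_sum _ (fun i _ => HT i)).
pose c0 := 2 - 2 * b * k + b * (b + 1) / 2 * (2 * k ^+ 2) - b * (b + 1) * (b + 2) / 6 * (2 * k ^+ 3).
pose c1 := b * (b + 1) / 2 * (8 * k) - b * (b + 1) * (b + 2) / 6 * (24 * k ^+ 2).
rewrite (eq_bigr (fun i => c0 + c1 * w i)); last by move=> i _; rewrite /c0 /c1; field.
rewrite big_split/= sumr_const card_ord -mulr_sumr w1 mulr1 -[c0 *+ n]mulr_natl -Nn.
rewrite -subr_gt0.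
have -> : N * c0 + c1 - 2 * N = (b * k) * (2 + k * (N * (b + 1) - 4 * (b + 1) * (b + 2)) - N * (b + 1) * (b + 2) * k ^+ 2 / 3).
  by rewrite /c0 /c1 Nb; field.
have bN : b = (N - 1) / 2 by lra.
have b0 : 0 < b by lra.
have B : (b + 1) * (b + 2) <= 2 * N ^+ 2 by rewrite bN; nra.
have B0 : 0 <= (b + 1) * (b + 2) by rewrite mulr_ge0//; lra.
have h1 : k * ((b + 1) * (b + 2)) <= 32^-1.
  have := ler_wpM2l (ltW k0) B; lra.
have h2 : k * N <= 64^-1 by have : k * N <= k * N ^+ 2; [rewrite ler_wpM2l ?ltW//; nra|lra].
have h3 : (k * N) * (k * ((b + 1) * (b + 2))) <= 1 * 32^-1.
  apply: ler_pM => //; [by rewrite mulr_ge0 ?ltW|by rewrite mulr_ge0// ltW|lra].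
have h4 : 0 <= k * (N * (b + 1)) by rewrite !mulr_ge0 ?(ltW k0) ?(ltW N0)//; lra.
apply: mulr_gt0; first exact: mulr_gt0.
lra.
Qed.

(** The average over the 2n points u + s e_i, u - s e_i replaces spherical means, so that no
    derivative in several variables occurs. The step [s] is uniform over all [u] of norm between [d]
    and [D]. *)
Lemma profile_strict_mean p m D : (0 < n)%N -> p = n%:R - 1 -> admissible p m D ->
  forall d, 0 < d -> exists s, [/\ 0 < s, s <= 1 &
    forall u, d <= enorm u -> enorm u <= D ->
    (forall i, enorm (u + s *: e_ i) <= D /\ enorm (u - s *: e_ i) <= D) ->
    (forall i, 0 < enorm (u + s *: e_ i) /\ 0 < enorm (u - s *: e_ i)) /\
    2 * n%:R * profile p m (enorm u) <
    \sum_(i < n) (profile p m (enorm (u + s *: e_ i)) + profile p m (enorm (u - s *: e_ i)))].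
Proof.
move=> n0 pn adm d d0.
set N : R := n%:R; have N1 : 1 <= N by rewrite ler1n.
(* The bound 1 keeps the neighbours in a box enlarged by 1; the factor [8 * N] gives
   [k <= (64 * N ^+ 2)^-1] below. *)
pose s := Num.min 1 (d / (8 * N)).
have s0 : 0 < s by rewrite lt_min ltr01 divr_gt0//; lra.
have sd : s * (8 * N) <= d by rewrite -ler_pdivlMr; [rewrite ge_min lexx orbT|lra].
have s8 : s * 8 <= d.
  by apply: le_trans sd; rewrite ler_wpM2l ?(ltW s0)//; lra.
exists s; split => //; first by rewrite ge_min lexx.
move=> u du uD usD.
have es i : enorm (s *: e_ i) = s.
  rewrite enormZ gtr0_norm// /enorm (bigD1 i)//= big1 ?addr0; last first.
    by move=> j ji; rewrite mxE (negbTE ji) andbF expr0n.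
  by rewrite mxE !eqxx expr1n sqrtr1 mulr1.
have pos i : 0 < enorm (u + s *: e_ i) /\ 0 < enorm (u - s *: e_ i).
  have := ler_enormD (u + s *: e_ i) (- (s *: e_ i)).
  have := ler_enormD (u - s *: e_ i) (s *: e_ i).
  by rewrite addrK subrK enormN es; split; lra.
split => //.
have u0 : 0 < enorm u by exact: lt_le_trans du.
rewrite (eq_bigr (fun i => (raw_profile p (enorm (u + s *: e_ i)) + m) +
    (raw_profile p (enorm (u - s *: e_ i)) + m))); last first.
  by move=> i _; have [? ?] := pos i; have [? ?] := usD i; rewrite !(profileE adm).
rewrite (profileE adm)//.
case: adm => [[p0 H]|[p0 m0]].
  have n1 : n = 1%N by apply/eqP; rewrite -(eqr_nat R) -subr_eq0 -pn p0.
  have NE : N = 1 by rewrite /N n1.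
  pose i0 := Ordinal n0.
  have I0 (i : 'I_n) : i != i0 -> False.
    by move=> /eqP; apply; apply: val_inj; case: i => j /=; rewrite n1; case: j.
  rewrite (bigD1 i0)//= big1 ?addr0 => [|i /I0//].
  rewrite NE /raw_profile p0 eqxx.
  have [a0 b0] := pos i0.
  have uE : u ord0 i0 ^+ 2 = enorm u ^+ 2.
    by rewrite sqr_enorm (bigD1 i0)//= big1 ?addr0// => i /I0.
  have a2 := sqr_enorm_addZ_delta u s i0.
  have b2 := sqr_enorm_addZ_delta u (- s) i0; rewrite scaleNr in b2.
  set a := enorm (u + _) in a0 a2 *; set b := enorm (u - _) in b0 b2 *.
  set U := enorm u in u0 uE a2 b2 du *.
  (* In dimension one strict convexity of -log is the strict inequality |u + s| |u - s| < u^2. *)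
  have abE : a * b = U ^+ 2 - s ^+ 2.
    apply/eqP; rewrite -(@eqrXn2 _ 2)//; last 2 first.
    - by rewrite mulr_ge0 ?ltW.
    - by rewrite subr_ge0 lerXn2r ?nnegrE ?(ltW s0) ?(ltW u0)//; lra.
    apply/eqP; rewrite exprMn a2 b2.
    rewrite (_ : (_ + _ + _) * _ = (U ^+ 2 + s ^+ 2) ^+ 2 - 4 * s ^+ 2 * (u ord0 i0) ^+ 2); last by ring.
    by rewrite uE; ring.
  have : ln (a * b) < ln (U ^+ 2).
    rewrite ltr_ln ?posrE ?mulr_gt0 ?exprn_gt0// abE ltrBlDr ltrDl.
    by rewrite exprn_gt0.
  rewrite expr2 !lnM ?posrE//; lra.
have N2 : 2 <= N.
  by rewrite /N ler_nat; have : 0 < n%:R - 1 :> R by [rewrite -pn]; rewrite subr_gt0 ltr1n.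
(* Working with squared norms makes the perturbation polynomial: |u + s e_i|^2 = r (1 + k + c_i) and
   |u - s e_i|^2 = r (1 + k - c_i), so the profile is the power -b of these. The odd powers of [c i]
   cancel in the symmetric sum. *)
pose b := p / 2.
have Nb : N = 2 * b + 1 by rewrite /b pn -/N; field.
have b0 : 0 <= b by rewrite /b; lra.
pose r := enorm u ^+ 2; have r0 : 0 < r by rewrite exprn_gt0.
pose k := s ^+ 2 / r; have k0 : 0 < k by rewrite divr_gt0// exprn_gt0.
have kN : k <= (64 * N ^+ 2)^-1.
  rewrite /k ler_pdivrMr// mulrC ler_pdivlMr; last by rewrite mulr_gt0// exprn_gt0//; lra.
  rewrite (_ : s ^+ 2 * (64 * N ^+ 2) = (s * (8 * N)) ^+ 2); last by ring.
  rewrite /r lerXn2r ?nnegrE ?(ltW u0)//; last exact: le_trans du.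
  by rewrite mulr_ge0 ?(ltW s0)//; lra.
have rawE (v : 'rV[R]_n) d' : 0 < enorm v -> -1 < d' -> enorm v ^+ 2 = r * (1 + d') ->
    raw_profile p (enorm v) = r `^ (- b) * (1 + d') `^ (- b).
  move=> v0 d1 vE; rewrite /raw_profile gt_eqF// -powRM ?(ltW r0)//; last by lra.
  rewrite -vE -powR_mulrn ?(ltW v0)// -powRrM; congr (_ `^ _).
  by rewrite /b; field.
have sr : s ^+ 2 * 64 <= r.
  rewrite (_ : s ^+ 2 * 64 = (s * 8) ^+ 2); last by ring.
  by rewrite /r lerXn2r ?nnegrE ?(ltW u0)//; [rewrite mulr_ge0 ?(ltW s0)|exact: le_trans du].
pose c i := 2 * s * u ord0 i / r.
have c1 i : `|c i| < 1.
  rewrite /c !normrM normfV (gtr0_norm r0) (gtr0_norm s0) ltr_pdivrMr// mul1r ger0_norm//.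
  apply: (@le_lt_trans _ _ (2 * s * enorm u)).
    by rewrite ler_wpM2l ?ler_coord_enorm// mulr_ge0// ltW.
  rewrite /r expr2 ltr_pM2r//; apply: lt_le_trans du; apply: lt_le_trans s8; lra.
have raw0 : raw_profile p (enorm u) = r `^ (- b).
  by rewrite (rawE u 0)// ?addr0 ?powR1 ?mulr1// ltrN10.
have rawp i : raw_profile p (enorm (u + s *: e_ i)) = r `^ (- b) * (1 + (k + c i)) `^ (- b).
  apply: rawE; first by have [] := pos i.
    by have := c1 i; rewrite ltr_norml => /andP[]; lra.
  by rewrite sqr_enorm_addZ_delta /k /c -/r; field; rewrite gt_eqF.
have rawm i : raw_profile p (enorm (u - s *: e_ i)) = r `^ (- b) * (1 + (k - c i)) `^ (- b).
  apply: rawE; first by have [] := pos i.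
    by have := c1 i; rewrite ltr_norml => /andP[]; lra.
  by rewrite -scaleNr sqr_enorm_addZ_delta /k /c -/r; field; rewrite gt_eqF.
rewrite m0 raw0 addr0.
under eq_bigr do rewrite !addr0 rawp rawm -mulrDr.
rewrite -mulr_sumr mulrC ltr_pM2l ?powR_gt0//.
apply: (@sum_powRN_gt N b k (fun i => u ord0 i ^+ 2 / r)) => //.
  by rewrite -mulr_suml -sqr_enorm -/r divff// gt_eqF.
move=> i; have := c1 i; rewrite ltr_norml => /andP[cm cp].
have H1 : -1 < k + c i by lra.
have H2 : -1 < k - c i by lra.
have := powRN_taylor3 b0 H1; have := powRN_taylor3 b0 H2.
have cE : c i ^+ 2 = 4 * k * (u ord0 i ^+ 2 / r).
  by rewrite /c /k; field; rewrite gt_eqF.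
have E2 : (k + c i) ^+ 2 + (k - c i) ^+ 2 = 2 * k ^+ 2 + 8 * k * (u ord0 i ^+ 2 / r).
  by rewrite (_ : _ + _ = 2 * k ^+ 2 + 2 * c i ^+ 2); [rewrite cE|]; ring.
have E3 : (k + c i) ^+ 3 + (k - c i) ^+ 3 = 2 * k ^+ 3 + 24 * k ^+ 2 * (u ord0 i ^+ 2 / r).
  by rewrite (_ : _ + _ = 2 * k ^+ 3 + 6 * k * c i ^+ 2); [rewrite cE|]; ring.
rewrite -E2 -E3.
set A2 := b * (b + 1) / 2; set A3 := b * (b + 1) * (b + 2) / 6.
lra.
Qed.
End strict_mean.

(** * The shifted kernel, its short-range part and its truncation *)

Section nker.
Context {R : realType} {n : nat}.
Variables (p m : R).
Hypothesis p0 : 0 <= p.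
Local Notation E := (borel_rV R n).
Local Notation vec := ('rV[R]_n).
Implicit Types (x y z : vec).

(** The diagonal value is set explicitly because [profile] is real-valued and takes a finite value
    at 0. *)
Definition nker (x y : vec) : \bar R :=
  if enorm (x - y) == 0 then +oo%E else (profile p m (enorm (x - y)))%:E.

Definition tker (c : R) (x y : vec) : \bar R :=
  if enorm (x - y) < c then nker x y else 0%E.

(** Freezing the kernel below distance [d] gives a bounded minorant, Lipschitz in [x]; [tker]
    carries the remaining short-range part ([nker_le]). *)
Definition cker (d : R) (x y : vec) : R := profile p m (Num.max d (enorm (x - y))).

Lemma nker_ge0 x y : (0 <= nker x y)%E.
Proof. by rewrite /nker; case: ifP => // _; rewrite lee_fin profile_ge0. Qed.

Lemma tker_ge0 c x y : (0 <= tker c x y)%E.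
Proof. by rewrite /tker; case: ifP => // _; exact: nker_ge0. Qed.

Lemma nkerC x y : nker x y = nker y x.
Proof. by rewrite /nker enormB. Qed.

Lemma measurable_dist d (T : measurableType d) (f g : T -> E) :
  measurable_fun setT f -> measurable_fun setT g ->
  measurable_fun setT (fun t => enorm ((f t : vec) - (g t : vec)) : R).
Proof.
move=> mf mg; apply: (measurableT_comp measurable_enorm).
exact: measurable_funBrV.
Qed.

Lemma measurable_nker : measurable_fun [set: E * E] (fun z : E * E => nker z.1 z.2).
Proof.
have md : measurable_fun [set: E * E] (fun z : E * E => enorm ((z.1 : vec) - (z.2 : vec)) : R).
  exact: measurable_dist.
rewrite /nker; apply: measurable_fun_ifT => //.
- by apply: measurable_fun_eqr => //; exact: measurable_cst.
- by apply/measurable_EFinP; apply: measurableT_comp md; exact: measurable_profile.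
Qed.

Lemma measurable_tker c : measurable_fun [set: E * E] (fun z : E * E => tker c z.1 z.2).
Proof.
have md : measurable_fun [set: E * E] (fun z : E * E => enorm ((z.1 : vec) - (z.2 : vec)) : R).
  exact: measurable_dist.
rewrite /tker; apply: measurable_fun_ifT => //; last exact: measurable_nker.
by apply: measurable_fun_ltr => //; exact: measurable_cst.
Qed.

Lemma measurable_cker d x : measurable_fun [set: E] (cker d x : E -> R).
Proof.
apply: measurableT_comp; first exact: measurable_profile.
apply: measurable_maxr => //.
by apply: measurable_dist => //; exact: measurable_cst.
Qed.

Lemma measurable_nker_r x : measurable_fun [set: E] (nker x : E -> \bar R).
Proof. exact: (measurable_ker_section (h := nker : E -> E -> _) measurable_nker). Qed.

Lemma measurable_tker_r c x : measurable_fun [set: E] (tker c x : E -> \bar R).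
Proof. exact: (measurable_ker_section (h := tker c : E -> E -> _) (measurable_tker c)). Qed.

Lemma cker_ge0 d x y : 0 <= cker d x y.
Proof. exact: profile_ge0. Qed.

Lemma cker_le d x y : 0 < d -> cker d x y <= profile p m d.
Proof. by move=> d0; apply: profile_nincr => //; rewrite le_max lexx. Qed.

Lemma cker_le_nker d x y : 0 < d -> ((cker d x y)%:E <= nker x y)%E.
Proof.
move=> d0; rewrite /nker; case: eqP => [_|/eqP u0]; first by rewrite leey.
rewrite lee_fin; apply: profile_nincr => //; last by rewrite le_max lexx orbT.
by rewrite lt_neqAle eq_sym u0 enorm_ge0.
Qed.

Lemma cker_nker d x y : 0 < d -> d <= enorm (x - y) -> (cker d x y)%:E = nker x y.
Proof.
move=> d0 du; rewrite /nker gt_eqF ?(lt_le_trans d0)//.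
by rewrite /cker max_r.
Qed.

Lemma nker_le d x y : 0 < d -> (nker x y <= (cker d x y)%:E + tker d x y)%E.
Proof.
move=> d0; rewrite /tker; case: ltP => [_|du].
  by rewrite leeDr// lee_fin cker_ge0.
by rewrite adde0 cker_nker.
Qed.

Lemma cker_lip d : 0 < d -> exists2 L, 0 < L &
  forall x x' y, `|cker d x y - cker d x' y| <= L * enorm (x - x').
Proof.
move=> d0; have [L L0 HL] := profile_lip m p0 d0.
exists (L + 1) => [|x x' y]; first by lra.
have dd t : d <= Num.max d t by rewrite le_max lexx.
apply: (le_trans (HL _ _ (dd _) (dd _))).
apply: (@le_trans _ _ (L * enorm (x - x'))); last by have := enorm_ge0 (x - x'); lra.
rewrite ler_wpM2l//.
have h1 := ler_enorm_dist x x' y; have h2 := ler_enorm_dist x' x y.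
rewrite (enormB x' x) in h2.
rewrite /Num.max; case: (ltP d (enorm (x - y))) => ?; case: (ltP d (enorm (x' - y))) => ?;
  rewrite ler_norml; lra.
Qed.

Lemma nker_mono x x' y : enorm (x' - y) <= enorm (x - y) -> (nker x y <= nker x' y)%E.
Proof.
move=> xx'; rewrite /nker; case: (eqVneq (enorm (x' - y))) => [_|x'0].
  by rewrite leey.
have x'p : 0 < enorm (x' - y) by rewrite lt_neqAle eq_sym x'0 enorm_ge0.
by rewrite gt_eqF ?(lt_le_trans x'p)// lee_fin profile_nincr.
Qed.

Lemma nker_comparable D : admissible p m D -> exists2 C, 0 < C &
  forall x x' y, x != y -> enorm (x - y) <= D -> enorm (x' - y) <= D ->
    enorm (x' - y) <= 3 * enorm (x - y) -> (nker x y <= C%:E * nker x' y)%E.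
Proof.
move=> /profile_comparable[C C0 HC]; exists C => // x x' y xy xD x'D x'3.
rewrite {2}/nker; case: (eqVneq (enorm (x' - y))) => [_|x'0].
  by rewrite gt0_muley ?leey// lte_fin.
have x0 : 0 < enorm (x - y) by rewrite enorm_gt0 subr_eq0.
rewrite /nker gt_eqF// -EFinM lee_fin HC//.
by rewrite lt_neqAle eq_sym x'0 enorm_ge0.
Qed.

End nker.

(** * The maximum principle for potentials *)

Section max_principle.
Context {R : realType} {n : nat}.
Variables (p m rho : R).
Hypotheses (n0 : (0 < n)%N) (pn : p = n%:R - 1) (rho0 : 0 <= rho)
  (adm : admissible p m (n%:R * (2 * rho + 2))).
Local Notation E := (borel_rV R n).
Local Notation vec := ('rV[R]_n).
Local Notation h := (@nker R n p m).
Implicit Types (x y z : vec).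
Variable mu : probability E R.

Let p0 : 0 <= p.
Proof. by rewrite pn subr_ge0 ler1n. Qed.

(** The margin 1 leaves room for the steps s <= 1 of the mean inequality. *)
Lemma box_dist x y : `|x| <= rho + 1 -> `|y| <= rho + 1 ->
  enorm (x - y) <= n%:R * (2 * rho + 2).
Proof.
move=> x1 y1; apply: (le_trans (enorm_le _)); rewrite ler_wpM2l//.
by apply: (le_trans (ler_normB _ _)); lra.
Qed.

(** Coordinatewise projection onto the box. Since the kernel decreases with distance, it turns a
    maximum of a potential over the box into a maximum over the whole space. *)
Lemma clamp z : exists2 z', `|z'| <= rho &
  forall y, `|y| <= rho -> enorm (z' - y) <= enorm (z - y).
Proof.
exists (\row_i Num.max (- rho) (Num.min rho (z ord0 i))).
  apply/rV_norm_leP => // i; rewrite mxE ler_norml le_max lexx/=.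
  by rewrite ge_max ge_min lexx/= andbT (le_trans _ rho0)// oppr_le0.
move=> y /rV_norm_leP yr; apply: ler_enorm => i.
rewrite !mxE; have := yr rho0 i; rewrite ler_norml => /andP[y1 y2].
have := ler_norm (z ord0 i - y ord0 i); have := ler_norm (- (z ord0 i - y ord0 i)).
rewrite normrN ler_norml /Num.max /Num.min.
case: (ltP rho (z ord0 i)) => ?; case: ltP => ?; lra.
Qed.

Local Open Scope ereal_scope.

(** Integrating the strict mean inequality over [A] shows that 2n times the potential at [x] is less
    than the sum of its values at the 2n neighbours, each of which is at most the value at [x]. The
    distance [d] makes the potential at [x] finite, which the strict inequality of integrals
    requires. *)
Lemma no_interior_max (A : set E) x (d : R) : measurable A ->
  (forall y, A y -> `|y| <= rho)%R -> 0 < mu A -> (`|x| <= rho)%R -> (0 < d)%R ->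
  (forall y, A y -> d <= enorm (x - y))%R ->
  (forall z, (`|z| <= rho)%R -> \int[mu]_(y in A) h z y <= \int[mu]_(y in A) h x y) ->
  False.
Proof.
move=> mA Arho A0 xrho d0 Ad xmax.
have mh z : measurable_fun A (h z : E -> \bar R).
  by apply: measurable_funTS; exact: measurable_nker_r.
have {}xmax z : \int[mu]_(y in A) h z y <= \int[mu]_(y in A) h x y.
  have [z' z'r zz'] := clamp z; apply: le_trans (xmax z' z'r).
  apply: ge0_le_integral => // [y _|y /Arho yr]; first exact: nker_ge0.
  by apply: nker_mono => //; exact: zz'.
have [s [s0 s1 Hs]] := profile_strict_mean n0 pn adm d0.
pose e (i : 'I_n) : vec := delta_mx ord0 i.
have es i : (`|s *: e i| <= 1)%R.
  apply/rV_norm_leP => // j; rewrite !mxE normrM (gtr0_norm s0) eqxx/=.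
  by case: eqP => _; rewrite ?normr1 ?mulr1// normr0 mulr0.
have Ahs y : A y -> (2 * n%:R)%:E * h x y <
    \sum_(i < n) (h (x + s *: e i)%R y + h (x - s *: e i)%R y).
  move=> Ay; have dxy := Ad _ Ay.
  have xy0 : (0 < enorm (x - y))%R by exact: lt_le_trans dxy.
  have yr := Arho _ Ay.
  have xyD : (enorm (x - y) <= n%:R * (2 * rho + 2))%R by apply: box_dist; lra.
  have xsD i : (enorm (x - y + s *: e i) <= n%:R * (2 * rho + 2) /\
      enorm (x - y - s *: e i) <= n%:R * (2 * rho + 2))%R.
    have := es i => esi; rewrite [(x - y + _)%R]addrAC [(x - y - _)%R]addrAC.
    split; apply: box_dist; try lra.
    + by apply: (le_trans (ler_normD _ _)); lra.
    + by apply: (le_trans (ler_normB _ _)); lra.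
  have [pos lt_s] := Hs (x - y)%R dxy xyD xsD.
  rewrite (eq_bigr (fun i => (profile p m (enorm (x - y + s *: e i)) +
      profile p m (enorm (x - y - s *: e i)))%:E)); last first.
    move=> i _; have [a0 b0] := pos i.
    rewrite /nker (_ : x + s *: e i - y = x - y + s *: e i)%R; last by rewrite addrAC.
    rewrite (_ : x - s *: e i - y = x - y - s *: e i)%R; last by rewrite addrAC.
    by rewrite !gt_eqF.
  by rewrite sumEFin /nker gt_eqF// -EFinM lte_fin.
have fin : \int[mu]_(y in A) h x y < +oo.
  apply: (@le_lt_trans _ _ (\int[mu]_(y in A) (profile p m d)%:E)).
    apply: ge0_le_integral => // [y _|y Ay]; first exact: nker_ge0.
    by rewrite -(cker_nker p m d0 (Ad _ Ay)) lee_fin cker_le.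
  rewrite integral_cst//; apply: lte_mul_pinfty => //.
    by rewrite lee_fin profile_ge0.
  by rewrite ltey_eq fin_num_measure.
have ge0h z y : 0 <= h z y by exact: nker_ge0.
have : \int[mu]_(y in A) ((2 * n%:R)%:E * h x y) <
    \int[mu]_(y in A) \sum_(i < n) (h (x + s *: e i)%R y + h (x - s *: e i)%R y).
  apply: lt_integral => //.
  - by apply: emeasurable_funM => //; exact: measurable_cst.
  - by apply: emeasurable_sum => i; apply: emeasurable_funD.
  - by move=> y _; rewrite mule_ge0// lee_fin mulr_ge0.
  - rewrite ge0_integralZl ?lee_fin ?mulr_ge0//.
    by apply: lte_mul_pinfty => //; rewrite lee_fin mulr_ge0.
apply/negP; rewrite -leNgt.
rewrite ge0_integral_sum//; last 2 first.
- by move=> i; apply: emeasurable_funD.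
- by move=> i y _; rewrite adde_ge0.
rewrite ge0_integralZl ?lee_fin ?mulr_ge0//.
apply: (@le_trans _ _ (\sum_(i < n) (2%:E * \int[mu]_(y in A) h x y))).
  apply: lee_sum => i _; rewrite ge0_integralD//.
  by rewrite mule_natl mule2n leeD.
have fx : \int[mu]_(y in A) h x y \is a fin_num by rewrite ge0_fin_numE// integral_ge0.
rewrite -(fineK fx) -EFinM sumEFin -EFinM lee_fin sumr_const card_ord.
by rewrite -mulr_natl; lra.
Qed.

End max_principle.

Lemma profile_unbounded (R : realType) (p m M : R) : 0 <= p ->
  exists2 d, 0 < d & forall t, 0 < t -> t <= d -> M <= profile p m t.
Proof.
move=> p0; have [p00|pn0] := eqVneq p 0.
  exists (expR (m - M)); first exact: expR_gt0.
  move=> t t0 td; rewrite /profile /raw_profile p00 eqxx le_max.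
  have : ln t <= ln (expR (m - M)) by rewrite ler_ln// posrE ?expR_gt0.
  by rewrite expRK => ?; apply/orP; right; lra.
have pp : 0 < p by rewrite lt_neqAle eq_sym pn0.
exists (expR (- (`|M - m| / p))); first exact: expR_gt0.
move=> t t0 td; rewrite /profile /raw_profile (negbTE pn0) le_max /powR gt_eqF//.
have : ln t <= ln (expR (- (`|M - m| / p))) by rewrite ler_ln// posrE ?expR_gt0.
rewrite expRK => lt; apply/orP; right.
have H := expR_ge1Dx (- p * ln t).
have : `|M - m| <= - p * ln t.
  by rewrite -[leLHS](divfK pn0) [leRHS]mulNr -mulrN mulrC ler_pM2l// lerNr.
have := ler_norm (M - m); lra.
Qed.

Section max_principle2.
Context {R : realType} {n : nat}.
Variables (p m rho : R).
Hypotheses (n0 : (0 < n)%N) (pn : p = n%:R - 1) (rho0 : 0 <= rho)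
  (adm : admissible p m (n%:R * (2 * rho + 2))).
Local Notation E := (borel_rV R n).
Local Notation vec := ('rV[R]_n).
Local Notation h := (@nker R n p m).
Implicit Types (x y z : vec).
Variable mu : probability E R.

Let p0 : 0 <= p.
Proof. by rewrite pn subr_ge0 ler1n. Qed.

Local Open Scope ereal_scope.

Section restricted.
Variable A : set E.
Hypothesis mA : measurable A.

Definition rpot (x : vec) : \bar R := \int[mu]_(y in A) h x y.
Let mh z : measurable_fun A (h z : E -> \bar R).
Proof. by apply: measurable_funTS; exact: measurable_nker_r. Qed.

Let mc d z : measurable_fun A (fun y : E => (cker p m d z y)%:E : \bar R).
Proof. by apply: measurable_funTS; apply/measurable_EFinP; exact: measurable_cker. Qed.

Let c0 d z y : 0 <= (cker p m d z y)%:E.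
Proof. by rewrite lee_fin cker_ge0. Qed.

Let muA1 : mu A <= 1.
Proof. exact: probability_le1. Qed.

(** The value is packed with its equation so that [cpot] is a real number for every [d],
    characterised by [cpotE] when [d] is positive. *)
Lemma truncated_potential_subproof d x :
  {c : R | (0 < d)%R -> c%:E = \int[mu]_(y in A) (cker p m d x y)%:E}.
Proof.
exists (fine (\int[mu]_(y in A) (cker p m d x y)%:E)) => d0.
rewrite fineK// ge0_fin_numE ?integral_ge0//.
apply: (@le_lt_trans _ _ (\int[mu]_(y in A) (profile p m d)%:E)).
  by apply: ge0_le_integral => // y _; rewrite lee_fin cker_le.
rewrite integral_cst//; apply: lte_mul_pinfty => //.
  by rewrite lee_fin profile_ge0.
by rewrite ltey_eq fin_num_measure.
Qed.

Definition cpot (d : R) (x : vec) : R := sval (truncated_potential_subproof d x).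

Lemma cpotE d x : (0 < d)%R -> (cpot d x)%:E = \int[mu]_(y in A) (cker p m d x y)%:E.
Proof. exact: svalP (truncated_potential_subproof d x). Qed.

Lemma cpot_lip d : (0 < d)%R -> exists2 L, (0 < L)%R &
  forall x x', (cpot d x <= cpot d x' + L * enorm (x - x'))%R.
Proof.
move=> d0; have [L L0 HL] := @cker_lip R n p m p0 d d0.
exists L; first exact: L0.
move=> x x'.
suff : (cpot d x)%:E <= (cpot d x')%:E + (L * enorm (x - x'))%:E.
  by rewrite -EFinD lee_fin.
rewrite [X in X <= _](cpotE x d0) [X in _ <= X + _](cpotE x' d0).

have e0 : (0 <= L * enorm (x - x'))%R by rewrite mulr_ge0 ?enorm_ge0// ltW.
apply: (@le_trans _ _ (\int[mu]_(y in A) ((cker p m d x' y)%:E + (L * enorm (x - x'))%:E))).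
  apply: ge0_le_integral => // [|y _].
    by apply: emeasurable_funD => //; exact: measurable_cst.
  rewrite -EFinD lee_fin -lerBlDl; apply: le_trans (HL x x' y).
  exact: ler_norm.
rewrite ge0_integralD//; rewrite leeD2l// integral_cst//.
rewrite -[leRHS]mule1; apply: lee_wpmul2l => //.
Qed.

Lemma cpot_continuous d : (0 < d)%R -> continuous (cpot d : vec -> R).
Proof.
move=> d0 x; have [L L0 HL] := cpot_lip d0.
have FF := nbhs_filter (x : 'rV[R]_n); apply/(@cvgrPdist_lt _ _ _ (nbhs x) FF) => e e0.
have C0 : (0 < L * n.+1%:R)%R by rewrite mulr_gt0.
near=> y.
have xy : (`|x - y| < e / (L * n.+1%:R))%R.
  near: y; apply/nbhs_ballP; exists (e / (L * n.+1%:R))%R => /=; first by rewrite divr_gt0.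
  by move=> y; rewrite -ball_normE.
have : (L * enorm (x - y) < e)%R.
  apply: (@le_lt_trans _ _ (L * (n.+1%:R * `|x - y|)))%R.
    rewrite ler_wpM2l ?(ltW L0)//; apply: (le_trans (enorm_le _)).
    by rewrite ler_wpM2r// ler_nat.
  by rewrite mulrA mulrC -ltr_pdivlMr.
have := HL x y; have := HL y x; rewrite (enormB y x).
move: (cpot d x) (cpot d y) (L * enorm (x - y))%R => a b c.
by rewrite ltr_norml; lra.
Unshelve. all: by end_near. Qed.

Lemma cpot_le_rpot d x : (0 < d)%R -> (cpot d x)%:E <= rpot x.
Proof.
move=> d0; rewrite [X in X <= _](cpotE x d0); apply: ge0_le_integral => // y _.
exact: cker_le_nker.
Qed.

Lemma cpot_rpot d x : (0 < d)%R -> (forall y, A y -> d <= enorm (x - y))%R ->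
  (cpot d x)%:E = rpot x.
Proof.
move=> d0 Ad; rewrite [LHS](cpotE x d0); apply: eq_integral => y /set_mem/Ad dy.
exact: cker_nker.
Qed.

(* The potential is the supremum of the truncated ones. *)
Lemma rpot_le x (V : \bar R) : (forall d, (0 < d)%R -> (cpot d x)%:E <= V) -> rpot x <= V.
Proof.
move=> HV.
pose d (j : nat) : R := j.+1%:R^-1%R.
have d0 j : (0 < d j)%R by rewrite invr_gt0.
have dle i j : (i <= j)%N -> (d j <= d i)%R.
  by move=> ij; rewrite lef_pV2 ?posrE// ler_nat.
have nd y : nondecreasing_seq (fun j => (cker p m (d j) x y)%:E).
  move=> i j ij; rewrite lee_fin; apply: profile_nincr => //.
    by rewrite lt_max d0.
  by rewrite ge_max !le_max (dle _ _ ij) lexx orbT.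
have cv : \int[mu]_(y in A) (cker p m (d j) x y)%:E @[j --> \oo] --> \int[mu]_(y in A) limn (fun j => (cker p m (d j) x y)%:E).
  by apply: cvg_monotone_convergence => // y _ i j; exact: nd.
have hlim y : h x y <= limn (fun j => (cker p m (d j) x y)%:E).
  have ub j : (cker p m (d j) x y)%:E <= limn (fun j => (cker p m (d j) x y)%:E).
    apply: lime_ge; first exact: ereal_nondecreasing_is_cvgn.
    by near=> k; apply: nd; near: k; exact: nbhs_infty_ge.
  rewrite /nker; case: eqP => [xy0|/eqP xy0].
    rewrite leye_eq; apply/eqP/eqyP => M _.
    have [r r0 Hr] := profile_unbounded m M p0.
    have [j] := ltr_add_invr r0; rewrite add0r => jr.
    apply: le_trans (ub j); rewrite lee_fin /cker xy0 max_l ?(ltW (d0 j))//.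
    by apply: Hr => //; exact: ltW.
  have r0 : (0 < enorm (x - y))%R by rewrite lt_neqAle eq_sym xy0 enorm_ge0.
  have [j] := ltr_add_invr r0; rewrite add0r => jr.
  by apply: le_trans (ub j); rewrite lee_fin /cker max_r// ltW.
apply: (@le_trans _ _ (\int[mu]_(y in A) limn (fun j => (cker p m (d j) x y)%:E))).
  apply: ge0_le_integral => //.
  - by move=> y _; exact: nker_ge0.
  - by apply: emeasurable_fun_cvg (fun j => mc (d j) x) _ => y _; exact: ereal_nondecreasing_is_cvgn.
rewrite -(cvg_lim _ cv)//; apply: lime_le.
  by apply: cvgP cv.
by apply: nearW => j; rewrite -[X in X <= _](cpotE x (d0 j)); exact: HV.
Unshelve. all: by end_near. Qed.
End restricted.

End max_principle2.

Section max_principle3.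
Context {R : realType} {n : nat}.
Variables (p m rho : R).
Hypotheses (n0 : (0 < n)%N) (pn : p = n%:R - 1) (rho0 : 0 <= rho)
  (adm : admissible p m (n%:R * (2 * rho + 2))).
Local Notation E := (borel_rV R n).
Local Notation vec := ('rV[R]_n).
Local Notation h := (@nker R n p m).
Implicit Types (x y z : vec).
Variable mu : probability E R.

Let p0 : 0 <= p.
Proof. by rewrite pn subr_ge0 ler1n. Qed.

Local Open Scope ereal_scope.

Section core.
Variable A : set E.
Hypotheses (mA : measurable A) (Arho : forall y, A y -> (`|y| <= rho)%R).
Variables (V d e C : R).
Hypotheses (V0 : (0 <= V)%R) (AV : forall y, A y -> rpot p m mu A y <= V%:E)
  (d0 : (0 < d)%R) (e0 : (0 <= e)%R) (C0 : (0 < C)%R)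
  (HC : forall x x' y, x != y -> (enorm (x - y) <= n%:R * (2 * rho + 2))%R ->
     (enorm (x' - y) <= n%:R * (2 * rho + 2))%R ->
     (enorm (x' - y) <= 3 * enorm (x - y))%R -> h x y <= C%:E * h x' y)
  (Atail : forall x, A x -> \int[mu]_(y in A) tker p m (3 * d) x y <= e%:E).

Local Notation rpot := (rpot p m mu A).
Local Notation cpot := (cpot m n0 pn mu mA).

Let mh z : measurable_fun A (h z : E -> \bar R).
Proof. by apply: measurable_funTS; exact: measurable_nker_r. Qed.

Let mt c z : measurable_fun A (tker p m c z : E -> \bar R).
Proof. by apply: measurable_funTS; exact: measurable_tker_r. Qed.

Let mc c z : measurable_fun A (fun y : E => (cker p m c z y)%:E : \bar R).
Proof. by apply: measurable_funTS; apply/measurable_EFinP; exact: measurable_cker. Qed.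

(** Complement of the closure of [A]; the points where the potential is continuous. *)
Definition far x := exists2 c, (0 < c)%R & forall y, A y -> (c <= enorm (x - y))%R.

Lemma cpot_mem_le c y : (0 < c)%R -> A y -> (cpot c y <= V)%R.
Proof.
move=> c0 Ay; rewrite -lee_fin; apply: le_trans (AV Ay).
exact: cpot_le_rpot.
Qed.

(** Each truncated potential is continuous and at most [V] on [A], hence on its closure; the
    potential is their supremum. *)
Lemma rpot_near_le x : ~ far x -> rpot x <= V%:E.
Proof.
move=> nfar; apply: (@rpot_le R n p m n0 pn mu A mA x V%:E) => c c0.
rewrite lee_fin.
have [L L0 HL] := cpot_lip m n0 pn mu mA c0.
apply/ler_addgt0Pr => t t0.
have [y Ay xy] : exists2 y, A y & (enorm (x - y) < t / L)%R.
  apply: contrapT => H; apply: nfar; exists (t / L)%R; first exact: divr_gt0.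
  by move=> y Ay; rewrite leNgt; apply/negP => ?; apply: H; exists y.
apply: (le_trans (HL x y)); apply: lerD; first exact: cpot_mem_le.
by rewrite mulrC -ler_pdivlMr// ltW.
Qed.

(** A point of [A] at less than twice the infimum of the distances to [x]: then |x' - y| <= |x' - x|
    + |x - y| <= 3 |x - y|. A nearest point may fail to exist, [A] being only measurable. *)
Lemma far_nearest x : far x -> A !=set0 -> exists2 x', A x' &
  forall y, A y -> (enorm (x' - y) <= 3 * enorm (x - y))%R.
Proof.
move=> [c c0 Hc] [y0 Ay0].
pose D := [set enorm (x - y) | y in A].
have D0 : D !=set0 by exists (enorm (x - y0)), y0.
have Dlb : lbound D c by move=> _ [y Ay <-]; exact: Hc.
have Di : has_inf D by split => //; exists c.
have infc : (c <= inf D)%R by exact: lb_le_inf.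
have i0 : (0 < inf D)%R by exact: lt_le_trans infc.
have [_ [x' Ax' <-] Hx'] := inf_adherent i0 Di.
exists x' => // y Ay.
have H : (inf D <= enorm (x - y))%R by apply: ge_inf; [exists c|exists y].
have := ler_enorm_dist x' x y; rewrite (enormB x' x); lra.
Qed.

(** Moving from [x] to [x'] at most triples distances to [A], so the part of the potential at [x]
    from range [d] is at most [C] times the part at [x'] from range 3d, which is uniformly small on
    [A]. *)
Lemma rpot_far_le x : (`|x| <= rho)%R -> far x -> rpot x <= (cpot d x + C * e)%:E.
Proof.
move=> xr farx; rewrite EFinD [X in _ <= X + _](cpotE m n0 pn mu mA x d0).
apply: (@le_trans _ _ (\int[mu]_(y in A) ((cker p m d x y)%:E + tker p m d x y))).
  apply: ge0_le_integral => //.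
  - by move=> y _; exact: nker_ge0.
  - by apply: emeasurable_funD.
  - by move=> y _; exact: nker_le.
rewrite ge0_integralD//; last 2 first.
- by move=> y _; rewrite lee_fin cker_ge0.
- by move=> y _; exact: tker_ge0.
apply: leeD2l.
have [A0|A0] := pselect (A !=set0); last first.
  rewrite (_ : A = set0); last by apply/eqP/negPn/negP => /set0P.
  by rewrite integral_set0 lee_fin mulr_ge0 ?(ltW C0).
have [x' Ax' Hx'] := far_nearest farx A0.
apply: (@le_trans _ _ (\int[mu]_(y in A) (C%:E * tker p m (3 * d) x' y))).
  apply: ge0_le_integral => //.
  - by move=> y _; exact: tker_ge0.
  - by apply: emeasurable_funM => //; exact: measurable_cst.
  - move=> y Ay; rewrite /tker; case: ltP => [xyd|_]; last first.
      by rewrite mule_ge0 ?lee_fin ?(ltW C0)//; case: ifP => // _; exact: nker_ge0.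
    have [c c0 Hc] := farx.
    rewrite ifT; last by have := Hx' _ Ay; lra.
    have yr := Arho Ay; have x'r := Arho Ax'.
    apply: HC; first by rewrite -subr_eq0 -enorm_gt0 (lt_le_trans c0)// Hc.
    + by apply: box_dist; lra.
    + by apply: box_dist; lra.
    + exact: Hx'.
rewrite ge0_integralZl ?lee_fin ?(ltW C0)//; last by move=> y _; exact: tker_ge0.
by rewrite EFinM; apply: lee_wpmul2l; [rewrite lee_fin ltW|exact: Atail].
Qed.

(** A larger value would force the potential to attain a maximum over the box at a point far from
    [A], which [no_interior_max] excludes. Compactness is applied to a superlevel set of a
    truncated, hence continuous, potential. *)
Lemma rpot_box_le x0 : (`|x0| <= rho)%R -> rpot x0 <= (V + C * e)%:E.
Proof.
move=> x0r; rewrite leNgt; apply/negP => Vx0.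
have Ce0 : (0 <= C * e)%R by rewrite mulr_ge0// ltW.
have far0 : far x0.
  apply: contrapT => /rpot_near_le; apply/negP; rewrite -ltNge.
  by apply: le_lt_trans Vx0; rewrite lee_fin lerDl.
have rfin z c : (0 < c)%R -> (forall y, A y -> (c <= enorm (z - y))%R) -> rpot z = (cpot c z)%:E.
  by move=> c0 Hc; apply/esym; exact: cpot_rpot.
have [c c0 Hc] := far0.
set P0 := cpot c x0; have P0E : rpot x0 = P0%:E by exact: rfin.
(* With this level, [rpot_far_le] puts [x0] in [D], while a far point of the box outside [D] has
   potential below [P0]. *)
pose a := (P0 - C * e)%R.
have aV : (V < a)%R by rewrite /a ltrBrDr -lte_fin -[X in _ < X]P0E.
have [L L0 HL] := cpot_lip m n0 pn mu mA d0.
pose D := [set x : vec | (`|x| <= rho)%R] `&` [set x : vec | (a <= cpot d x)%R].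
have Dx0 : D x0.
  split => //=; have := rpot_far_le x0r far0.
  by rewrite [X in X <= _]P0E lee_fin -lerBlDr.
have cD : compact D.
  apply: bounded_closed_compact.
    exists rho; split; first exact: num_real.
    by move=> M rM x [/= xr _]; apply: (le_trans xr); exact: ltW.
  apply: closedI.
    rewrite (_ : [set _ | _] = (@Num.norm _ _ : vec -> R) @^-1` [set t | t <= rho]%R)//.
    by apply: closed_comp => [x _|]; [exact: norm_continuous|exact: closed_le].
  rewrite (_ : [set _ | _] = (cpot d : vec -> R) @^-1` [set t | a <= t]%R)//.
  by apply: closed_comp => [x _|]; [exact: cpot_continuous|exact: closed_ge].
(* The [L]-Lipschitz function [cpot d] is at most [V] on [A] and at least [a] on [D], so [D] keeps
   distance [c1] from [A], and on [D] the potential equals the continuous [cpot c1]. *)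
pose c1 := ((a - V) / L)%R.
have c10 : (0 < c1)%R by rewrite divr_gt0// subr_gt0.
have Dfar x : D x -> forall y, A y -> (c1 <= enorm (x - y))%R.
  move=> [_ /= ax] y Ay; rewrite ler_pdivrMr// mulrC.
  move: (HL x y) (cpot_mem_le d0 Ay) ax.
  by move: (cpot d x) (cpot d y) (L * enorm (x - y))%R => u v w; lra.
have [x1 Dx1 Hx1] : exists2 x1, D x1 & forall z, D z -> (cpot c1 z <= cpot c1 x1)%R.
  have [|x1 Dx1 Hx1] := @compact_EVT_max vec R (cpot c1) D (ex_intro _ x0 Dx0) cD.
    by apply: continuous_subspaceT; exact: cpot_continuous.
  exists x1; first exact: set_mem.
  by move=> z Dz; apply: Hx1; exact: mem_set.
have x1r : (`|x1| <= rho)%R by case: Dx1.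
have a_x1 : a%:E <= rpot x1.
  apply: (@le_trans _ _ (cpot d x1)%:E); first by rewrite lee_fin; case: Dx1.
  exact: cpot_le_rpot.
have x0x1 : rpot x0 <= rpot x1.
  rewrite [X in X <= _](rfin x0 c1 c10 (Dfar _ Dx0)).
  by rewrite [X in _ <= X](rfin x1 c1 c10 (Dfar _ Dx1)) lee_fin; exact: Hx1.
have Apos : 0 < mu A.
  rewrite lt0e measure_ge0 andbT; apply/eqP => A0.
  have : rpot x0 = 0 by exact: null_set_integral.
  move=> P00; move: Vx0; rewrite P00 lte_fin ltNge => /negP; apply.
  exact: addr_ge0.
(* The maximum over [D] is one over the box: outside [D], points of the closure of [A] give at most
   V < a, and far points give at most [P0]. *)
apply: (no_interior_max n0 pn rho0 adm mA Arho Apos x1r c10 (Dfar _ Dx1)) => z zr.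
have [Dz|nDz] := pselect (D z).
  rewrite [X in X <= _](rfin z c1 c10 (Dfar _ Dz)).
  by rewrite [X in _ <= X](rfin x1 c1 c10 (Dfar _ Dx1)) lee_fin; exact: Hx1.
have [farz|nfarz] := pselect (far z); last first.
  apply: (le_trans (rpot_near_le nfarz)); apply: le_trans a_x1.
  by rewrite lee_fin ltW.
apply: (le_trans (rpot_far_le zr farz)); apply: le_trans x0x1.
rewrite [X in _ <= X]P0E lee_fin -lerBrDr -/a leNgt; apply/negP => H; apply: nDz.
by split => //=; exact: ltW.
Qed.
End core.

End max_principle3.

Section max_principle4.
Context {R : realType} {n : nat}.
Variables (p m rho : R).
Hypotheses (n0 : (0 < n)%N) (pn : p = n%:R - 1) (rho0 : 0 <= rho)
  (adm : admissible p m (n%:R * (2 * rho + 2))).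
Local Notation E := (borel_rV R n).
Local Notation vec := ('rV[R]_n).
Local Notation h := (@nker R n p m : E -> E -> \bar R).
Implicit Types (x y z : vec).
Variable mu : probability E R.

Let p0 : 0 <= p.
Proof. by rewrite pn subr_ge0 ler1n. Qed.

Local Open Scope ereal_scope.

Let mh z : measurable_fun [set: E] (h z : E -> \bar R).
Proof. exact: measurable_nker_r. Qed.

Let mt c z : measurable_fun [set: E] (tker p m c z : E -> \bar R).
Proof. exact: measurable_tker_r. Qed.

Let tail (c : R) (x : vec) := \int[mu]_y tker p m c x y.

Let tail_le c c' x : (c <= c')%R -> tail c x <= tail c' x.
Proof.
move=> cc'; apply: ge0_le_integral => //.
  by move=> y _; exact: tker_ge0.
move=> y _; rewrite /tker; case: ltP => [xc|_].
  by rewrite (lt_le_trans xc cc').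
by case: ifP => // _; exact: nker_ge0.
Qed.

Let measurable_tail c : measurable_fun [set: E] (tail c : E -> \bar R).
Proof.
exact: (measurable_potential (h := tker p m c : E -> E -> \bar R)
  (@tker_ge0 R n p m c) (measurable_tker p m c) mu).
Qed.

Let r (j : nat) : R := (j.+1%:R^-1)%R.

Let r_le i j : (i <= j)%N -> (r j <= r i)%R.
Proof. by move=> ij; rewrite lef_pV2 ?posrE// ler_nat. Qed.

(** A finite potential at [x] forces mu({x}) = 0, since the kernel is infinite there. The integrals
    over the complements of small balls then increase to the whole potential. *)
Lemma tail_small x (e : R) : potential h mu x < +oo -> (0 < e)%R ->
  exists j, tail (3 * r j) x <= e%:E.
Proof.
move=> Ux e0; apply: contrapT => H.
have {}H j : e%:E < tail (3 * r j) x.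
  by rewrite ltNge; apply/negP => ?; apply: H; exists j.
have r0 j : (0 < r j)%R by rewrite invr_gt0.
pose G j : set E := [set y : E | (3 * r j <= enorm (x - (y : vec)))%R].
have md : measurable_fun [set: E] (fun y : E => enorm (x - (y : vec)) : R).
  by apply: measurable_dist => //; exact: measurable_cst.
have mG j : measurable (G j).
  rewrite -[X in measurable X]setTI /G.
  have := md measurableT _ (measurable_itv `[(3 * r j)%R, +oo[).
  by congr (measurable (_ `&` _)); apply/seteqP; split => y /=; rewrite in_itv/= andbT.
have ndG : nondecreasing_seq G.
  move=> i j ij; apply/subsetPset => y /=; rewrite /G /=; apply: le_trans.
  by rewrite ler_wpM2l// r_le.
have UE : \bigcup_j G j = ~` [set x].
  apply/seteqP; split => [y [j _ Gy] /= yx|y /= /eqP yx].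
    by move: Gy; rewrite /G /= yx subrr enorm0 leNgt mulr_gt0.
  have xy0 : (0 < enorm (x - y))%R by rewrite enorm_gt0 subr_eq0 eq_sym.
  have xy3 : (0 < enorm (x - y) / 3)%R by rewrite divr_gt0.
  have [j] := ltr_add_invr xy3; rewrite add0r ltr_pdivlMr// => jr.
  by exists j => //; rewrite /G /= mulrC; exact: ltW.
have mx : measurable ([set x] : set E).
  by rewrite -(setCK [set x]); apply: measurableC; rewrite -UE; exact: bigcupT_measurable.
have x0 : mu [set x] = 0.
  apply/eqP; rewrite eq_le measure_ge0 andbT leNgt; apply/negP => xpos.
  have : \int[mu]_(y in [set x]) h x y <= potential h mu x.
    by apply: ge0_subset_integral => // y _; exact: nker_ge0.
  rewrite (eq_integral (cst +oo)); last first.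
    by move=> y /set_mem /= ->; rewrite /nker subrr enorm0 eqxx.
  by rewrite integral_cst// gt0_mulye// leye_eq => /eqP U; rewrite U in Ux.
have UxE : potential h mu x = \int[mu]_(y in ~` [set x]) h x y.
  rewrite /potential (ge0_negligible_integral mx)//; last by move=> y _; exact: nker_ge0.
  by rewrite setTD.
have cvG : \int[mu]_(y in G j) h x y @[j --> \oo] --> potential h mu x.
  rewrite UxE -UE; apply: ge0_nondecreasing_set_cvg_integral => //.
  - by move=> j; exact: measurable_funTS.
  - by move=> j y _; exact: nker_ge0.
have fU : potential h mu x \is a fin_num.
  by rewrite ge0_fin_numE// potential_ge0//; exact: nker_ge0.
have split_j j : potential h mu x = \int[mu]_(y in G j) h x y + tail (3 * r j) x.
  rewrite /potential -(setUv (G j)) ge0_integral_setU//; last 4 first.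
  - exact: measurableC.
  - exact: measurable_funTS.
  - by move=> y _; exact: nker_ge0.
  - by apply/disj_setPS => y [].
  congr (_ + _); rewrite integral_mkcond; apply: eq_integral => y _.
  rewrite patchE /tker; case: ifPn => [/set_mem /= /negP|].
    by rewrite -ltNge => ->.
  by rewrite notin_setE /= => /contrapT; rewrite /G /= leNgt => /negbTE ->.
have : potential h mu x <= potential h mu x - e%:E.
  rewrite -{1}(cvg_lim _ cvG)//; apply: lime_le; first exact: cvgP cvG.
  apply: nearW => j; rewrite leeBrDr// (split_j j) leeD2l// ltW//.
by rewrite -(fineK fU) -EFinB lee_fin leNgt ltrBlDr ltrDl e0.
Qed.

(** An exhaustion in the manner of Egorov: on [A j] the short-range parts at scale 3 r_j are
    uniformly at most [e = t / C], so [rpot_box_le] bounds the potential of [mu] restricted to [A j]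
    by V + t. The sets [A j] increase to [S] because the potential is finite on [S]. *)
Theorem max_principle (S : set E) (V : R) : measurable S ->
  (forall y, S y -> `|y| <= rho)%R -> mu S = 1 -> (0 <= V)%R ->
  (forall x, S x -> potential h mu x <= V%:E) ->
  forall x, (`|x| <= rho)%R -> potential h mu x <= V%:E.
Proof.
move=> mS Srho S1 V0 SV x xr.
have [C C0 HC] := @nker_comparable R n p m _ adm.
apply/lee_addgt0Pr => t t0; set e := (t / C)%R.
have e0 : (0 < e)%R by rewrite divr_gt0.
pose A j : set E := S `&` [set y | tail (3 * r j) y <= e%:E].
have mA j : measurable (A j).
  apply: measurableI => //; rewrite -[X in measurable X]setTI.
  exact: emeasurable_fun_infty_c.
have ndA : nondecreasing_seq A.
  move=> i j ij; apply/subsetPset => y [Sy /= ty]; split => //=.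
  by apply: le_trans ty; apply: tail_le; rewrite ler_wpM2l// r_le.
have AS : \bigcup_j A j = S.
  apply/seteqP; split => [y [j _ []]//|y Sy].
  have [|j Hj] := @tail_small y e _ e0; first by apply: (le_lt_trans (SV _ Sy)); rewrite ltry.
  by exists j.
have cvA : rpot p m mu (A j) x @[j --> \oo] --> potential h mu x.
  have -> : potential h mu x = \int[mu]_(y in \bigcup_j A j) h x y.
    rewrite AS; apply/esym; apply: integral_probability1 => // y; exact: nker_ge0.
  apply: ge0_nondecreasing_set_cvg_integral => //.
  - by move=> j; exact: measurable_funTS.
  - by move=> j y _; exact: nker_ge0.
rewrite -(cvg_lim _ cvA)//; apply: lime_le; first exact: cvgP cvA.
apply: nearW => j.
have -> : t = (C * e)%R by rewrite /e mulrC divfK// gt_eqF.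
apply: (@rpot_box_le R n p m rho n0 pn rho0 adm mu (A j) (mA j) _ V (r j) e C) => //.
- by move=> y [/Srho].
- move=> y [Sy _]; apply: le_trans (SV _ Sy).
  by apply: ge0_subset_integral => // z _; exact: nker_ge0.
- by rewrite invr_gt0.
- exact: ltW.
- move=> y [_ /= Hy]; apply: le_trans Hy.
  by apply: ge0_subset_integral => // z _; exact: tker_ge0.
Qed.

(** A point off the closed set [F] is at positive distance from it; equality there would make it a
    maximum over the box. *)
Theorem potential_lt (F : set vec) (V : R) : closed F ->
  (forall y, F y -> `|y| <= rho)%R -> mu (F : set E) = 1 ->
  (forall x, (`|x| <= rho)%R -> potential h mu x <= V%:E) ->
  forall x, (`|x| <= rho)%R -> ~ F x -> potential h mu x < V%:E.
Proof.
move=> cF Frho F1 UV x xr Fx.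
rewrite lt_neqAle UV// andbT; apply/eqP => UxV.
have mF : measurable (F : set E) by exact: closed_borel.
have [/= d d0 Hd] : nbhs_ball (x : vec) (~` F).
  by apply/nbhs_ballP; apply: open_nbhs_nbhs; split => //; exact: closed_openC.
have Ff y : F y -> (d <= enorm (x - y))%R.
  move=> Fy; apply: le_trans (ler_norm_enorm _); rewrite leNgt; apply/negP => xyd.
  by apply: (Hd y) => //; rewrite -ball_normE.
have EF z : \int[mu]_(y in F) h z y = potential h mu z.
  by apply: integral_probability1 => // y; exact: nker_ge0.
apply: (no_interior_max n0 pn rho0 adm mF Frho _ xr d0 Ff).
  by apply: (lt_le_trans lte01); rewrite le_eqVlt; apply/orP; left; apply/eqP; exact: esym F1.
by move=> z zr; rewrite [X in X <= _]EF [X in _ <= X]EF UxV UV.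
Qed.

End max_principle4.

(** * Integrals on the real line *)

Section real_line.
Context {R : realType}.
Local Open Scope ereal_scope.
Local Notation leb := (@lebesgue_measure R).

Lemma measurable_affine (a b : R) :
  measurable_fun [set: R] (fun x => (a * x + b)%R : R).
Proof.
apply: measurable_funD => //; apply: measurable_funM => //; exact: measurable_cst.
Qed.

Lemma ge0_integral_affine (f : R -> \bar R) (a b : R) : a != 0%R ->
  measurable_fun setT f -> (forall x, 0 <= f x) ->
  \int[leb]_x f (a * x + b)%R = (`|a|^-1)%:E * \int[leb]_x f x.
Proof.
move=> a0 mf f0; have aN0 : (`|a| != 0)%R by rewrite normr_eq0.
have an : (0 <= `|a|)%R by [].
pose phi (x : measurableTypeR R) : measurableTypeR R := (a * x + b)%R.
have mphi : measurable_fun setT phi by exact: measurable_affine.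
pose pf : {measure set (measurableTypeR R) -> \bar R} :=
  measure_function_pushforward__canonical__measure_function_Measure lebesgue_measure mphi.
pose m' := mscale (NngNum an) pf.
have E A : measurable A -> leb A = m' A.
  apply: lebesgue_measure_unique => //= _ [[u v]] _ <-.
  rewrite /mscale /= /pushforward.
  have [ap|an'|a00] := ltgtP 0%R a; last by rewrite -a00 eqxx in a0.
  - have -> : phi @^-1` [set` `]u, v]] = [set` `]((u - b) / a), ((v - b) / a)]]%R.
      apply/seteqP; split => x; rewrite /phi /= !in_itv/= ltr_pdivrMr// ler_pdivlMr//;
      by rewrite ltrBlDr lerBrDr (mulrC x).
    rewrite !lebesgue_measure_itv/= !lte_fin ltr_pM2r ?invr_gt0// ltrD2r.
    case: ifP => // _; last by rewrite mule0.
    rewrite -!EFinB -EFinM; congr EFin; rewrite gtr0_norm//; field; exact: lt0r_neq0.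
  - have -> : phi @^-1` [set` `]u, v]] = [set` `[((v - b) / a), ((u - b) / a)[]%R.
      apply/seteqP; split => x; rewrite /phi /= !in_itv/= ltr_ndivlMr// ler_ndivrMr//;
      by rewrite ltrBlDr lerBrDr (mulrC x) andbC.
    rewrite !lebesgue_measure_itv/= !lte_fin ltr_nM2r ?invr_lt0// ltrD2r.
    case: ifP => // _; last by rewrite mule0.
    rewrite -!EFinB -EFinM; congr EFin; rewrite ltr0_norm//; field; exact: ltr0_neq0.
have -> : \int[leb]_x f x = `|a|%:E * \int[leb]_x f (a * x + b)%R.
  rewrite [LHS](eq_measure_integral m') => [|A mA _]; last exact: E.
  rewrite ge0_integral_mscale//; congr (_ * _).
  exact: (ge0_integral_pushforward mphi lebesgue_measure measurableT mf (fun y _ => f0 y)).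
by rewrite muleA -EFinM mulVf// mul1e.
Qed.

Lemma integral_powR01 (a : R) : (0 < a)%R ->
  \int[leb]_(x in `]0%R, 1%R]) (x `^ (a - 1))%:E <= a^-1%:E.
Proof.
move=> a0.
(* Starting at 1/(j + 2) keeps the left end strictly below 1, as the fundamental theorem of calculus
   requires. *)
pose F j := `[(j.+2%:R^-1)%R, 1%R]%classic : set R.
have j0 j : (0 < j.+2%:R^-1 :> R)%R by rewrite invr_gt0.
have j1 j : (j.+2%:R^-1 < 1 :> R)%R by rewrite invf_lt1// ltr1n.
have -> : `]0%R, 1%R]%classic = \bigcup_j F j :> set R.
  apply/seteqP; split => [x /=|x [j _]]; rewrite /F /= !in_itv/=.
    move=> /andP[x0 x1]; have [j] := ltr_add_invr x0; rewrite add0r => jx.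
    exists j => //; rewrite /F /= in_itv/= x1 andbT; apply: le_trans (ltW jx).
    by rewrite lef_pV2 ?posrE// ler_nat.
  by move=> /andP[jx ->]; rewrite (lt_le_trans (j0 j) jx).
have cv : \int[leb]_(x in F j) (x `^ (a - 1))%:E @[j --> \oo] --> \int[leb]_(x in \bigcup_j F j) (x `^ (a - 1))%:E.
  apply: ge0_nondecreasing_set_cvg_integral => //.
  - move=> i j ij; apply/subsetPset => x; rewrite /F /= !in_itv/= => /andP[ix ->].
    by rewrite andbT (le_trans _ ix)// lef_pV2 ?posrE// ler_nat.
  - by move=> j; exact: measurable_itv.
  - move=> j; apply: measurable_funTS; apply/measurable_EFinP; exact: measurable_powR.
  - by move=> j x _; rewrite lee_fin powR_ge0.
rewrite -(cvg_lim _ cv)//; apply: lime_le; first exact: cvgP cv.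
apply: nearW => j.
pose G (x : R) := (x `^ a * a^-1)%R.
have dG (x : R) : (0 < x)%R -> is_derive x 1%R G (x `^ (a - 1))%R.
  move=> x0; have H := is_derive1_powR a x0.
  have := is_deriveZ a^-1%R H.
  rewrite (_ : _ \*: _ = G); last by apply/funext => y; rewrite /G mulrC.
  by move=> ?; apply: is_derive_eq; rewrite -[LHS]/(a^-1 * _)%R mulrA mulVf ?mul1r// gt_eqF.
have cont (f f' : R -> R) : (forall x : R, (0 < x)%R -> is_derive x 1%R f (f' x)) ->
   {within F j, continuous f}.
  move=> df; apply: derivable_within_continuous => y.
  rewrite in_itv/= => /andP[y0 _]; have [//] := df y (lt_le_trans (j0 j) y0).
rewrite (@continuous_FTC2 _ _ G); last 4 first.
- exact: j1.
- by apply: (cont _ (fun x => (a - 1) * x `^ (a - 1 - 1))%R) => x x0; exact: is_derive1_powR.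
- have cG (x : R) : (0 < x)%R -> {for x, continuous G}.
    by move=> x0; have [/derivable1_diffP/differentiable_continuous] := dG x x0.
  split.
  + by move=> x; rewrite in_itv/= => /andP[x0 _]; have [] := dG x (lt_trans (j0 j) x0).
  + by apply: cvg_at_right_filter; exact: cG.
  + by apply: cvg_at_left_filter; exact: cG.
- move=> x; rewrite in_itv/= => /andP[x0 _].
  by rewrite derive1E; have [_ ->] := dG x (lt_trans (j0 j) x0).
rewrite -EFinB lee_fin /G powR1 mul1r gerBl mulr_ge0 ?powR_ge0// invr_ge0 ltW//.
Qed.

Lemma ln_le_powR (x a : R) : (0 < x)%R -> (0 < a)%R -> (- ln x <= a^-1 * x `^ (- a))%R.
Proof.
move=> x0 a0; rewrite ler_pdivlMl//.
rewrite (_ : a * - ln x = ln (x `^ (- a)))%R; last by rewrite ln_powR mulNr mulrN.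
by apply/ltW/ln_sublinear; rewrite powR_gt0.
Qed.

End real_line.

(** * Measures with constant potential on the unit ball *)

Section ball_measure_def.
Context {R : realType} {n : nat}.
Local Notation E := (borel_rV R n).
Local Notation vec := ('rV[R]_n).
Local Open Scope ereal_scope.

(** Rotation invariance, tested only on functions of the distance to a point. *)
Definition radial (nu : probability E R) := forall phi : R -> \bar R,
  measurable_fun setT phi -> (forall t, 0 <= phi t) ->
  forall x x' : vec, enorm x = enorm x' ->
  \int[nu]_y phi (enorm (x - (y : vec)))
    = \int[nu]_y phi (enorm (x' - (y : vec))).

(** The bound 2 is the diameter of the unit ball. All admissible constants are allowed because
    dilation changes [m] for the logarithmic kernel. *)
Definition ball_measure (p : R) (nu : probability E R) :=
  [/\ nu (origin_ball 1 : set E) = 1, radial nu &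
   forall m, admissible p m 2 -> exists V : R, forall x : vec, (enorm x <= 1)%R ->
   \int[nu]_y nker p m x y = V%:E].
End ball_measure_def.

(** * The arcsine law on [-1, 1] *)

Section interval.
Context {R : realType}.
Local Notation E := (borel_rV R 1).
Local Notation vec := ('rV[R]_1).
Local Open Scope ereal_scope.
Local Notation leb := (@lebesgue_measure R).

Lemma ge0_integral_periodic (f : R -> \bar R) (c : R) : measurable_fun setT f ->
  (forall x, 0 <= f x) -> (forall x, f (x + 1)%R = f x) -> (0 <= c <= 1)%R ->
  \int[leb]_(x in `]0%R, 1%R]) f (x + c)%R = \int[leb]_(x in `]0%R, 1%R]) f x.
Proof.
move=> mf f0 f1 /andP[c0 c1].
have shift (a b d : R) : \int[leb]_(x in `]a, b]) f (x + d)%R = \int[leb]_(x in `](a + d)%R, (b + d)%R]) f x.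
  rewrite integral_mkcond [RHS]integral_mkcond.
  have := @ge0_integral_affine R (f \_ `](a + d)%R, (b + d)%R]) 1%R d.
  rewrite oner_eq0 normr1 invr1 mul1e => <-//; last 2 first.
  - by apply/(measurable_restrictT _ _).1 => //; exact: measurable_funTS.
  - by move=> x; rewrite patchE; case: ifP.
  apply: eq_integral => x _; rewrite !patchE mul1r.
  by congr (if _ then _ else _); rewrite !mem_setE !in_itv/= ltrD2r lerD2r.
have split01 (a b d : R) : (a <= d)%R -> (d <= b)%R ->
    \int[leb]_(x in `]a, b]) f x = \int[leb]_(x in `]a, d]) f x + \int[leb]_(x in `]d, b]) f x.
  move=> ad db; rewrite -ge0_integral_setU//; last 2 first.
  - exact: measurable_funTS.
  - apply/disj_setPS => x; rewrite /= !in_itv/= => -[/andP[_ xd] /andP[dx _]].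
    by move: dx; rewrite ltNge xd.
  congr (integral _ _ _); apply/seteqP; split => x /=; rewrite !in_itv/=.
    by move=> /andP[ax xb]; case: (leP x d) => xd; [left; rewrite ax|right; rewrite xb].
  by move=> [/andP[ax xd]|/andP[dx xb]]; [rewrite ax (le_trans xd)|rewrite xb (le_lt_trans ad)].
rewrite shift add0r (split01 c (1 + c)%R 1%R c1) ?lerDl// addeC.
rewrite [RHS](split01 0%R 1%R c)//; congr (_ + _).
have := shift 0%R c 1%R; rewrite add0r (addrC c) => <-.
by apply: eq_integral => x _; rewrite f1.
Qed.

Let g (t : R) : \bar R := if sin (pi * t) == 0%R then +oo else (- ln `|sin (pi * t)|)%:E.

Let g_ge0 t : 0 <= g t.
Proof.
rewrite /g; case: eqP => // /eqP s0; rewrite lee_fin oppr_ge0 ln_le0//.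
exact: sin_max.
Qed.

Let measurable_sinpi : measurable_fun [set: R] (fun t => sin (pi * t) : R).
Proof.
apply: measurableT_comp; first exact: (continuous_measurable_fun (@continuous_sin R)).
by apply: measurable_funM => //; exact: measurable_cst.
Qed.

Let measurable_g : measurable_fun [set: R] g.
Proof.
rewrite /g; apply: measurable_fun_ifT => //.
  by apply: measurable_fun_eqr => //; exact: measurable_cst.
apply/measurable_EFinP; apply: measurableT_comp => //.
by apply: measurableT_comp; [exact: measurable_ln|exact: measurableT_comp].
Qed.

Let gN t : g (- t)%R = g t.
Proof. by rewrite /g mulrN sinN oppr_eq0 normrN. Qed.

Let g1 t : g (t + 1)%R = g t.
Proof. by rewrite /g mulrDr mulr1 sinDpi oppr_eq0 normrN. Qed.

Lemma sin_ge_half (x : R) : (0 <= x)%R -> (x <= pi / 2)%R -> (x / 2 <= sin x)%R.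
Proof.
move=> x0; rewrite le_eqVlt => /predU1P[->|xpi].
  by rewrite sin_pihalf; have := @pihalf_lt2 R; lra.
have y0 : (0 <= x / 2)%R by lra.
have cc : (1 <= 2 * cos (x / 2) ^+ 2)%R.
  have : (0 <= cos (x / 2 *+ 2))%R.
    rewrite -mulr_natr divfK//; apply: cos_ge0_pihalf; apply/andP; split; lra.
  by rewrite cos_mulr2n -mulr_natr; lra.
have c0 : (0 <= cos (x / 2))%R by apply: cos_ge0_pihalf; apply/andP; split; lra.
have [->|xn0] := eqVneq x 0%R; first by rewrite mul0r sin0.
have yp : (0 < x / 2)%R by rewrite lt_neqAle y0 andbT eq_sym mulf_neq0// invr_neq0.
have [|c] := @MVT R sin cos 0%R (x / 2)%R yp (fun y _ => is_derive_sin y).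
  by apply: continuous_subspaceT; exact: continuous_sin.
rewrite in_itv/= => /andP[cp cx]; rewrite sin0 !subr0 => sE.
have cosle : (cos (x / 2) <= cos c)%R.
  rewrite ltW// ltr_cos ?in_itv/=//; apply/andP; split; have := @pihalf_lt2 R; have := @pi_ge2 R; lra.
have -> : sin x = (2 * (cos (x / 2) * sin (x / 2)))%R.
  by rewrite -[in LHS](divfK (_ : 2 != 0)%R x)// mulr_natr sin_mulr2n -mulr_natl.
have h1 : (cos (x / 2) * (x / 2) <= sin (x / 2))%R.
  by rewrite sE ler_wpM2r.
have h2 : (cos (x / 2) * (cos (x / 2) * (x / 2)) <= cos (x / 2) * sin (x / 2))%R.
  by rewrite ler_wpM2l.
have h3 : (1 * (x / 2) <= (2 * cos (x / 2) ^+ 2) * (x / 2))%R by rewrite ler_wpM2r.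
lra.
Qed.

Let J := \int[leb]_(t in `]0%R, 1%R]) g t.

(** Near 0, sin(pi t) >= t, so [g t] is at most 2 t^(-1/2); the symmetry t to 1 - t treats the other
    singularity. *)
Let J_fin : J < +oo.
Proof.
have lnb (t : R) : (0 < t)%R -> (t <= 2^-1)%R -> g t <= (2 * t `^ (2^-1 - 1))%:E.
  move=> t0 t2; have pi2 := @pi_ge2 R.
  have pt0 : (0 < pi * t)%R by rewrite mulr_gt0// pi_gt0.
  have ptpi : (pi * t <= pi / 2)%R by rewrite ler_pM2l// pi_gt0.
  have st : (t <= sin (pi * t))%R.
    apply: le_trans (sin_ge_half (ltW pt0) ptpi).
    by rewrite ler_pdivlMr// mulrC ler_pM2r.
  have sp : (0 < sin (pi * t))%R by exact: lt_le_trans st.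
  rewrite /g gt_eqF// lee_fin gtr0_norm//.
  apply: (@le_trans _ _ (- ln t)%R); first by rewrite lerN2 ler_ln ?posrE.
  have : (0 < 2^-1 :> R)%R by [].
  move=> /(ln_le_powR t0); rewrite invrK; congr (_ <= _ * _ `^ _)%R; lra.
have powc (t : R) : (0 <= 2 * t `^ (2^-1 - 1))%R by rewrite mulr_ge0// powR_ge0.
have bound (t : R) : `]0%R, 1%R[%classic t ->
    g t <= (2 * t `^ (2^-1 - 1))%:E + (2 * (1 - t) `^ (2^-1 - 1))%:E.
  rewrite /= in_itv/= => /andP[t0 t1].
  have [t2|t2] := leP t (2^-1)%R.
    by apply: (le_trans (lnb _ t0 t2)); rewrite leeDl// lee_fin.
  have -> : g t = g (1 - t)%R by rewrite -(gN (1 - t)%R) opprB -[in RHS](g1 (t - 1)%R) subrK.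
  rewrite addeC; apply: (le_trans (lnb _ _ _)); [lra|lra|by rewrite leeDl// lee_fin].
have mpow : measurable_fun [set: R] (fun t : R => (2 * t `^ (2^-1 - 1))%:E : \bar R).
  by apply/measurable_EFinP; apply: measurable_funM; [exact: measurable_cst|exact: measurable_powR].
have mpow1 : measurable_fun [set: R] (fun t : R => (2 * (1 - t) `^ (2^-1 - 1))%:E : \bar R).
  apply/measurable_EFinP; apply: measurable_funM; first exact: measurable_cst.
  have m1t : measurable_fun [set: R] (fun t : R => (1 - t)%R : R).
    by apply: measurable_funB => //; exact: measurable_cst.
  exact: (measurableT_comp (measurable_powR (2^-1 - 1)%R) m1t).
have I1 : \int[leb]_(t in `]0%R, 1%R[) (2 * t `^ (2^-1 - 1))%:E < +oo.
  under eq_integral do rewrite EFinM.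
  rewrite ge0_integralZl//; last 2 first.
  - by apply: measurable_funTS; apply/measurable_EFinP; exact: measurable_powR.
  - by move=> t _; rewrite lee_fin powR_ge0.
  apply: lte_mul_pinfty => //.
  rewrite -(@integral_itv_bndoo R 0%R 1%R _ false false).
    have h0 : (0 < 2^-1 :> R)%R by [].
    by apply: (le_lt_trans (integral_powR01 h0)); rewrite ltry.
  by apply: measurable_funTS; apply/measurable_EFinP; exact: measurable_powR.
have I2 : \int[leb]_(t in `]0%R, 1%R[) (2 * (1 - t) `^ (2^-1 - 1))%:E < +oo.
  apply: le_lt_trans I1; rewrite integral_mkcond [leRHS]integral_mkcond.
  have := @ge0_integral_affine R ((fun t : R => (2 * t `^ (2^-1 - 1))%:E : \bar R) \_ `]0%R, 1%R[) (- 1)%R 1%R.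
  rewrite oppr_eq0 oner_eq0 normrN1 invr1 mul1e => <-//; last 2 first.
  - by apply/(measurable_restrictT _ _).1 => //; exact: measurable_funTS.
  - by move=> x; rewrite patchE; case: ifP => // _; rewrite lee_fin.
  rewrite le_eqVlt; apply/orP; left; apply/eqP.
  apply: eq_integral => x _; rewrite !patchE mulN1r (addrC _ 1%R).
  congr (if _ then _ else _); rewrite !mem_setE !in_itv/=.
  by rewrite subr_gt0 ltrBlDr ltrDl andbC.
have -> : J = \int[leb]_(t in `]0%R, 1%R[) g t.
  by apply: integral_itv_bndoo; exact: measurable_funTS.
apply: (@le_lt_trans _ _ (\int[leb]_(t in `]0%R, 1%R[) ((2 * t `^ (2^-1 - 1))%:E + (2 * (1 - t) `^ (2^-1 - 1))%:E))).
  apply: ge0_le_integral => //.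
  - exact: measurable_funTS.
  - by apply: emeasurable_funD; exact: measurable_funTS.
rewrite ge0_integralD//; last 4 first.
- by move=> t _; rewrite lee_fin.
- exact: measurable_funTS.
- by move=> t _; rewrite lee_fin.
- exact: measurable_funTS.
exact: (lte_add_pinfty I1 I2).
Qed.

Let pt (t : R) : E := const_mx (cos (2 * pi * t)) : vec.

Let measurable_pt : measurable_fun [set: R] (pt : R -> E).
Proof.
apply: measurable_rVP => i; rewrite /pt.
under eq_fun do rewrite mxE.
apply: measurableT_comp; first exact: (continuous_measurable_fun (@continuous_cos R)).
by apply: measurable_funM => //; exact: measurable_cst.
Qed.

Let pt1 t : pt (t + 1)%R = pt t.
Proof.
rewrite /pt mulrDr mulr1; congr const_mx.
by rewrite (mulr_natl pi 2) cosD2pi.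
Qed.

Let enorm1 (x : vec) : enorm x = `|x ord0 ord0|%R.
Proof. by rewrite /enorm big_ord1 sqrtr_sqr. Qed.

(** Since |cos 2 pi a - cos 2 pi t| = 2 |sin pi(a+t)| |sin pi(a-t)|, the logarithmic kernel splits
    into a constant and two values of the 1-periodic function [g]. *)
Let nker_pt m (a t : R) : admissible 0 m 2 ->
  nker 0 m (pt a) (pt t) = (m - ln 2)%:E + (g (a + t)%R + g (a - t)%R).
Proof.
move=> adm.
have dE : enorm ((pt a : vec) - (pt t : vec)) = (2 * (`|sin (pi * (a + t))| * `|sin (pi * (a - t))|))%R.
  rewrite enorm1 !mxE -normrM -[2%R in RHS]ger0_norm// -normrM -normrN.
  congr (`| _ |)%R.
  have -> : (2 * pi * a = pi * (a + t) + pi * (a - t))%R by ring.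
  have -> : (2 * pi * t = pi * (a + t) - pi * (a - t))%R by ring.
  by rewrite cosD cosB; ring.
rewrite /nker dE !mulf_eq0 !normr_eq0 (negbTE (_ : 2 != 0)%R)//= /g.
have [s0|s0] := eqVneq (sin (pi * (a + t))) 0%R => /=.
  by rewrite addye ?addey//; case: ifP.
have [s1|s1] := eqVneq (sin (pi * (a - t))) 0%R => /=.
  by rewrite addey ?addey.
have n0 : (0 < `|sin (pi * (a + t))|)%R by rewrite normr_gt0.
have n1 : (0 < `|sin (pi * (a - t))|)%R by rewrite normr_gt0.
rewrite (profileE adm) ?mulr_gt0//; last first.
  by rewrite ler_piMr// mulr_ile1// sin_max.
rewrite /raw_profile eqxx !lnM ?posrE ?mulr_gt0// -!EFinD; congr EFin.
by ring.
Qed.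

(** The image of the uniform law on ]0, 1] under t to cos(2 pi t). By periodicity both terms of
    [nker_pt] integrate to [J] whatever the point, so the potential is constant; the reflection x to
    -x corresponds to the shift of t by 1/2. *)
Lemma ball_measure1 : exists nu : probability E R, ball_measure 0 nu.
Proof.
have m01 : leb `]0%R, 1%R] = 1%:E by rewrite lebesgue_measure_itv/= lte_fin ltr01 -EFinB subr0.
have [P [PE PI]] := @restriction_probability _ (measurableTypeR R) R leb `]0%R, 1%R] 1%R (measurable_itv _) ltr01 m01.
have [nu [nuE nuI]] := pushforward_probability P measurable_pt.
have I (f : vec -> \bar R) : measurable_fun [set: E] (f : E -> \bar R) -> (forall x, 0 <= f x) ->
    \int[nu]_y f y = \int[leb]_(t in `]0%R, 1%R]) f (pt t).
  move=> mf f0; rewrite nuI// PI//; first by rewrite invr1 mul1e.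
  exact: (measurableT_comp mf measurable_pt).
have mnorm (x : vec) : measurable_fun [set: E] (fun y : E => enorm (x - (y : vec)) : R).
  by apply: measurable_dist => //; exact: measurable_cst.
exists nu; split.
- rewrite nuE; last by apply: closed_borel; exact: closed_origin_ball.
  rewrite (_ : _ @^-1` _ = setT) ?probability_setT//.
  by apply/seteqP; split => // t _; rewrite /pt /= /origin_ball /= enorm1 mxE cos_max.
- move=> phi mphi phi0 x x'.
  rewrite !enorm1 => /eqP; rewrite eqr_norm2 => /orP[]/eqP xx'.
    suff -> : x = x' by [].
    by apply/rowP => i; rewrite (ord1 i).
  have {xx'}-> : x = (- x')%R by apply/rowP => i; rewrite (ord1 i) mxE.
  have mp (z : vec) : measurable_fun [set: E] (fun y : E => phi (enorm (z - (y : vec)))).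
    exact: (measurableT_comp mphi (mnorm z)).
  rewrite !I//; try exact: mp.
  have half : (0 <= (2^-1 : R) <= 1)%R by apply/andP; split; lra.
  pose F (t : R) := phi (enorm (x' - (pt t : vec))).
  have mF : measurable_fun setT F by exact: (measurableT_comp (mp x') measurable_pt).
  have F0 t : 0 <= F t by exact: phi0.
  have F1 t : F (t + 1)%R = F t by rewrite /F pt1.
  transitivity (\int[leb]_(t in `]0%R, 1%R]) F (t + 2^-1)%R); last first.
    exact: (ge0_integral_periodic mF F0 F1 half).
  apply: eq_integral => t _; congr phi; rewrite !enorm1 /pt !mxE -normrN.
  congr (`| _ |)%R.
  have -> : (2 * pi * (t + 2^-1) = 2 * pi * t + pi)%R by field.
  by rewrite cosDpi; ring.
- move=> m adm.
  have Jn : J \is a fin_num by rewrite ge0_fin_numE// integral_ge0.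
  exists (m - ln 2 + (fine J + fine J))%R => x x1.
  rewrite enorm1 in x1.
  have xb : (-1 <= x ord0 ord0 <= 1)%R by rewrite -ler_norml.
  set a := (acos (x ord0 ord0) / (2 * pi))%R.
  have xE : x = pt a.
    apply/rowP => i; rewrite (ord1 i) /pt mxE /a mulrC divfK ?acosK//.
    by rewrite gt_eqF// mulr_gt0// pi_gt0.
  have pi2 := @pi_gt0 R.
  have a01 : (0 <= a <= 1)%R.
    rewrite /a divr_ge0 ?acos_ge0 ?mulr_ge0 ?(ltW pi2)//= ler_pdivrMr ?mulr_gt0//.
    by apply: (le_trans (acos_lepi xb)); lra.
  have mh : measurable_fun [set: E] (nker 0 m x : E -> \bar R) by exact: measurable_nker_r.
  rewrite (I (nker 0 m x))//; last by move=> y; exact: nker_ge0.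
  rewrite xE; under eq_integral do rewrite nker_pt//.
  have mga : measurable_fun [set: R] (fun t => g (a + t)%R).
    by apply: measurableT_comp => //; apply: measurable_funD => //; exact: measurable_cst.
  have mgb : measurable_fun [set: R] (fun t => g (a - t)%R).
    by apply: measurableT_comp => //; apply: measurable_funB => //; exact: measurable_cst.
  have c0 : (0 <= m - ln 2)%R.
    case: adm => [[_ H]|[]]; last by rewrite ltxx.
    by have := H 2%R (ltr0Sn _ 1) (lexx _); lra.
  rewrite ge0_integralD//; [|by move=> t _; rewrite adde_ge0
    |by apply: measurable_funTS; exact: emeasurable_funD].
  rewrite ge0_integralD//; try exact: measurable_funTS.
  have -> : \int[leb]_(t in `]0%R, 1%R]) (m - ln 2)%:E = (m - ln 2)%:E.
    by rewrite integral_cst// -[RHS]mule1; congr (_ * _); exact: m01.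
  have -> : \int[leb]_(t in `]0%R, 1%R]) g (a + t)%R = J.
    rewrite -[RHS](ge0_integral_periodic measurable_g g_ge0 g1 a01).
    by apply: eq_integral => t _; rewrite addrC.
  have -> : \int[leb]_(t in `]0%R, 1%R]) g (a - t)%R = J.
    have a01' : (0 <= 1 - a <= 1)%R by case/andP: a01 => ? ?; apply/andP; split; lra.
    rewrite -[RHS](ge0_integral_periodic measurable_g g_ge0 g1 a01').
    apply: eq_integral => t _.
    by rewrite -gN -g1; congr g; ring.
  by rewrite -(fineK Jn) -!EFinD.
Qed.

End interval.

(** * Lebesgue measure on row vectors, by induction on the dimension *)

Section cons_rV.
Context {R : realType} {m : nat}.
Local Notation E := (borel_rV R m).
Local Notation E1 := (borel_rV R m.+1).

Definition cons_rV (t : R) (w : 'rV[R]_m) : 'rV[R]_m.+1 :=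
  \row_i if unlift ord0 i is Some j then w ord0 j else t.

Definition tail_rV (x : 'rV[R]_m.+1) : 'rV[R]_m := \row_j x ord0 (lift ord0 j).

Lemma cons_rV0 t w : cons_rV t w ord0 ord0 = t.
Proof. by rewrite mxE unlift_none. Qed.

Lemma cons_rVS t w j : cons_rV t w ord0 (lift ord0 j) = w ord0 j.
Proof. by rewrite mxE liftK. Qed.

Lemma tail_cons_rV t w : tail_rV (cons_rV t w) = w.
Proof. by apply/rowP => j; rewrite mxE cons_rVS. Qed.

Lemma cons_tail_rV (x : 'rV[R]_m.+1) : cons_rV (x ord0 ord0) (tail_rV x) = x.
Proof.
apply/rowP => i; rewrite mxE; case: unliftP => [j ->|->] //.
by rewrite mxE.
Qed.

Lemma cons_rVD t w t' w' : cons_rV t w + cons_rV t' w' = cons_rV (t + t') (w + w').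
Proof. by apply/rowP => i; rewrite !mxE; case: unliftP => // j _; rewrite mxE. Qed.

Lemma cons_rVZ a t w : a *: cons_rV t w = cons_rV (a * t) (a *: w).
Proof. by apply/rowP => i; rewrite !mxE; case: unliftP => // j _; rewrite mxE. Qed.

Lemma sqr_enorm_cons t w : enorm (cons_rV t w) ^+ 2 = t ^+ 2 + enorm w ^+ 2.
Proof.
rewrite !sqr_enorm big_ord_recl cons_rV0; congr (_ + _).
by apply: eq_bigr => i _; rewrite cons_rVS.
Qed.

Lemma measurable_cons_rV : measurable_fun [set: R * E]
  (fun z : R * E => cons_rV z.1 z.2 : E1).
Proof.
apply: measurable_rVP => i; case: (unliftP ord0 i) => [j ->|->].
  under eq_fun do rewrite cons_rVS.
  by apply: (measurableT_comp (measurable_coord j)); exact: measurable_snd.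
by under eq_fun do rewrite cons_rV0; exact: measurable_fst.
Qed.

Lemma measurable_tail_rV : measurable_fun [set: E1] (tail_rV : E1 -> E).
Proof.
apply: measurable_rVP => j; under eq_fun do rewrite mxE.
exact: measurable_coord.
Qed.

End cons_rV.

Section extend.
Context {R : realType} {m : nat}.
Local Notation E := (borel_rV R m).
Local Notation E1 := (borel_rV R m.+1).
Local Open Scope ereal_scope.
Local Notation leb := (@lebesgue_measure R).
Variable L : {sigma_finite_measure set E -> \bar R}.

Definition extend : set E1 -> \bar R :=
  pushforward (leb \x L)%E (fun z : R * E => cons_rV z.1 z.2 : E1).

Let pf : {measure set E1 -> \bar R} :=
  measure_function_pushforward__canonical__measure_function_Measure
    (leb \x L)%E (@measurable_cons_rV R m).

HB.instance Definition _ := isMeasure.Build _ _ _ extend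
  (measure0 pf) (measure_ge0 pf) (@measure_semi_sigma_additive _ _ _ pf).

Let extend_sigma_finite : sigma_finite setT extend.
Proof.
have [F FT HF] : sigma_finite setT (leb \x L)%E.
  have /sigma_finiteP[F [TF ndF Foo]] := sigma_finiteT (@lebesgue_measure R).
  have /sigma_finiteP[G [TG ndG Goo]] := sigma_finiteT L.
  exists (fun k => F k `*` G k).
    rewrite -setXTT TF TG predeqE => -[x y]; split.
      move=> [/= [k _ Fnx] [j _ Gky]]; exists (maxn k j) => //; split.
      - by move: x Fnx; exact/subsetPset/ndF/leq_maxl.
      - by move: y Gky; exact/subsetPset/ndG/leq_maxr.
    by move=> [k _ []/= ? ?]; split; exists k.
  move=> k; have [? ?] := Foo k; have [? ?] := Goo k.
  split; first exact: measurableX.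
  by rewrite product_measure1E// lte_mul_pinfty// ge0_fin_numE.
pose inv (x : E1) : R * E := ((x : 'rV[R]_m.+1) ord0 ord0, tail_rV x).
have minv : measurable_fun setT inv.
  by apply: measurable_fun_pair; [exact: measurable_coord|exact: measurable_tail_rV].
exists (fun k => inv @^-1` F k).
  by rewrite -preimage_bigcup -FT preimage_setT.
move=> k; have [mF Fy] := HF k; split.
  by rewrite -[X in measurable X]setTI; exact: minv.
rewrite /extend /pushforward.
suff -> : (fun z : R * E => cons_rV z.1 z.2 : E1) @^-1` (inv @^-1` F k) = F k by [].
apply/seteqP; split => -[t w] /=; by rewrite /inv /= cons_rV0 tail_cons_rV.
Qed.

HB.instance Definition _ := Measure_isSigmaFinite.Build _ _ _ extend extend_sigma_finite.

Lemma integral_extend (f : E1 -> \bar R) : measurable_fun setT f -> (forall x, 0 <= f x) ->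
  \int[extend]_x f x = \int[leb]_t \int[L]_w f (cons_rV t w).
Proof.
move=> mf f0.
transitivity (\int[pf]_x f x); first exact: eq_measure_integral.
rewrite ge0_integral_pushforward//; last exact: (@measurable_cons_rV R m).
rewrite preimage_setT.
have mfc : measurable_fun setT (fun z : R * E => f (cons_rV z.1 z.2)).
  exact: (measurableT_comp mf (@measurable_cons_rV R m)).
have := @fubini_tonelli1 _ _ _ _ R leb L (fun z : R * E => f (cons_rV z.1 z.2)) mfc (fun z => f0 _).
by [].
Qed.

End extend.

Section lebesgue_rV.
Context {R : realType}.
Local Open Scope ereal_scope.
Local Notation leb := (@lebesgue_measure R).

(** The properties of Lebesgue measure that pass from dimension m to m + 1 and serve below:
    translation and scaling give the change of variables, the last two clauses make [slope_mass]
    positive and finite. *)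
Definition lebesgue_like (m : nat) (L : {measure set (borel_rV R m) -> \bar R}) :=
  [/\ forall f : 'rV[R]_m -> \bar R, measurable_fun [set: borel_rV R m] (f : borel_rV R m -> \bar R) ->
        (forall w, 0 <= f w) -> forall v : 'rV[R]_m,
        \int[L]_w f ((w : 'rV[R]_m) + v)%R = \int[L]_w f w,
      forall f : 'rV[R]_m -> \bar R, measurable_fun [set: borel_rV R m] (f : borel_rV R m -> \bar R) ->
        (forall w, 0 <= f w) -> forall z : R, z != 0%R ->
        \int[L]_w f (z *: (w : 'rV[R]_m))%R = ((`|z| ^+ m)^-1)%:E * \int[L]_w f w,
      0 < L setT &
      forall b : R, (m.+1%:R <= 2 * b)%R ->
        \int[L]_w ((1 + enorm (w : 'rV[R]_m) ^+ 2) `^ (- b))%:E < +oo].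

Lemma integralT_oneDsqr : \int[leb]_t ((1 + t ^+ 2)^-1)%:E < +oo :> \bar R.
Proof.
have := @ge0_symfun_integralT R (fun t => (1 + t ^+ 2)^-1)%R _ _ _.
move=> ->.
- rewrite -set_itvcy; have := @integral0y_oneDsqr R; rewrite /oneDsqr => ->.
  by rewrite -EFinM ltry.
- by move=> t; rewrite invr_ge0 addr_ge0// sqr_ge0.
- exact: continuous_oneDsqrV.
- by move=> t; rewrite /= sqrrN.
Qed.

Lemma leb_setT_gt0 : 0 < leb setT.
Proof.
apply: (@lt_le_trans _ _ (leb `]0%R, 1%R])).
  by rewrite lebesgue_measure_itv/= lte_fin ltr01 -EFinB subr0.
by apply: le_measure; rewrite ?inE.
Qed.

Lemma measurable_1Dsqr m (b : R) :
  measurable_fun [set: borel_rV R m]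
   (fun w : borel_rV R m => ((1 + enorm (w : 'rV[R]_m) ^+ 2) `^ (- b))%:E : \bar R).
Proof.
apply/measurable_EFinP.
have H : measurable_fun [set: borel_rV R m] (fun w : borel_rV R m => (1 + enorm (w : 'rV[R]_m) ^+ 2)%R : R).
  apply: measurable_funD; first exact: measurable_cst.
  by apply: measurable_funX; exact: measurable_enorm.
exact: (measurableT_comp (measurable_powR (- b)%R) H).
Qed.

Lemma lebesgue_like_extend m (L : {sigma_finite_measure set (borel_rV R m) -> \bar R}) :
  lebesgue_like L -> lebesgue_like (extend L).
Proof.
move=> [T S P C].
have mfc (f : 'rV[R]_m.+1 -> \bar R) : measurable_fun [set: borel_rV R m.+1] (f : borel_rV R m.+1 -> \bar R) ->
    measurable_fun [set: R * borel_rV R m] (fun z : R * borel_rV R m => f (cons_rV z.1 z.2)).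
  by move=> mf; exact: (measurableT_comp mf (@measurable_cons_rV R m)).
have mfc2 (f : 'rV[R]_m.+1 -> \bar R) t : measurable_fun [set: borel_rV R m.+1] (f : borel_rV R m.+1 -> \bar R) ->
    measurable_fun [set: borel_rV R m] (fun w : borel_rV R m => f (cons_rV t w)).
  move=> /mfc mf.
  have mt : measurable_fun [set: borel_rV R m] (pair t : borel_rV R m -> R * borel_rV R m) by exact: measurable_fun_pair.
  exact: (measurableT_comp mf mt).
have mH (f : 'rV[R]_m.+1 -> \bar R) : measurable_fun [set: borel_rV R m.+1] (f : borel_rV R m.+1 -> \bar R) ->
    (forall w, 0 <= f w) -> measurable_fun [set: R] (fun t : R => \int[L]_w f (cons_rV t w)).
  move=> mf f0.
  exact: (measurable_fun_fubini_tonelli_F (m2 := L) (fun z : R * borel_rV R m => f (cons_rV z.1 z.2)) (mfc _ mf)).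
split.
- move=> f mf f0 v.
  have mfv : measurable_fun [set: borel_rV R m.+1] (fun x : borel_rV R m.+1 => f ((x : 'rV[R]_m.+1) + v)%R).
    apply: (measurableT_comp mf); apply: measurable_funDrV => //; exact: measurable_cst.
  rewrite (integral_extend L mfv (fun x => f0 _)) (integral_extend L mf f0).
  transitivity (\int[leb]_t \int[L]_w f (cons_rV (t + v ord0 ord0)%R w)).
    apply: eq_integral => t _.
    rewrite -[RHS](T (fun w => f (cons_rV (t + v ord0 ord0)%R w)) (mfc2 _ _ mf) (fun w => f0 _) (tail_rV v)).
    apply: eq_integral => w _; congr f.
    by rewrite -cons_rVD cons_tail_rV.
  have := @ge0_integral_affine R (fun t => \int[L]_w f (cons_rV t w)) 1%R (v ord0 ord0) (oner_neq0 _) (mH _ mf f0).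
  rewrite normr1 invr1 mul1e => <-; last by move=> t; exact: integral_ge0.
  by apply: eq_integral => t _; rewrite mul1r.
- move=> f mf f0 z z0.
  have mfv : measurable_fun [set: borel_rV R m.+1] (fun x : borel_rV R m.+1 => f (z *: (x : 'rV[R]_m.+1))%R).
    by apply: (measurableT_comp mf); apply: measurable_funZrV => //; exact: measurable_cst.
  rewrite (integral_extend L mfv (fun x => f0 _)) (integral_extend L mf f0).
  have zm : (0 <= (`|z| ^+ m)^-1)%R by rewrite invr_ge0 exprn_ge0.
  transitivity (\int[leb]_t (((`|z| ^+ m)^-1)%:E * \int[L]_w f (cons_rV (z * t + 0)%R w))).
    apply: eq_integral => t _; rewrite addr0.
    rewrite -[RHS](S (fun w => f (cons_rV (z * t)%R w)) (mfc2 _ _ mf) (fun w => f0 _) z z0).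
    by apply: eq_integral => w _; rewrite -cons_rVZ.
  rewrite ge0_integralZl; last 4 first.
  + exact: measurableT.
  + apply: measurableT_comp (mH _ mf f0) _; exact: measurable_affine.
  + by move=> t _; exact: integral_ge0.
  + by rewrite lee_fin.
  have := @ge0_integral_affine R (fun t => \int[L]_w f (cons_rV t w)) z 0%R z0 (mH _ mf f0).
  move=> ->; last by move=> t; exact: integral_ge0.
  by rewrite muleA -EFinM -invfM -exprSr.
- have m1 : measurable_fun [set: borel_rV R m.+1] (cst 1 : borel_rV R m.+1 -> \bar R) by exact: measurable_cst.
  have LT : extend L setT = \int[leb]_t L setT.
    transitivity (\int[extend L]_x (cst 1 x : \bar R)); first by rewrite integral_cst// mul1e.
    rewrite (integral_extend L m1)//.
    by apply: eq_integral => t _; rewrite integral_cst// mul1e.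
  apply: (@lt_le_trans _ _ (\int[leb]_t L setT)).
    by apply: integral_gt0 => //; exact: leb_setT_gt0.
  by rewrite le_eqVlt; apply/orP; left; apply/eqP; exact: esym.
- move=> b mb.
  have mb' : (m.+1%:R <= 2 * b)%R by apply: le_trans mb; rewrite ler_nat.
  have KC := C b mb'.
  set K := \int[L]_w _ in KC.
  have b0 w : 0 <= ((1 + enorm (w : 'rV[R]_m.+1) ^+ 2) `^ (- b))%:E by rewrite lee_fin powR_ge0.
  rewrite (integral_extend L (@measurable_1Dsqr m.+1 b) b0).
  have K0 : 0 <= K by apply: integral_ge0 => w _; rewrite lee_fin powR_ge0.
  have fK : K \is a fin_num by rewrite ge0_fin_numE.
  apply: (@le_lt_trans _ _ (\int[leb]_t (K * ((1 + t ^+ 2)^-1)%:E))); last first.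
    rewrite -(fineK fK) ge0_integralZl//.
    + by apply: lte_mul_pinfty => //; [rewrite lee_fin fine_ge0|exact: integralT_oneDsqr].
    + apply/measurable_EFinP; exact: (continuous_measurable_fun (@continuous_oneDsqrV R)).
    + by move=> t _; rewrite lee_fin invr_ge0 addr_ge0// sqr_ge0.
    + by rewrite lee_fin fine_ge0.
  apply: ge0_le_integral.
  + exact: measurableT.
  + by move=> t _; apply: integral_ge0 => w _; exact: b0.
  + exact: (mH _ (@measurable_1Dsqr m.+1 b) b0).
  + apply: emeasurable_funM; first exact: measurable_cst.
    apply/measurable_EFinP; exact: (continuous_measurable_fun (@continuous_oneDsqrV R)).
  move=> t _.
  (* Scaling w by the square root of [a] factors the inner integral as a^(m/2 - b) [K], and m/2 - b
     <= -1 leaves at most (1 + t^2)^(-1) to integrate in t. *)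
  set a := (1 + t ^+ 2)%R.
  have a1 : (1 <= a)%R by rewrite lerDl sqr_ge0.
  have a0 : (0 < a)%R by exact: lt_le_trans a1.
  have sa0 : Num.sqrt a != 0%R by rewrite gt_eqF// sqrtr_gt0.
  have mG : measurable_fun [set: borel_rV R m] (fun w : borel_rV R m => ((a + enorm (w : 'rV[R]_m) ^+ 2) `^ (- b))%:E : \bar R).
    have := mfc2 _ t (@measurable_1Dsqr m.+1 b).
    by under eq_fun do rewrite sqr_enorm_cons addrA.
  have := S (fun w => ((a + enorm (w : 'rV[R]_m) ^+ 2) `^ (- b))%:E) mG _ (Num.sqrt a) sa0.
  under eq_integral => w _.
    rewrite enormZ exprMn real_normK ?num_real// sqr_sqrtr ?(ltW a0)//.
    rewrite -[X in (X + _)%R]mulr1 -mulrDr powRM ?(ltW a0)//; last by rewrite addr_ge0// sqr_ge0.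
    rewrite EFinM; over.
  rewrite ge0_integralZl//; last 3 first.
  + exact: measurable_1Dsqr.
  + by move=> w _; rewrite lee_fin powR_ge0.
  + by rewrite lee_fin powR_ge0.
  rewrite -/K => H.
  have {H} : \int[L]_w ((1 + enorm (cons_rV t w) ^+ 2) `^ (- b))%:E = (`|Num.sqrt a| ^+ m)%:E * ((a `^ (- b))%:E * K).
    rewrite H; last by move=> w; rewrite lee_fin powR_ge0.
    rewrite muleA -EFinM mulfV ?mul1e; last by rewrite expf_eq0 normr_eq0 (negbTE sa0) andbF.
    by apply: eq_integral => w _; rewrite sqr_enorm_cons addrA.
  move=> ->.
  rewrite muleA -EFinM muleC; apply: lee_wpmul2l => //; rewrite lee_fin.
  rewrite ger0_norm ?sqrtr_ge0// -powR12_sqrt ?(ltW a0)// -powR_mulrn ?powR_ge0// -powRrM.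
  rewrite -powRD; last by apply/implyP => _; rewrite gt_eqF.
  rewrite -[X in (_ <= X)%R](powR_inv1 (ltW a0)).
  apply: ler_powR => //.
  move: mb; rewrite -[m.+2]addn2 natrD; lra.
Qed.

Lemma exists_lebesgue m : exists L : {sigma_finite_measure set (borel_rV R m) -> \bar R},
  lebesgue_like L.
Proof.
elim: m => [|m [L HL]]; last by exists (extend L); exact: lebesgue_like_extend.
exists (\d_(0%R : borel_rV R 0)).
have v0 (v : 'rV[R]_0) : v = 0%R by exact: thinmx0.
split.
- by move=> f mf f0 v; apply: eq_integral => w _; rewrite (v0 (_ + _)%R) (v0 w).
- move=> f mf f0 z z0; rewrite expr0 invr1 mul1e; apply: eq_integral => w _.
  by rewrite (v0 (_ *: _)%R) (v0 w).
- apply: lt_le_trans lte01 _; rewrite le_eqVlt; apply/orP; left; apply/eqP; apply: esym; exact: diracT.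
- move=> b _; rewrite integral_dirac//; last exact: measurable_1Dsqr.
  apply: (@le_lt_trans _ _ (1%E * ((1 + enorm (0%R : 'rV[R]_0) ^+ 2) `^ (- b))%:E)).
    by rewrite le_eqVlt; apply/orP; left; apply/eqP; congr (_ * _); exact: diracT.
  by rewrite mul1e ltry.
Qed.

End lebesgue_rV.

(** * One-dimensional integrals of the inverse square root *)

Section arcsine_density.
Context {R : realType}.
Local Open Scope ereal_scope.
Local Notation leb := (@lebesgue_measure R).

(** Both [Num.sqrt] on nonpositive numbers and the inverse of 0 are 0, so this vanishes for s <= 0:
    densities built from it are supported in the ball without an indicator. *)
Definition invsqrt (s : R) : R := ((Num.sqrt s)^-1)%R.

Lemma invsqrt_ge0 s : (0 <= invsqrt s)%R.
Proof. by rewrite invr_ge0 sqrtr_ge0. Qed.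

Lemma invsqrtM a s : (0 <= a)%R -> invsqrt (a * s) = ((Num.sqrt a)^-1 * invsqrt s)%R.
Proof. by move=> a0; rewrite /invsqrt sqrtrM// invfM. Qed.

Lemma measurable_invsqrt : measurable_fun [set: R] invsqrt.
Proof.
rewrite (_ : invsqrt = fun s => Num.sqrt s `^ (-1))%R; last first.
  by apply/funext => s; rewrite powR_inv1// sqrtr_ge0.
have ms : measurable_fun [set: R] (@Num.sqrt R) by exact: (continuous_measurable_fun (@sqrt_continuous R)).
exact: (measurableT_comp (measurable_powR (- 1)%R) ms).
Qed.

Lemma measurable_invsqrt_quad d (T : measurableType d) (f : T -> R) :
  measurable_fun setT f -> measurable_fun setT (fun t => invsqrt (f t)).
Proof. by move=> mf; exact: (measurableT_comp measurable_invsqrt mf). Qed.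

Definition arcsine_moment k : \bar R := \int[leb]_v (`|v| ^+ k * invsqrt (1 - v ^+ 2))%:E.

Let mf k : measurable_fun [set: R] (fun v : R => (`|v| ^+ k * invsqrt (1 - v ^+ 2))%:E : \bar R).
Proof.
apply/measurable_EFinP; apply: measurable_funM.
  by apply: measurable_funX; apply: normr_measurable.
apply: measurable_invsqrt_quad; apply: measurable_funB; first exact: measurable_cst.
exact: measurable_funX.
Qed.

Let f0 k (v : R) : 0 <= (`|v| ^+ k * invsqrt (1 - v ^+ 2))%:E.
Proof. by rewrite lee_fin mulr_ge0 ?exprn_ge0// invsqrt_ge0. Qed.

Lemma arcsine_moment_gt0 k : 0 < arcsine_moment k.
Proof.
apply: (@lt_le_trans _ _ (\int[leb]_(v in `]0%R, 1%R[) (`|v| ^+ k * invsqrt (1 - v ^+ 2))%:E)).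
  have l01 : 0 < leb `]0%R, 1%R[ by rewrite lebesgue_measure_itv/= lte_fin ltr01 -EFinB subr0.
  apply: integral_gt0 => //.
  - exact: (measurable_funTS (mf k)).
  - move=> v; rewrite /= in_itv/= => /andP[v0 v1].
    rewrite lte_fin mulr_gt0 ?exprn_gt0 ?normr_gt0 ?gt_eqF// invr_gt0 sqrtr_gt0.
    by rewrite subr_gt0 expr_lt1// ltW.
apply: ge0_subset_integral => //; exact: mf.
Qed.

Let h : R -> \bar R := (fun x : R => (x `^ (2^-1 - 1))%:E : \bar R) \_ `]0%R, 1%R].

Let h0 x : 0 <= h x.
Proof. by rewrite /h patchE; case: ifP => // _; rewrite lee_fin powR_ge0. Qed.

Let mh : measurable_fun setT h.
Proof.
apply/(measurable_restrictT _ _).1 => //; apply: measurable_funTS; apply/measurable_EFinP.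
exact: measurable_powR.
Qed.

Let hI : \int[leb]_x h x < +oo.
Proof.
rewrite -integral_mkcond; have h2 : (0 < 2^-1 :> R)%R by [].
by apply: (le_lt_trans (integral_powR01 h2)); rewrite ltry.
Qed.

(** In 1 - v^2 = (1 - v)(1 + v) one factor is at least 1, so the integrand is dominated by an
    inverse square root at each end point. *)
Lemma arcsine_moment_fin k : arcsine_moment k < +oo.
Proof.
have mh' a : measurable_fun [set: R] (fun v : R => h (a * v + 1)%R).
  by apply: (measurableT_comp mh); exact: measurable_affine.
apply: (@le_lt_trans _ _ (\int[leb]_v (h (-1 * v + 1)%R + h (1 * v + 1)%R))).
  apply: ge0_le_integral => //.
  - exact: mf.
  - apply: emeasurable_funD; exact: mh'.
  move=> v _; rewrite mulN1r mul1r (addrC (- v)%R) (addrC v).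
  have [v1|v1] := leP 1%R (`|v|)%R.
    have -> : invsqrt (1 - v ^+ 2) = 0%R.
      rewrite /invsqrt ler0_sqrtr ?invr0// subr_le0.
      by rewrite -(real_normK (num_real v)) exprn_ege1.
    by rewrite mulr0 adde_ge0.
  have bound (a b : R) : (0 < a <= 1)%R -> (1 <= b)%R -> (`|v| ^+ k * invsqrt (a * b) <= a `^ (2^-1 - 1))%R.
    move=> /andP[a0 a1] b1.
    have -> : (a `^ (2^-1 - 1) = (Num.sqrt a)^-1)%R.
      rewrite (_ : 2^-1 - 1 = - 2^-1)%R; last by field.
      by rewrite powRN powR12_sqrt// ltW.
    rewrite invsqrtM ?(ltW a0)// mulrCA ler_piMr ?invr_ge0 ?sqrtr_ge0//.
    rewrite mulr_ile1 ?exprn_ge0 ?invsqrt_ge0//; first by rewrite exprn_ile1// ltW.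
    rewrite invf_le1 ?sqrtr_gt0 ?(lt_le_trans ltr01 b1)//.
    by rewrite -[leLHS]sqrtr1 ler_wsqrtr.
  have := v1; rewrite ltr_norml => /andP[vN v1'].
  have [v0|v0] := leP 0%R v.
    have i : (0 < 1 - v <= 1)%R by apply/andP; split; lra.
    rewrite (_ : 1 - v ^+ 2 = (1 - v) * (1 + v))%R; last by ring.
    apply: (@le_trans _ _ (h (1 - v)%R)); last by rewrite leeDl.
    rewrite /h patchE mem_set /= ?in_itv//= lee_fin; apply: bound => //; lra.
  have i : (0 < 1 + v <= 1)%R by apply/andP; split; lra.
  rewrite (_ : 1 - v ^+ 2 = (1 + v) * (1 - v))%R; last by ring.
  apply: (@le_trans _ _ (h (1 + v)%R)); last by rewrite leeDr.
  rewrite /h patchE mem_set /= ?in_itv//= lee_fin; apply: bound => //; lra.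
rewrite ge0_integralD//; try exact: mh'.
rewrite !ge0_integral_affine ?oner_eq0 ?oppr_eq0 ?oner_eq0//.
by rewrite normrN1 normr1 invr1 mul1e lte_add_pinfty.
Qed.

(** An affine change of variable. That the value depends neither on [D] nor on [c] is what makes the
    potential of the ball constant. *)
Lemma integral_invsqrt_quad (b D c : R) : (0 < b)%R -> (0 < D)%R ->
  \int[leb]_z (invsqrt (D - b * (z + c) ^+ 2))%:E = ((Num.sqrt b)^-1)%:E * arcsine_moment 0.
Proof.
move=> b0 D0.
have [sb sD] : (Num.sqrt b != 0 /\ Num.sqrt D != 0)%R by rewrite !gt_eqF ?sqrtr_gt0.
have sb0 := sqrtr_ge0 b; have sD0 := sqrtr_ge0 D.
have qb := sqr_sqrtr (ltW b0); have qD := sqr_sqrtr (ltW D0).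
pose a := (Num.sqrt b / Num.sqrt D)%R.
have a0 : a != 0%R by rewrite mulf_neq0// invr_eq0.
have an : (`|a| = a)%R by rewrite ger0_norm// divr_ge0.
pose g (v : R) := (`|v| ^+ 0 * invsqrt (1 - v ^+ 2))%:E.
transitivity (\int[leb]_z (((Num.sqrt D)^-1)%:E * g (a * z + a * c)%R)).
  apply: eq_integral => z _; rewrite /g expr0 mul1r -EFinM; congr EFin.
  rewrite -invsqrtM ?(ltW D0)//; congr invsqrt.
  by rewrite -mulrDr exprMn /a expr_div_n qb qD; field; exact: lt0r_neq0.
rewrite ge0_integralZl ?lee_fin ?invr_ge0 ?exprn_ge0//; last 2 first.
- exact: (measurableT_comp (mf _) (measurable_affine _ _)).
- by move=> z _; exact: f0.
rewrite (ge0_integral_affine _ a0)//; last 2 first.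
- exact: mf.
- by move=> z; exact: f0.
rewrite an muleA -EFinM; congr (_%:E * _).
by rewrite /a invf_div mulrA mulVf// mul1r.
Qed.

Lemma integral_abs_invsqrt_quad (b : R) k : (0 < b)%R ->
  \int[leb]_z (`|z| ^+ k * invsqrt (1 - b * z ^+ 2))%:E
    = ((Num.sqrt b ^+ k.+1)^-1)%:E * arcsine_moment k.
Proof.
move=> b0.
have sb : (Num.sqrt b != 0)%R by rewrite gt_eqF ?sqrtr_gt0.
have sb0 := sqrtr_ge0 b.
pose g (v : R) := (`|v| ^+ k * invsqrt (1 - v ^+ 2))%:E.
transitivity (\int[leb]_z (((Num.sqrt b ^+ k)^-1)%:E * g (Num.sqrt b * z + 0)%R)).
  apply: eq_integral => z _; rewrite /g addr0 -EFinM; congr EFin.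
  rewrite exprMn sqr_sqrtr ?(ltW b0)// normrM exprMn (ger0_norm sb0) -mulrA mulKf//.
  by rewrite expf_eq0 (negbTE sb) andbF.
rewrite ge0_integralZl ?lee_fin ?invr_ge0 ?exprn_ge0//; last 2 first.
- exact: (measurableT_comp (mf _) (measurable_affine _ _)).
- by move=> z _; exact: f0.
rewrite (ge0_integral_affine _ sb)//; last 2 first.
- exact: mf.
- by move=> z; exact: f0.
rewrite (ger0_norm sb0) muleA -EFinM; congr (_%:E * _).
by rewrite exprS invfM mulrC.
Qed.

End arcsine_density.

(** * Potential of the density (1 - |y|^2)^(-1/2) *)

Section ball_potential.
Context {R : realType} {m : nat}.
Local Open Scope ereal_scope.
Local Notation leb := (@lebesgue_measure R).
Local Notation E := (borel_rV R m).
Local Notation E1 := (borel_rV R m.+1).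
Local Notation vec := ('rV[R]_m).
Local Notation vec1 := ('rV[R]_m.+1).
Variable L : {sigma_finite_measure set E -> \bar R}.
Hypothesis HL : lebesgue_like L.

Let measurable_section (H : R * E -> \bar R) z : measurable_fun setT H ->
  measurable_fun [set: E] (fun w : E => H (z, w)).
Proof.
move=> mH.
have mz : measurable_fun [set: E] (pair z : E -> R * E) by exact: measurable_fun_pair.
exact: (measurableT_comp mH mz).
Qed.

(** Coordinates y = z (1, w) along the lines through the origin, indexed by the slope w, with
    Jacobian |z|^m. The hyperplane z = 0 is a null set. *)
Lemma integral_slice (G : vec1 -> \bar R) (H : R * E -> \bar R) :
  measurable_fun [set: E1] (G : E1 -> \bar R) -> (forall y, 0 <= G y) ->
  measurable_fun setT H -> (forall z, 0 <= H z) ->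
  (forall z (w : vec), z != 0%R -> (`|z| ^+ m)%:E * G (z *: cons_rV 1 w)%R = H (z, w)) ->
  \int[extend L]_y G y = \int[L]_w \int[leb]_z H (z, w).
Proof.
move=> mG G0 mH H0 GH; rewrite integral_extend//.
have mGc : measurable_fun setT (fun z : R * E => G (cons_rV z.1 z.2)).
  exact: (measurableT_comp mG (@measurable_cons_rV R m)).
transitivity (\int[leb]_z \int[L]_w H (z, w)); last first.
  exact: (@fubini_tonelli _ _ _ _ R leb L H mH H0).
have mA : measurable_fun [set: R] (fun t : R => \int[L]_w G (cons_rV t w)).
  exact: (measurable_fun_fubini_tonelli_F (m2 := L) (fun z : R * E => G (cons_rV z.1 z.2)) mGc).
have mB : measurable_fun [set: R] (fun t : R => \int[L]_w H (t, w)).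
  exact: (measurable_fun_fubini_tonelli_F (m2 := L) H mH).
have mT0 : measurable ([set: R] `\ (0%R : R)) by apply: measurableD => //; exact: measurable_set1.
rewrite -[LHS](@integral_setD1 R _ 0%R setT mT0); last exact: measurable_funTS.
rewrite -[RHS](@integral_setD1 R _ 0%R setT mT0); last exact: measurable_funTS.
apply: eq_integral => z; rewrite inE => -[_ /eqP z0].
have [_ S _ _] := HL.
have zm0 : (`|z| ^+ m != 0)%R by rewrite expf_eq0 normr_eq0 (negbTE z0) andbF.
have mz := @measurable_section (fun z : R * E => G (cons_rV z.1 z.2)) z mGc.
transitivity ((`|z| ^+ m)%:E * \int[L]_w G (cons_rV z (z *: (w : vec))%R)).
  rewrite (S (fun w => G (cons_rV z w)))//.
  by rewrite muleA -EFinM mulfV// mul1e.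
rewrite -ge0_integralZl//; last first.
  have mzw : measurable_fun [set: E] (fun w : E => (z *: (w : vec))%R : E).
    by apply: measurable_funZrV => //; exact: measurable_cst.
  exact: (measurableT_comp mz mzw).
by apply: eq_integral => w _; rewrite -GH// cons_rVZ mulr1.
Qed.

Definition arcsine_density (y : vec1) : R := invsqrt (1 - enorm y ^+ 2).

Lemma arcsine_density_ge0 y : (0 <= arcsine_density y)%R.
Proof. exact: invsqrt_ge0. Qed.

Lemma measurable_arcsine_density : measurable_fun [set: E1] (arcsine_density : E1 -> R).
Proof.
apply: measurable_invsqrt_quad; apply: measurable_funB; first exact: measurable_cst.
by apply: measurable_funX; exact: measurable_enorm.
Qed.

Let b (w : vec) : R := (1 + enorm w ^+ 2)%R.

Let b1 w : (1 <= b w)%R.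
Proof. by rewrite lerDl sqr_ge0. Qed.

Let b0 w : (0 < b w)%R.
Proof. exact: lt_le_trans (b1 w). Qed.

Let sb0 w : (0 < Num.sqrt (b w))%R.
Proof. by rewrite sqrtr_gt0. Qed.

Let mb : measurable_fun [set: E] (b : E -> R).
Proof.
apply: measurable_funD; first exact: measurable_cst.
by apply: measurable_funX; exact: measurable_enorm.
Qed.

Let mb' : measurable_fun [set: R * E] (fun z : R * E => b z.2 : R).
Proof. exact: (measurableT_comp mb (@measurable_snd _ _ R E)). Qed.

Let mz' : measurable_fun [set: R * E] (fun z : R * E => z.1 : R).
Proof. exact: measurable_fst. Qed.

Let minv k : measurable_fun [set: E] (fun w : E => (Num.sqrt (b w) ^+ k)^-1 : R)%R.
Proof.
rewrite (_ : (fun _ => _) = fun w : E => invsqrt (b w) ^+ k :> R)%R; last first.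
  by apply/funext => w; rewrite exprVn.
by apply: measurable_funX; exact: measurable_invsqrt_quad.
Qed.

Definition slope_mass : \bar R := \int[L]_w ((Num.sqrt (b w) ^+ m.+1)^-1)%:E.

Let sqrt_pow w : ((Num.sqrt (b w) ^+ m.+1)^-1 = b w `^ (- (m.+1%:R / 2)))%R.
Proof.
by rewrite -powR12_sqrt ?(ltW (b0 w))// -powR_mulrn ?powR_ge0// -powRrM powRN mulrC.
Qed.

Lemma slope_mass_gt0 : 0 < slope_mass.
Proof.
have [_ _ L0 _] := HL.
apply: integral_gt0 => //; first by apply/measurable_EFinP; exact: minv.
by move=> w _; rewrite lte_fin invr_gt0 exprn_gt0.
Qed.

Lemma slope_mass_fin : slope_mass < +oo.
Proof.
have [_ _ _ C] := HL.
have mm : (m.+1%:R <= 2 * (m.+1%:R / 2) :> R)%R by rewrite mulrC divfK.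
apply: le_lt_trans (C _ mm).
rewrite le_eqVlt; apply/orP; left; apply/eqP.
by apply: eq_integral => w _; rewrite sqrt_pow.
Qed.

Let enorm_slice z w : (enorm (z *: cons_rV 1 w) ^+ 2 = b w * z ^+ 2)%R.
Proof.
by rewrite enormZ exprMn real_normK ?num_real// sqr_enorm_cons expr1n mulrC.
Qed.

Lemma arcsine_mass :
  \int[extend L]_y (arcsine_density y)%:E = slope_mass * arcsine_moment m.
Proof.
have am0 : 0 <= @arcsine_moment R m by exact/ltW/arcsine_moment_gt0.
have amf : @arcsine_moment R m \is a fin_num by rewrite ge0_fin_numE// arcsine_moment_fin.
rewrite (integral_slice (H := fun z => (`|z.1| ^+ m * invsqrt (1 - b z.2 * z.1 ^+ 2))%:E)).
- transitivity (\int[L]_w (((Num.sqrt (b w) ^+ m.+1)^-1)%:E * arcsine_moment m)).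
    by apply: eq_integral => w _; exact: (integral_abs_invsqrt_quad _ (b0 w)).
  rewrite -(fineK amf) ge0_integralZr//.
  + by apply/measurable_EFinP; exact: minv.
  + by rewrite fineK.
- by apply/measurable_EFinP; exact: measurable_arcsine_density.
- by move=> y; rewrite lee_fin arcsine_density_ge0.
- apply/measurable_EFinP; apply: measurable_funM.
    by apply: measurable_funX; exact: (measurableT_comp (@normr_measurable R setT) mz').
  apply: measurable_invsqrt_quad; apply: measurable_funB; first exact: measurable_cst.
  by apply: measurable_funM => //; exact: measurable_funX.
- by move=> z; rewrite lee_fin mulr_ge0 ?exprn_ge0// invsqrt_ge0.
- by move=> z w z0; rewrite -EFinM /arcsine_density enorm_slice.
Qed.

(** Integrate along the lines through the point (N, 0). The kernel |z|^(-m) (1 + |w|^2)^(-m/2)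
    cancels the Jacobian |z|^m, and what remains on each line is an integral of
    [integral_invsqrt_quad], the same for every N. *)
Lemma arcsine_potential (N : R) : (0 < m)%N -> (0 <= N <= 1)%R ->
  \int[extend L]_y (nker m%:R 0 (cons_rV N 0) y * (arcsine_density y)%:E)
    = slope_mass * arcsine_moment 0.
Proof.
move=> m0 /andP[N0 N1].
have am0 : 0 <= @arcsine_moment R 0 by exact/ltW/arcsine_moment_gt0.
have amf : @arcsine_moment R 0 \is a fin_num by rewrite ge0_fin_numE// arcsine_moment_fin.
set v := cons_rV N 0.
pose g (y : vec1) := nker m%:R 0 v y * (arcsine_density y)%:E.
have mg : measurable_fun [set: E1] (g : E1 -> \bar R).
  apply: emeasurable_funM; first by apply: measurable_nker_r; rewrite ler0n.
  by apply/measurable_EFinP; exact: measurable_arcsine_density.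
have g0 y : 0 <= g y by rewrite mule_ge0 ?nker_ge0// lee_fin arcsine_density_ge0.
have [T _ _ _] := lebesgue_like_extend HL.
rewrite -/(g _) -(T g mg g0 v).
have mgv : measurable_fun [set: E1] (fun y : E1 => g ((y : vec1) + v)%R).
  by apply: (measurableT_comp mg); apply: measurable_funDrV => //; exact: measurable_cst.
(* Completing the square in z of 1 - |(N, 0) + z (1, w)|^2; [D w] is at least 1 / [b w], hence
   positive even for N = 1. *)
pose D w := (1 - N ^+ 2 + N ^+ 2 / b w)%R.
pose H (z : R * E) := ((Num.sqrt (b z.2) ^+ m)^-1 * invsqrt (D z.2 - b z.2 * (z.1 + N / b z.2) ^+ 2))%:E : \bar R.
have HE z w : (1 - ((N + z) ^+ 2 + z ^+ 2 * enorm w ^+ 2) = D w - b w * (z + N / b w) ^+ 2)%R.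
  have := b0 w; rewrite /D /b => bp; field; exact: lt0r_neq0.
rewrite (integral_slice (H := H))//.
- transitivity (\int[L]_w (((Num.sqrt (b w) ^+ m.+1)^-1)%:E * arcsine_moment 0)).
    apply: eq_integral => w _; rewrite /H /=.
    have D0 : (0 < D w)%R.
      apply: (@lt_le_trans _ _ (b w)^-1%R); first by rewrite invr_gt0.
      rewrite -subr_ge0 (_ : _ - _ = (1 - N ^+ 2) * (1 - (b w)^-1))%R; last by rewrite /D; ring.
      by rewrite mulr_ge0// subr_ge0 ?exprn_ile1// invf_le1.
    under eq_integral do rewrite EFinM.
    rewrite ge0_integralZl//.
    + by rewrite integral_invsqrt_quad// muleA -EFinM -invfM -exprSr.
    + apply/measurable_EFinP; apply: measurable_invsqrt_quad.
      apply: measurable_funB; first exact: measurable_cst.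
      apply: measurable_funM; first exact: measurable_cst.
      by apply: measurable_funX; apply: measurable_funD => //; exact: measurable_cst.
    + by move=> z _; rewrite lee_fin invsqrt_ge0.
  rewrite -(fineK amf) ge0_integralZr//.
  + by apply/measurable_EFinP; exact: minv.
  + by rewrite fineK.
- apply/measurable_EFinP; apply: measurable_funM.
    exact: (measurableT_comp (minv m) (@measurable_snd _ _ R E)).
  under eq_fun do rewrite -HE.
  apply: measurable_invsqrt_quad; apply: measurable_funB; first exact: measurable_cst.
  apply: measurable_funD.
    by apply: measurable_funX; apply: measurable_funD => //; exact: measurable_cst.
  apply: measurable_funM; first exact: measurable_funX.
  have me : measurable_fun [set: R * E] (fun z : R * E => enorm (z.2 : vec) : R).
    exact: (measurableT_comp measurable_enorm (@measurable_snd _ _ R E)).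
  exact: measurable_funX.
- by move=> z; rewrite lee_fin mulr_ge0 ?invsqrt_ge0// invr_ge0 exprn_ge0// sqrtr_ge0.
- move=> z w z0; rewrite /g /H /=.
  have dE : (enorm (v - (z *: cons_rV 1 w + v)) = `|z| * Num.sqrt (b w))%R.
    rewrite opprD addrCA subrr addr0 enormN enormZ; congr (_ * _)%R.
    by rewrite -[LHS]ger0_norm ?enorm_ge0// -sqrtr_sqr sqr_enorm_cons expr1n.
  have zn : (0 < `|z|)%R by rewrite normr_gt0.
  have d0 : (0 < `|z| * Num.sqrt (b w))%R by rewrite mulr_gt0.
  have -> : nker m%:R 0 v (z *: cons_rV 1 w + v)%R = ((`|z| ^+ m)^-1 * (Num.sqrt (b w) ^+ m)^-1)%:E.
    rewrite /nker dE gt_eqF// /profile addr0 max_r; last first.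
      by rewrite /raw_profile pnatr_eq0 gtn_eqF// powR_ge0.
    rewrite /raw_profile pnatr_eq0 gtn_eqF// powRN powR_mulrn ?(ltW d0)//.
    by rewrite exprMn invfM.
  rewrite /arcsine_density cons_rVZ cons_rVD mulr1 addr0 sqr_enorm_cons enormZ exprMn real_normK ?num_real//.
  rewrite (addrC z N) HE muleA -!EFinM; congr EFin.
  by rewrite mulrA mulfV ?mul1r// expf_eq0 (gt_eqF zn) andbF.
Qed.

End ball_potential.

(** * Rotation invariance of the extended measure *)

Section rotations.
Context {R : realType} {m : nat}.
Local Open Scope ereal_scope.
Local Notation leb := (@lebesgue_measure R).
Local Notation E := (borel_rV R m).
Local Notation E1 := (borel_rV R m.+1).
Local Notation vec := ('rV[R]_m).
Local Notation vec1 := ('rV[R]_m.+1).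
Variable L : {sigma_finite_measure set E -> \bar R}.
Hypothesis HL : lebesgue_like L.

Definition invariant (T : vec1 -> vec1) :=
  measurable_fun [set: E1] (T : E1 -> E1) /\
  forall g : vec1 -> \bar R, measurable_fun [set: E1] (g : E1 -> \bar R) ->
    (forall y, 0 <= g y) -> \int[extend L]_y g (T y) = \int[extend L]_y g y.

Definition isometry (T : vec1 -> vec1) := forall x y, enorm (T x - T y) = enorm (x - y).

Lemma invariant_comp S T : invariant S -> invariant T -> invariant (S \o T).
Proof.
move=> [mS iS] [mT iT]; split; first exact: (measurableT_comp mS mT).
move=> g mg g0; rewrite -(iS g mg g0) -(iT (g \o S) _ (fun y => g0 _))//.
exact: (measurableT_comp mg mS).
Qed.

Definition dot (w u : vec) : R := (\sum_i w ord0 i * u ord0 i)%R.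

Lemma dotB w w' u : dot (w - w') u = (dot w u - dot w' u)%R.
Proof. by rewrite /dot -sumrB; apply: eq_bigr => i _; rewrite !mxE mulrBl. Qed.

Lemma dotDZ w c u : dot (w + c *: u) u = (dot w u + c * enorm u ^+ 2)%R.
Proof.
rewrite /dot sqr_enorm mulr_sumr -big_split; apply: eq_bigr => i _ /=.
by rewrite !mxE; ring.
Qed.

Lemma sqr_enormDZ w c u :
  (enorm (w + c *: u) ^+ 2 = enorm w ^+ 2 + 2 * c * dot w u + c ^+ 2 * enorm u ^+ 2)%R.
Proof.
rewrite !sqr_enorm /dot !mulr_sumr -!big_split; apply: eq_bigr => i _ /=.
by rewrite !mxE; ring.
Qed.

Let measurable_dot u : measurable_fun [set: E] (fun w : E => dot w u : R).
Proof.
apply: measurable_sum => i; apply: measurable_funM; first exact: measurable_coord.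
exact: measurable_cst.
Qed.

Let measurable_consT d (T : measurableType d) (f : T -> R) (g : T -> E) :
  measurable_fun setT f -> measurable_fun setT g ->
  measurable_fun setT (fun t => cons_rV (f t) (g t) : E1).
Proof.
move=> mf mg.
exact: (measurableT_comp (@measurable_cons_rV R m) (measurable_fun_pair mf mg)).
Qed.

Let mcomp (g : vec1 -> \bar R) : measurable_fun [set: E1] (g : E1 -> \bar R) ->
  measurable_fun setT (fun z : R * E => g (cons_rV z.1 z.2)).
Proof. by move=> mg; exact: (measurableT_comp mg (@measurable_cons_rV R m)). Qed.

Let msect1 (H : R * E -> \bar R) w : measurable_fun setT H ->
  measurable_fun [set: R] (fun t : R => H (t, w)).
Proof.
move=> mH.
have mz : measurable_fun [set: R] (fun t : R => (t, w) : R * E) by exact: measurable_fun_pair.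
exact: (measurableT_comp mH mz).
Qed.

Let msect2 (H : R * E -> \bar R) t : measurable_fun setT H ->
  measurable_fun [set: E] (fun w : E => H (t, w)).
Proof.
move=> mH.
have mz : measurable_fun [set: E] (fun w : E => (t, w) : R * E) by exact: measurable_fun_pair.
exact: (measurableT_comp mH mz).
Qed.

Definition shear1 (u : vec) (a : R) (y : vec1) : vec1 :=
  cons_rV (y ord0 ord0 + a * dot (tail_rV y) u) (tail_rV y).

Definition shear2 (u : vec) (b : R) (y : vec1) : vec1 :=
  cons_rV (y ord0 ord0) (tail_rV y + (b * y ord0 ord0) *: u).

Let mdot_tail u : measurable_fun [set: E1] (fun y : E1 => dot (tail_rV (y : vec1)) u : R).
Proof. exact: (measurableT_comp (measurable_dot u) (@measurable_tail_rV R m)). Qed.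

(** A shear translates one factor by an amount depending on the other, so Fubini and translation
    invariance suffice. *)
Lemma invariant_shear1 u a : invariant (shear1 u a).
Proof.
have mT : measurable_fun [set: E1] (shear1 u a : E1 -> E1).
  apply: measurable_consT; last exact: measurable_tail_rV.
  apply: measurable_funD; first exact: measurable_coord.
  by apply: measurable_funM; [exact: measurable_cst|exact: mdot_tail].
split => // g mg g0.
have mgT : measurable_fun [set: E1] (fun y : E1 => g (shear1 u a y)) by exact: (measurableT_comp mg mT).
rewrite (integral_extend L mgT (fun y => g0 _)) (integral_extend L mg g0).
rewrite -[LHS]/(\int[leb]_t \int[L]_w (fun z : R * E => g (shear1 u a (cons_rV z.1 z.2))) (t, w)).
rewrite -[RHS]/(\int[leb]_t \int[L]_w (fun z : R * E => g (cons_rV z.1 z.2)) (t, w)).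
rewrite [LHS](@fubini_tonelli _ _ _ _ R leb L _ (mcomp mgT) (fun z => g0 _)).
rewrite [RHS](@fubini_tonelli _ _ _ _ R leb L _ (mcomp mg) (fun z => g0 _)).
apply: eq_integral => w _ /=.
have := @ge0_integral_affine R (fun t => g (cons_rV t w)) 1%R (a * dot w u)%R (oner_neq0 _) (msect1 w (mcomp mg)) (fun t => g0 _).
rewrite normr1 invr1 mul1e => <-; apply: eq_integral => t _.
by rewrite /shear1 cons_rV0 tail_cons_rV mul1r.
Qed.

Lemma invariant_shear2 u b : invariant (shear2 u b).
Proof.
have mT : measurable_fun [set: E1] (shear2 u b : E1 -> E1).
  apply: measurable_consT; first exact: measurable_coord.
  apply: measurable_funDrV; first exact: measurable_tail_rV.
  apply: measurable_funZrV; last exact: measurable_cst.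
  by apply: measurable_funM; [exact: measurable_cst|exact: measurable_coord].
split => // g mg g0.
have mgT : measurable_fun [set: E1] (fun y : E1 => g (shear2 u b y)) by exact: (measurableT_comp mg mT).
rewrite (integral_extend L mgT (fun y => g0 _)) (integral_extend L mg g0).
apply: eq_integral => t _.
have [T _ _ _] := HL.
rewrite -[RHS](T (fun w => g (cons_rV t w)) (msect2 t (mcomp mg)) (fun w => g0 _) ((b * t) *: u)%R).
by apply: eq_integral => w _; rewrite /shear2 cons_rV0 tail_cons_rV.
Qed.

Definition reflection (y : vec1) : vec1 := cons_rV (- y ord0 ord0) (tail_rV y).

Lemma invariant_reflection : invariant reflection.
Proof.
have mT : measurable_fun [set: E1] (reflection : E1 -> E1).
  apply: measurable_consT; last exact: measurable_tail_rV.
  by apply: measurableT_comp => //; exact: measurable_coord.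
split => // g mg g0.
have mgT : measurable_fun [set: E1] (fun y : E1 => g (reflection y)) by exact: (measurableT_comp mg mT).
rewrite (integral_extend L mgT (fun y => g0 _)) (integral_extend L mg g0).
have mH : measurable_fun [set: R] (fun t : R => \int[L]_w g (cons_rV t w)).
  exact: (measurable_fun_fubini_tonelli_F (m2 := L) (fun z : R * E => g (cons_rV z.1 z.2)) (mcomp mg)).
have N1 : (-1 != 0 :> R)%R by rewrite oppr_eq0 oner_eq0.
have := @ge0_integral_affine R (fun t => \int[L]_w g (cons_rV t w)) (-1)%R 0%R N1 mH.
rewrite normrN1 invr1 mul1e => <-; last by move=> t; exact: integral_ge0.
apply: eq_integral => t _; apply: eq_integral => w _.
by rewrite /reflection cons_rV0 tail_cons_rV mulN1r addr0.
Qed.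

Lemma sqr_enorm_tail (y : vec1) : (enorm y ^+ 2 = y ord0 ord0 ^+ 2 + enorm (tail_rV y) ^+ 2)%R.
Proof. by rewrite -[in LHS](cons_tail_rV y) sqr_enorm_cons. Qed.

Let enorm_sqr_eq (x y : vec1) : (enorm x ^+ 2 = enorm y ^+ 2)%R -> enorm x = enorm y.
Proof. by move/eqP; rewrite eqrXn2 ?enorm_ge0// => /eqP. Qed.

Lemma cons_rVB t t' (w w' : vec) : (cons_rV t w - cons_rV t' w' = cons_rV (t - t') (w - w'))%R.
Proof. by rewrite -[(- cons_rV t' w')%R]scaleN1r cons_rVZ cons_rVD mulN1r scaleN1r. Qed.

Lemma isometry_reflection : isometry reflection.
Proof.
move=> x y; apply: enorm_sqr_eq; rewrite /reflection cons_rVB sqr_enorm_cons.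
by rewrite -[in RHS](cons_tail_rV x) -[in RHS](cons_tail_rV y) cons_rVB sqr_enorm_cons; ring.
Qed.

(* The composition of three shears with slopes [a], [-2a/(1+a^2)], [a] is the
   rotation of angle [2 atan a] in the plane of the first axis and [u]. *)
Definition rotation (u : vec) (a : R) : vec1 -> vec1 :=
  shear1 u a \o (shear2 u (- (2 * a / (1 + a ^+ 2))) \o shear1 u a).

Lemma isometry_rotation u a : enorm u = 1%R -> isometry (rotation u a).
Proof.
move=> u1 x y; apply: enorm_sqr_eq.
set b := (- (2 * a / (1 + a ^+ 2)))%R.
have ab : (b + a ^+ 2 * b + 2 * a = 0)%R.
  by rewrite /b; field; rewrite gt_eqF// ltr_pwDl// sqr_ge0.
have rE z : rotation u a z = cons_rV (z ord0 ord0 + a * dot (tail_rV z) u +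
     a * (dot (tail_rV z) u + b * (z ord0 ord0 + a * dot (tail_rV z) u)))
    (tail_rV z + (b * (z ord0 ord0 + a * dot (tail_rV z) u)) *: u).
  by rewrite /rotation /= /shear1 /shear2 !cons_rV0 !tail_cons_rV dotDZ u1 expr1n mulr1.
rewrite !rE cons_rVB sqr_enorm_cons.
rewrite -[in RHS](cons_tail_rV x) -[in RHS](cons_tail_rV y) cons_rVB sqr_enorm_cons.
set tx := x ord0 ord0; set ty := y ord0 ord0.
set wx := tail_rV x; set wy := tail_rV y.
set cx := (b * (tx + _))%R; set cy := (b * (ty + _))%R.
have -> : (wx + cx *: u - (wy + cy *: u) = (wx - wy) + (cx - cy) *: u)%R.
  by rewrite scalerBl opprD addrACA.
rewrite sqr_enormDZ u1 dotB /cx /cy.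
set kx := dot wx u; set ky := dot wy u.
set t := (tx - ty)%R; set k := (kx - ky)%R.
have -> : (b * (tx + a * kx) - b * (ty + a * ky) = b * (t + a * k))%R by rewrite /t /k; ring.
have -> : (tx + a * kx + a * (kx + b * (tx + a * kx)) - (ty + a * ky + a * (ky + b * (ty + a * ky)))
  = t + a * k + a * (k + b * (t + a * k)))%R by rewrite /t /k; ring.
move: ab (enorm _) => ab e.
have key : ((t + a * k + a * (k + b * (t + a * k))) ^+ 2 + 2 * (b * (t + a * k)) * k + (b * (t + a * k)) ^+ 2
  - t ^+ 2 = (b + a ^+ 2 * b + 2 * a) * (t + a * k) * (2 * k + b * (t + a * k)))%R by ring.
by move: key; rewrite ab !mul0r => /eqP; rewrite subr_eq0 => /eqP <-; ring.
Qed.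

(** One rotation in the plane of the first axis and [x]; when [x] already lies on that axis, the
    identity or a reflection. *)
Lemma rotate_to_axis (x : vec1) : exists T : vec1 -> vec1,
  [/\ invariant T, isometry T, T 0%R = 0%R & T x = cons_rV (enorm x) 0].
Proof.
have sx := sqr_enorm_tail x.
have tail0 : tail_rV (0%R : vec1) = 0%R by apply/rowP => j; rewrite !mxE.
have cons0 : cons_rV (0%R : R) (0%R : vec) = 0%R.
  by apply/rowP => i; rewrite !mxE; case: unliftP => // j _; rewrite mxE.
have [w0|w0] := eqVneq (tail_rV x) 0%R.
  have {}sx : enorm x = `|x ord0 ord0|%R.
    apply/eqP; rewrite -(@eqrXn2 _ 2)// ?enorm_ge0// real_normK ?num_real//.
    by rewrite sx w0 enorm0 expr0n addr0.
  have [x0|x0] := leP 0%R (x ord0 ord0).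
    exists id; split=> [||//|]; [|by move=> y z|].
      by split=> [|g mg g0 //]; exact: measurable_id.
    by rewrite sx ger0_norm// -w0 cons_tail_rV.
  exists reflection; split.
  - exact: invariant_reflection.
  - exact: isometry_reflection.
  - by rewrite /reflection tail0 mxE oppr0.
  - by rewrite /reflection w0 sx ltr0_norm.
set r := enorm (tail_rV x).
have r0 : (0 < r)%R by rewrite enorm_gt0.
pose u := (r^-1 *: tail_rV x)%R.
have u1 : enorm u = 1%R by rewrite enormZ ger0_norm ?invr_ge0 ?(ltW r0)// mulVf// gt_eqF.
have wE : tail_rV x = (r *: u)%R by rewrite /u scalerA mulfV ?scale1r// gt_eqF.
have dotx : dot (tail_rV x) u = r.
  by rewrite -[tail_rV x]add0r wE dotDZ u1 expr1n mulr1 /dot big1 ?add0r// => i _; rewrite mxE mul0r.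
(* The tangent of half the angle between [x] and the first axis. *)
pose a := ((enorm x - x ord0 ord0) / r)%R.
have dot0 : dot 0%R u = 0%R by rewrite /dot big1// => i _; rewrite mxE mul0r.
exists (rotation u a); split.
- apply: invariant_comp; first exact: invariant_shear1.
  by apply: invariant_comp; [exact: invariant_shear2|exact: invariant_shear1].
- exact: isometry_rotation.
- rewrite /rotation /= /shear1 /shear2 !cons_rV0 !tail_cons_rV tail0 dot0 mxE !mulr0 addr0 mulr0.
  by rewrite scale0r addr0 dot0 mulr0 addr0.
- rewrite /rotation /= /shear1 /shear2 !cons_rV0 !tail_cons_rV dotx.
  have ar : (a * r = enorm x - x ord0 ord0)%R by rewrite divfK// gt_eqF.
  have tE : (x ord0 ord0 + a * r = enorm x)%R by rewrite ar; ring.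
  rewrite tE wE -scalerDl.
  have -> : (r + - (2 * a / (1 + a ^+ 2)) * enorm x = 0)%R.
    have aq : (r * (1 + a ^+ 2) = 2 * a * enorm x)%R.
      have : (r * (r * (1 + a ^+ 2)) = r * (2 * a * enorm x))%R.
        rewrite (_ : r * (r * _) = r ^+ 2 + (a * r) ^+ 2)%R; last by ring.
        rewrite (_ : r * (2 * a * enorm x) = 2 * (a * r) * enorm x)%R; last by ring.
        have -> : (r ^+ 2 = enorm x ^+ 2 - x ord0 ord0 ^+ 2)%R by rewrite sx -/r; ring.
        by rewrite ar; ring.
      by apply: mulfI; rewrite gt_eqF.
    have a1 : (1 + a ^+ 2 != 0)%R by rewrite gt_eqF// ltr_pwDl// sqr_ge0.
    rewrite mulNr mulrAC -aq mulfK// subrr//.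
  by rewrite scale0r dot0 mulr0 addr0.
Qed.

End rotations.

Section exists_ball_measure.
Context {R : realType}.
Local Open Scope ereal_scope.

(** The normalised density is radial because both the Lebesgue measure and the density are rotation
    invariant, so its potential need only be computed at points of the first axis. *)
Lemma exists_ball_measureS m : (0 < m)%N ->
  exists nu : probability (borel_rV R m.+1) R, ball_measure m%:R nu.
Proof.
move=> m0; have [L HL] := @exists_lebesgue R m.
have C0 := slope_mass_gt0 HL; have Cf := slope_mass_fin HL.
have A0 := @arcsine_moment_gt0 R m; have Af := @arcsine_moment_fin R m.
have B0 := @arcsine_moment_gt0 R 0; have Bf := @arcsine_moment_fin R 0.
have Cn : slope_mass L \is a fin_num by rewrite ge0_fin_numE// ltW.
have An : @arcsine_moment R m \is a fin_num by rewrite ge0_fin_numE// ltW.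
have Bn : @arcsine_moment R 0 \is a fin_num by rewrite ge0_fin_numE// ltW.
have amass := arcsine_mass HL; have apot := @arcsine_potential R m L HL.
move: (slope_mass L) (@arcsine_moment R m) (@arcsine_moment R 0) => C A B in C0 Cf A0 Af B0 Bf Cn An Bn amass apot.
pose c := (fine C * fine A)%R.
have c0 : (0 < c)%R by rewrite mulr_gt0// fine_gt0// ?C0 ?A0.
pose F := @arcsine_density R m.
have F0 := @arcsine_density_ge0 R m.
have mF := @measurable_arcsine_density R m.
pose dens := density (extend L) F0 mF.
have mass : dens setT = c%:E.
  by rewrite /dens /density amass /c EFinM !fineK.
have [nu [nuE nuI]] := restriction_probability measurableT c0 mass.
have I (f : 'rV[R]_m.+1 -> \bar R) : measurable_fun [set: borel_rV R m.+1] (f : borel_rV R m.+1 -> \bar R) ->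
    (forall y, 0 <= f y) -> \int[nu]_y f y = c^-1%:E * \int[extend L]_y (f y * (F y)%:E).
  by move=> mf f0; rewrite nuI// -(integral_density (extend L) F0 mF).
have mnorm (x : 'rV[R]_m.+1) : measurable_fun [set: borel_rV R m.+1] (fun y : borel_rV R m.+1 => enorm (x - (y : 'rV[R]_m.+1)) : R).
  by apply: measurable_dist => //; exact: measurable_cst.
have rad : radial nu.
  move=> phi mphi phi0.
  have main (x : 'rV[R]_m.+1) : \int[nu]_y phi (enorm (x - (y : 'rV[R]_m.+1)))
      = \int[nu]_y phi (enorm (cons_rV (enorm x) 0 - (y : 'rV[R]_m.+1))).
    have mp (z : 'rV[R]_m.+1) : measurable_fun [set: borel_rV R m.+1] (fun y : borel_rV R m.+1 => phi (enorm (z - (y : 'rV[R]_m.+1)))).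
      exact: (measurableT_comp mphi (mnorm z)).
    rewrite (I _ (mp x) (fun y => phi0 _)) (I _ (mp _) (fun y => phi0 _)); congr (_ * _).
    have [T [[mT iT] isoT T0 Tx]] := rotate_to_axis HL x.
    have normT y : enorm (T y) = enorm y by have := isoT y 0%R; rewrite T0 !subr0.
    rewrite -Tx.
    rewrite -[RHS](iT (fun y => phi (enorm (T x - y)) * (F y)%:E)).
    - by apply: eq_integral => y _; rewrite isoT /F /arcsine_density normT.
    - by apply: emeasurable_funM; [exact: mp|apply/measurable_EFinP].
    - by move=> y; rewrite mule_ge0// lee_fin F0.
  by move=> x x' xx'; rewrite main xx' -main.
exists nu; split => //.
- have mB : measurable (origin_ball 1 : set (borel_rV R m.+1)) by apply: closed_borel; exact: closed_origin_ball.
  rewrite nuE// setIT.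
  suff dB : dens (origin_ball 1) = c%:E.
    transitivity (c^-1%:E * c%:E); first by congr (_ * _).
    by rewrite -EFinM mulVf// gt_eqF.
  rewrite -mass /dens /density integral_mkcond; apply: eq_integral => y _.
  rewrite patchE; case: ifPn => //; rewrite notin_setE /origin_ball /= => /negP.
  rewrite -ltNge => y1; rewrite /arcsine_density /invsqrt ler0_sqrtr ?invr0//.
  by rewrite subr_le0 exprn_ege1// ltW.
- move=> m' adm.
  have m'0 : m' = 0%R by case: adm => [[/eqP]|[]//]; rewrite pnatr_eq0 gtn_eqF.
  rewrite {adm}m'0.
  exists (c^-1 * (fine C * fine B))%R => x x1.
  pose phi (t : R) : \bar R := if t == 0%R then +oo else (profile m%:R 0 t)%:E.
  have mphi : measurable_fun setT phi.
    apply: measurable_fun_ifT => //.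
      by apply: measurable_fun_eqr => //; exact: measurable_cst.
    by apply/measurable_EFinP; exact: measurable_profile.
  have phi0 t : 0 <= phi t by rewrite /phi; case: ifP => // _; rewrite lee_fin profile_ge0.
  have ee : enorm x = enorm (cons_rV (enorm x) (0 : 'rV[R]_m)).
    apply/eqP; rewrite -(@eqrXn2 _ 2)// ?enorm_ge0// sqr_enorm_cons enorm0.
    by rewrite expr0n addr0.
  rewrite -[LHS]/(\int[nu]_y phi (enorm (x - (y : 'rV[R]_m.+1)))).
  rewrite (rad phi mphi phi0 _ _ ee).
  rewrite -[LHS]/(\int[nu]_y nker m%:R 0 (cons_rV (enorm x) 0) y).
  rewrite I; last 2 first.
  - by apply: measurable_nker_r; rewrite ler0n.
  - by move=> y; exact: nker_ge0.
  by rewrite /F apot ?enorm_ge0// !EFinM !fineK.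
Qed.

Lemma exists_ball_measure n : (0 < n)%N ->
  exists nu : probability (borel_rV R n) R, ball_measure (n%:R - 1) nu.
Proof.
case: n => [//|[|n]] _; first by rewrite subrr; exact: ball_measure1.
by rewrite -[X in (X - 1)%R]natr1 addrK; exact: exists_ball_measureS.
Qed.

End exists_ball_measure.

(** * Capacity, energy and the shifted kernel *)

Section integral_shift.
Context d (T : measurableType d) (R : realType).
Local Open Scope ereal_scope.

(** It holds for infinite integrals as well: the negative part of f - c is at most [c], so the
    positive part carries the value +oo. *)
Lemma integral_subcst (P : probability T R) (K : set T) (f : T -> \bar R) (c : R) :
  measurable K -> P K = 1 -> measurable_fun setT f -> (forall x, 0 <= f x) -> (0 <= c)%R ->
  \int[P]_(x in K) (f x - c%:E) = \int[P]_x f x - c%:E.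
Proof.
move=> mK PK mf f0 c0.
have If : \int[P]_(x in K) f x = \int[P]_x f x by exact: integral_probability1.
have mfK : measurable_fun K f by exact: measurable_funTS.
have Ic : \int[P]_(x in K) c%:E = c%:E.
  by rewrite integral_cst// -[RHS]mule1; congr (_ * _); exact: PK.
have ic : P.-integrable K (fun=> c%:E).
  apply/integrableP; split; first exact: measurable_cst.
  rewrite (_ : \int[P]_(x in K) `|c%:E| = c%:E) ?ltry// -[RHS]Ic.
  by apply: eq_integral => x _; rewrite gee0_abs.
rewrite -If; have [Ioo|Ioo] := ltP (\int[P]_(x in K) f x) +oo.
  have fi : P.-integrable K f.
    apply/integrableP; split => //; apply: le_lt_trans Ioo.
    rewrite le_eqVlt; apply/orP; left; apply/eqP.
    by apply: eq_integral => x _; rewrite gee0_abs.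
  by rewrite integralB// Ic.
have {Ioo} E : \int[P]_(x in K) f x = +oo by apply/eqP; rewrite -leye_eq.
rewrite E addye//.
pose g x := f x - c%:E.
have mg : measurable_fun K g by apply: emeasurable_funB => //; exact: measurable_cst.
rewrite -/(g _) integralE.
have neg : \int[P]_(x in K) g^\- x <= c%:E.
  rewrite -[leRHS]Ic; apply: ge0_le_integral => //.
  - exact: measurable_funeneg.
  - by move=> x _; rewrite funenegE /g fin_num_oppeB// ge_max lee_fin c0 andbT addeC -[leRHS]adde0 leeD2l// oppe_le0.
have pos : \int[P]_(x in K) g^\+ x = +oo.
  apply/eqP; rewrite -leye_eq -(@leeD2rE _ c%:E)// addye//.
  rewrite -[X in _ + X]Ic -E -ge0_integralD//; last exact: measurable_funepos.
  apply: ge0_le_integral => //.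
  - by apply: emeasurable_funD; [exact: measurable_funepos|exact: measurable_cst].
  - move=> x _; rewrite -leeBlDr//; by rewrite funeposE /g le_max lexx.
have nf : \int[P]_(x in K) g^\- x \is a fin_num.
  by rewrite ge0_fin_numE ?integral_ge0//; apply: le_lt_trans neg _; rewrite ltry.
by rewrite pos -(fineK nf).
Qed.

End integral_shift.

Section capacity_energy.
Context {R : realType} {n : nat}.
Local Open Scope ereal_scope.
Local Notation E := (borel_rV R n).
Local Notation vec := ('rV[R]_n).
Implicit Types (K : set vec) (p : R).

Lemma cap_pkernel p K : cap p K = if p == 0%R then expeR (- min_energy (pkernel p) K)
  else (min_energy (pkernel p) K)^-1 `^ p^-1.
Proof. rewrite /cap /pkernel /log_energy /riesz_energy; case: (p == 0%R); reflexivity. Qed.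

Lemma riesz_min_energy_ge0 p K : p != 0%R -> 0 <= min_energy (pkernel p) K.
Proof.
move=> p0; apply: le_ereal_inf_tmp => _ [Q _ <-].
apply: integral_ge0 => x _; apply: integral_ge0 => y _.
by rewrite /pkernel (negbTE p0) inve_ge0 lee_fin powR_ge0.
Qed.

(** The hypothesis on capacities enters the argument only as an equality of energies. *)
Lemma cap_inj p K K' : cap p K = cap p K' ->
  min_energy (pkernel p) K = min_energy (pkernel p) K'.
Proof.
rewrite !cap_pkernel; case: eqP => [_|/eqP p0].
  by move=> /expeR_inj /eqP; rewrite eqe_opp => /eqP.
have := riesz_min_energy_ge0 K p0; have := riesz_min_energy_ge0 K' p0.
move: (min_energy _ K) (min_energy _ K') => a b b0 a0.
move=> /(congr1 (fun z => z `^ p)); rewrite -!poweRrM mulVf//.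
by rewrite !poweRe1 ?inve_ge0// => /(can_inj (@inveK R)).
Qed.

Lemma cap_eq0 p K : cap p K = 0 <-> min_energy (pkernel p) K = +oo.
Proof.
rewrite cap_pkernel; case: eqP => [_|/eqP p0].
  move: (min_energy _ K) => a; split => [/eqP|->//].
  by rewrite expeR_eq0 => /eqP H; rewrite -[LHS]oppeK H.
have := riesz_min_energy_ge0 K p0; move: (min_energy _ K) => a a0; split => [H|->].
  have : 0 <= a^-1 by rewrite inve_ge0.
  by move=> /poweR_eq0_eq0 /(_ H) /eqP; rewrite inve_eq0 => /eqP.
by rewrite invey poweR0r// invr_eq0.
Qed.

Variables (p m rho : R).
Hypotheses (p0 : (0 <= p)%R) (rho0 : (0 <= rho)%R) (m0 : (0 <= m)%R)
  (adm : admissible p m (n%:R * (2 * rho + 2))).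
Local Notation h := (@nker R n p m : E -> E -> \bar R).

Lemma nker_pkernel (x y : vec) : (`|x| <= rho)%R -> (`|y| <= rho)%R ->
  pkernel p x y = nker p m x y - m%:E.
Proof.
move=> xr yr; rewrite /nker /pkernel /log_kernel /riesz_kernel.
have [d0|d0] := eqVneq (enorm (x - y)) 0%R.
  rewrite addye//; case: eqP => [_|/eqP p00] /=; rewrite d0; first by rewrite inver eqxx.
  by rewrite powR0// inver eqxx.
have dp : (0 < enorm (x - y))%R by rewrite lt_neqAle eq_sym d0 enorm_ge0.
have dD : (enorm (x - y) <= n%:R * (2 * rho + 2))%R.
  apply: (le_trans (enorm_le _)); rewrite ler_wpM2l//.
  by apply: (le_trans (ler_normB _ _)); lra.
rewrite (profileE adm dp dD) -EFinB addrK /raw_profile; case: eqP => [_|/eqP p00].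
  by rewrite inver (negbTE d0) lne_EFin ?invr_gt0// lnV// posrE.
by rewrite inver powRN gt_eqF// powR_gt0.
Qed.

(** Within the box [nker] exceeds the true kernel by the constant [m], so both energies have the
    same minimisers. *)
Lemma kernel_energyE (K : set vec) (tau : probability E R) :
  compact K -> (forall x, K x -> `|x| <= rho)%R -> tau (K : set E) = 1 ->
  kernel_energy (pkernel p) K tau = mutual h tau tau - m%:E.
Proof.
move=> cK Kr tK; have mK : measurable (K : set E) by exact: compact_borel.
rewrite /kernel_energy.
transitivity (\int[tau]_(x in (K : set E)) (potential h tau x - m%:E)).
  apply: eq_integral => x; rewrite inE => Kx.
  transitivity (\int[tau]_(y in (K : set E)) (h x y - m%:E)).
    by apply: eq_integral => y; rewrite inE => Ky; rewrite nker_pkernel ?Kr.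
  apply: integral_subcst => //; first exact: measurable_nker_r.
  by move=> y; exact: nker_ge0.
apply: integral_subcst => //.
- by apply: measurable_potential; [move=> ? ?; exact: nker_ge0|exact: measurable_nker].
- by move=> x; apply: potential_ge0 => ? ?; exact: nker_ge0.
Qed.

Lemma equilibrium_minimizer (K : set vec) (mu : probability E R) :
  compact K -> (forall x, K x -> `|x| <= rho)%R -> equilibrium_measure p K mu ->
  minimizer h (K : set E) mu /\ min_energy (pkernel p) K = mutual h mu mu - m%:E.
Proof.
move=> cK Kr [mK Koo emu].
have eE := kernel_energyE cK Kr.
have muE : min_energy (pkernel p) K = mutual h mu mu - m%:E by rewrite -emu eE.
split=> //; split => //.
  by move: Koo; rewrite muE; case: (mutual h mu mu) => [r _|//|//]; exact: ltry.
move=> Q QK; rewrite -(@leeD2rE _ (- m%:E))//.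
rewrite -[X in X <= _]muE -[X in _ <= X](eE Q QK).
by apply: ereal_inf_lbound; exists Q.
Qed.

Lemma cap_gt0_mutual (K : set vec) (tau : probability E R) :
  compact K -> (forall x, K x -> `|x| <= rho)%R -> tau (K : set E) = 1 ->
  mutual h tau tau < +oo -> cap p K <> 0.
Proof.
move=> cK Kr tK too /cap_eq0 Koo.
have : min_energy (pkernel p) K <= kernel_energy (pkernel p) K tau.
  by apply: ereal_inf_lbound; exists tau.
by rewrite Koo kernel_energyE// leye_eq; move: too; case: (mutual h tau tau).
Qed.

Lemma cap_eq0_mutual (K : set vec) :
  compact K -> (forall x, K x -> `|x| <= rho)%R ->
  (forall tau : probability E R, tau (K : set E) = 1 -> mutual h tau tau = +oo) ->
  cap p K = 0.
Proof.
move=> cK Kr H; apply/cap_eq0/eqP; rewrite -leye_eq; apply: le_ereal_inf_tmp => _ [Q QK <-].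
by rewrite kernel_energyE// H.
Qed.

End capacity_energy.

(** * Potentials of the dilated ball measures and their gaps *)

Section scaled_balls.
Context {R : realType} {n : nat}.
Local Open Scope ereal_scope.
Local Notation E := (borel_rV R n).
Local Notation vec := ('rV[R]_n).
Variables (p m rho : R).
Hypotheses (n0 : (0 < n)%N) (pn : p = (n%:R - 1)%R) (rho1 : (1 <= rho)%R)
  (adm : admissible p m (n%:R * (2 * rho + 2))).
Variable nu1 : probability E R.
Hypothesis Hnu1 : ball_measure p nu1.
Local Notation h := (@nker R n p m : E -> E -> \bar R).
Implicit Types (x y : vec) (s : R).

Let p0 : (0 <= p)%R.
Proof. by rewrite pn subr_ge0 ler1n. Qed.

Let rho0 : (0 < rho)%R.
Proof. exact: lt_le_trans rho1. Qed.

Let D : R := (n%:R * (2 * rho + 2))%R.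

Let rhoD : (2 * rho <= D)%R.
Proof.
apply: (@le_trans _ _ (1 * (2 * rho + 2))%R); first by rewrite mul1r lerDl.
by rewrite ler_wpM2r ?ler1n// addr_ge0// mulr_ge0// ltW.
Qed.

Let mB : measurable (origin_ball 1 : set E).
Proof. by apply: closed_borel; exact: closed_origin_ball. Qed.

Let nu1B : nu1 (origin_ball 1 : set E) = 1.
Proof. by have [] := Hnu1. Qed.

Lemma nker0_scale m' (l : R) x y : (0 < l)%R ->
  nker 0 m' (l *: x) (l *: y) = nker 0 (m' - ln l) x y.
Proof.
move=> l0; rewrite /nker -scalerBr enormZ gtr0_norm// mulf_eq0 gt_eqF//=.
case: eqP => // /eqP d0; congr (_%:E).
have d1 : (0 < enorm (x - y))%R by rewrite lt_neqAle eq_sym d0 enorm_ge0.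
by rewrite /profile /raw_profile eqxx lnM ?posrE//; congr (Num.max _ _); ring.
Qed.

Lemma nkerp_scale q (l : R) x y : (0 < l)%R -> (q != 0)%R ->
  nker q 0 (l *: x) (l *: y) = (l `^ (- q))%:E * nker q 0 x y.
Proof.
move=> l0 q0; have lq : (0 < l `^ (- q))%R by rewrite powR_gt0.
rewrite /nker -scalerBr enormZ gtr0_norm// mulf_eq0 gt_eqF//=.
case: eqP => [_|/eqP d0]; first by rewrite gt0_muley// lte_fin.
rewrite -EFinM /profile /raw_profile (negbTE q0) !addr0 !max_r ?powR_ge0//.
by rewrite powRM ?enorm_ge0// ltW.
Qed.

Lemma adm_cases : (p = 0%R /\ forall t, (0 < t -> t <= D -> 1 <= m - ln t)%R) \/ (p != 0%R /\ m = 0%R).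
Proof. by case: adm => [|[pp ->]]; [left|right; rewrite gt_eqF]. Qed.

(** Potential of the image of [nu1] under dilation by [s]; written over [nu1], it is jointly
    measurable in [s] and [x]. *)
Definition ball_pot s x : \bar R := \int[nu1]_y nker p m x (s *: (y : vec))%R.

Definition ball_u s x : R := fine (ball_pot s x).

Let measurable_scale s : measurable_fun [set: E] (fun y : E => (s *: (y : vec))%R : E).
Proof. by apply: measurable_funZrV => //; exact: measurable_cst. Qed.

Let mh : measurable_fun [set: E * E] (fun z : E * E => h z.1 z.2).
Proof. exact: measurable_nker. Qed.

Let mhs s x : measurable_fun [set: E] (fun y : E => nker p m x (s *: (y : vec))%R).
Proof. exact: (measurableT_comp (measurable_nker_r p m x) (measurable_scale s)). Qed.

Let h0 x y : 0 <= nker p m x y.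
Proof. exact: nker_ge0. Qed.

Lemma exists_scaled s : (0 < s)%R -> exists Q : probability E R,
  Q (origin_ball s : set E) = 1 /\
  forall f : vec -> \bar R, (forall x, 0 <= f x) -> measurable_fun [set: E] (f : E -> \bar R) ->
    \int[Q]_x f x = \int[nu1]_y f (s *: (y : vec))%R.
Proof.
move=> s0; have [Q [QE QI]] := pushforward_probability nu1 (measurable_scale s).
exists Q; split; last by move=> f f0 mf; rewrite QI.
rewrite QE; last by apply: closed_borel; exact: closed_origin_ball.
rewrite -[RHS]nu1B; congr (nu1 _); apply/seteqP; split => y;
  by rewrite /= /origin_ball /= enormZ gtr0_norm// -ler_pdivlMl// mulVf// gt_eqF.
Qed.

(** Dilation by [s] multiplies the Riesz kernel by s^(-p) and lowers the logarithmic constant [m] by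
    [ln s]; s <= rho keeps the lowered constant admissible up to distance 2. *)
Lemma ball_pot_const s : (0 < s)%R -> (s <= rho)%R ->
  exists V : R, forall x, (enorm x <= s)%R -> ball_pot s x = V%:E.
Proof.
move=> s0 sr; have [_ _ H] := Hnu1.
have xE x : x = (s *: (s^-1 *: x))%R by rewrite scalerA mulfV ?scale1r// gt_eqF.
have xs x : (enorm x <= s)%R -> (enorm (s^-1 *: x) <= 1)%R.
  by move=> xs; rewrite enormZ gtr0_norm ?invr_gt0// ler_pdivrMl// mulr1.
have [[p00 Hm]|[pn0 m00]] := adm_cases.
  have adm' : admissible p (m - ln s) 2.
    left; split => // t t0 t2.
    have st : (s * t <= D)%R.
      by apply: le_trans rhoD; rewrite mulrC; apply: ler_pM => //; exact: ltW.
    by have := Hm (s * t)%R (mulr_gt0 s0 t0) st; rewrite lnM ?posrE//; lra.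
  have [V HV] := H _ adm'; exists V => x /xs /HV <-.
  by apply: eq_integral => y _; rewrite p00 [in LHS](xE x) nker0_scale.
have adm' : admissible p 0 2 by right; split => //; rewrite lt_neqAle eq_sym pn0.
have [V HV] := H _ adm'; exists (s `^ (- p) * V)%R => x /xs /HV HVx.
rewrite EFinM -HVx -ge0_integralZl ?lee_fin ?powR_ge0//; last 2 first.
- exact: measurable_nker_r.
- by move=> y _; exact: nker_ge0.
by apply: eq_integral => y _; rewrite m00 [in LHS](xE x) nkerp_scale.
Qed.

Lemma ball_potE s x : (0 < s)%R -> (s <= rho)%R -> (enorm x <= s)%R ->
  ball_pot s x = (ball_u s 0)%:E.
Proof.
move=> s0 sr xs; have [V HV] := ball_pot_const s0 sr.
by rewrite /ball_u !HV ?enorm0// ltW.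
Qed.

Lemma ball_u_const s x : (0 < s)%R -> (s <= rho)%R -> (enorm x <= s)%R ->
  ball_u s x = ball_u s 0.
Proof. by move=> s0 sr xs; rewrite {1}/ball_u ball_potE. Qed.

Let box x : (enorm x <= rho)%R -> (`|x| <= rho)%R.
Proof. exact: le_trans (ler_norm_enorm _). Qed.

Lemma ball_pot_le s x : (0 < s)%R -> (s <= rho)%R -> (enorm x <= rho)%R ->
  ball_pot s x <= (ball_u s 0)%:E /\
  ((s < enorm x)%R -> ball_pot s x < (ball_u s 0)%:E).
Proof.
move=> s0 sr xr; have [Q [QB QI]] := exists_scaled s0.
have potE z : potential h Q z = ball_pot s z.
  by apply: QI; [exact: h0|exact: measurable_nker_r].
have cB : closed (origin_ball s : set vec) by exact: closed_origin_ball.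
have Brho y : (origin_ball s y -> `|y| <= rho)%R by move=> ys; apply: box; exact: le_trans sr.
have V0 : (0 <= ball_u s 0)%R by apply: fine_ge0; apply: integral_ge0.
have Qle z : (`|z| <= rho)%R -> potential h Q z <= (ball_u s 0)%:E.
  move=> zr; apply: (max_principle n0 pn (ltW rho0) adm _ Brho QB V0 _ zr).
    exact: closed_borel.
  by move=> y ys; rewrite potE ball_potE.
split; first by rewrite -potE; apply: Qle; exact: box.
move=> sx; rewrite -potE; apply: (potential_lt n0 pn (ltW rho0) adm cB Brho QB Qle (box xr)).
by rewrite /origin_ball /= => xs; move: sx; rewrite ltNge xs.
Qed.

Lemma ball_pot_fin s x : (0 < s)%R -> (s <= rho)%R -> (enorm x <= rho)%R ->
  ball_pot s x = (ball_u s x)%:E.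
Proof.
move=> s0 sr xr; rewrite fineK// ge0_fin_numE; last exact: integral_ge0.
by apply: (le_lt_trans (ball_pot_le s0 sr xr).1); rewrite ltry.
Qed.

Lemma ball_u_le s x : (0 < s)%R -> (s <= rho)%R -> (enorm x <= rho)%R ->
  (ball_u s x <= ball_u s 0)%R.
Proof.
move=> s0 sr xr; have [+ _] := ball_pot_le s0 sr xr.
by rewrite [X in X <= _](ball_pot_fin s0 sr xr) lee_fin.
Qed.

Lemma ball_u_lt s x : (0 < s)%R -> (s < enorm x)%R -> (enorm x <= rho)%R ->
  (ball_u s x < ball_u s 0)%R.
Proof.
move=> s0 sx xr; have sr : (s <= rho)%R by exact/ltW/(lt_le_trans sx).
have [_ /(_ sx)] := ball_pot_le s0 sr xr.
by rewrite [X in X < _](ball_pot_fin s0 sr xr) lte_fin.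
Qed.

Lemma ball_u_ge0 s x : (0 <= ball_u s x)%R.
Proof. by apply: fine_ge0; exact: integral_ge0. Qed.

Lemma ball_u_radial s x x' : (0 < s)%R -> enorm x = enorm x' -> ball_u s x = ball_u s x'.
Proof.
move=> s0 xx'; have [_ rad _] := Hnu1.
suff E : ball_pot s x = ball_pot s x' by rewrite /ball_u E.
pose phi (t : R) : \bar R := if (s * t)%R == 0%R then +oo else (profile p m (s * t)%R)%:E.
have ms : measurable_fun [set: R] (fun t : R => (s * t)%R : R).
  by apply: measurable_funM => //; exact: measurable_cst.
have mphi : measurable_fun setT phi.
  apply: measurable_fun_ifT => //.
    by apply: measurable_fun_eqr => //; exact: measurable_cst.
  by apply/measurable_EFinP; exact: (measurableT_comp (@measurable_profile R p m) ms).
have phi0 t : 0 <= phi t by rewrite /phi; case: ifP => // _; rewrite lee_fin profile_ge0.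
have main z : ball_pot s z = \int[nu1]_y phi (enorm (s^-1 *: z - (y : vec))).
  apply: eq_integral => y _; rewrite /nker /phi.
  suff -> : enorm (z - s *: (y : vec)) = (s * enorm (s^-1 *: z - (y : vec)))%R by [].
  rewrite (_ : z - _ = s *: (s^-1 *: z - (y : vec)))%R ?enormZ ?gtr0_norm//.
  by rewrite scalerBr scalerA mulfV ?scale1r// gt_eqF.
have ee : enorm (s^-1 *: x) = enorm (s^-1 *: x') by rewrite !enormZ xx'.
rewrite [LHS](main x) [RHS](main x'); exact: (rad phi mphi phi0 _ _ ee).
Qed.

Definition gap s x : R := (s `^ p * (ball_u s 0 - ball_u s x))%R.

Lemma gap_ge0 s x : (0 < s)%R -> (s <= rho)%R -> (enorm x <= rho)%R -> (0 <= gap s x)%R.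
Proof. by move=> *; rewrite mulr_ge0 ?powR_ge0// subr_ge0 ball_u_le. Qed.

Lemma gap_eq0 s x : (0 < s)%R -> (s <= rho)%R -> (enorm x <= s)%R -> gap s x = 0%R.
Proof. by move=> *; rewrite /gap ball_u_const// subrr mulr0. Qed.

Lemma gap_gt0 s x : (0 < s)%R -> (s < enorm x)%R -> (enorm x <= rho)%R -> (0 < gap s x)%R.
Proof. by move=> *; rewrite mulr_gt0 ?powR_gt0// subr_gt0 ball_u_lt. Qed.

Let ball_pot_int s x : ball_pot s x = \int[nu1]_y nker p m x (s *: (y : vec))%R.
Proof. by []. Qed.

Lemma ball_u_scale s : (p != 0)%R -> (0 < s)%R -> (s `^ p * ball_u s 0 = ball_u 1 0)%R.
Proof.
move=> pn0 s0; have m00 : m = 0%R by case: adm_cases => [[p00]|[]//]; rewrite p00 eqxx in pn0.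
have H : ball_pot s 0 = (s `^ (- p))%:E * ball_pot 1 0.
  rewrite !ball_pot_int -ge0_integralZl; [|exact: measurableT|exact: mhs|move=> y _; exact: h0|by rewrite lee_fin powR_ge0].
  apply: eq_integral => y _; rewrite scale1r m00 -[X in nker p 0 X (s *: _)](scaler0 _ s).
  exact: nkerp_scale.
have e1 := ball_potE ltr01 rho1 (_ : enorm (0 : vec) <= 1)%R.
rewrite /ball_u [X in (_ * fine X)%R]H.
rewrite e1 ?enorm0// -EFinM /= mulrA powRN mulfV ?mul1r//.
by rewrite gt_eqF// powR_gt0.
Qed.

(** The potential at the centre grows at most logarithmically as the radius shrinks, which keeps the
    weighted integrals of the gap finite. *)
Lemma ball_u0_le s : p = 0%R -> (0 < s)%R -> (s <= 1)%R -> (ball_u s 0 <= ball_u 1 0 - ln s)%R.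
Proof.
move=> p00 s0 s1; have lns : (0 <= - ln s)%R by rewrite oppr_ge0 ln_le0.
have sr : (s <= rho)%R by exact: le_trans rho1.
have e01 : (enorm (0 : vec) <= 1)%R by rewrite enorm0.
have e0s : (enorm (0 : vec) <= s)%R by rewrite enorm0 ltW.
have e1 := ball_potE ltr01 rho1 e01; have e2 := ball_potE s0 sr e0s.
have lc : \int[nu1]_y (- ln s)%:E = (- ln s)%:E.
  by rewrite integral_cst// -[RHS]mule1; congr (_ * _); exact: probability_setT.
have mc : measurable_fun [set: E] (fun _ : E => (- ln s)%:E) by exact: measurable_cst.
suff H : ball_pot s 0 <= ball_pot 1 0 + (- ln s)%:E.
  by move: H; rewrite [X in X <= _]e2 [X in _ <= X + _]e1 -EFinD lee_fin.
rewrite !ball_pot_int -[X in _ + X]lc -ge0_integralD; [|exact: measurableT|move=> y _; exact: h0|exact: mhs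
  |by move=> y _; rewrite lee_fin|exact: mc].
apply: ge0_le_integral; [exact: measurableT|move=> y _; exact: h0|exact: mhs
  |by apply: emeasurable_funD; [exact: mhs|exact: mc]|move=> y _].
rewrite scale1r p00 -[X in nker 0 m X (s *: _)](scaler0 _ s) nker0_scale// /nker.
case: eqP => [_|_]; first by rewrite leey.
rewrite -EFinD lee_fin /profile /raw_profile eqxx ge_max; apply/andP; split.
  by rewrite addr_ge0// le_max lexx.
have h1 : (- ln (enorm (0 - (y : vec))) + m <= Num.max 0 (- ln (enorm (0 - (y : vec))) + m))%R.
  by rewrite le_max lexx orbT.
move: h1; set a := Num.max _ _; lra.
Qed.

Opaque ball_pot ball_u.

(** For l >= 1 the constant [ln l] is nonnegative, so it can be added to the kernel inside integrals
    of nonnegative functions. Dilations with l < 1 are treated by their inverse in [gap_scale]. *)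
Let gap_scale1 (l : R) s x : (1 <= l)%R -> (0 < s)%R -> (l * s <= rho)%R ->
  (enorm (l *: x) <= rho)%R -> gap (l * s)%R (l *: x) = gap s x.
Proof.
move=> l1 s0 lsr lxr; have l0 : (0 < l)%R by exact: lt_le_trans l1.
have ls0 : (0 < l * s)%R by rewrite mulr_gt0.
have sr : (s <= rho)%R by apply: le_trans lsr; rewrite ler_peMl// ltW.
have lxE : enorm (l *: x) = (l * enorm x)%R by rewrite enormZ gtr0_norm.
have xr : (enorm x <= rho)%R.
  by apply: le_trans lxr; rewrite lxE ler_peMl ?enorm_ge0.
have [[p00 Hm]|[pn0 m00]] := adm_cases.
  have H z : (enorm (l *: z) <= rho)%R -> (enorm z <= rho)%R ->
      ball_u s z = (ball_u (l * s) (l *: z) + ln l)%R.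
    move=> lzr zr; have e1 := ball_pot_fin s0 sr zr; have e2 := ball_pot_fin ls0 lsr lzr.
    suff H : ball_pot s z = ball_pot (l * s) (l *: z) + (ln l)%:E.
      by move: H; rewrite [X in X = _]e1 [X in _ = X + _]e2 -EFinD => -[].
    have lnl : 0 <= (ln l)%:E by rewrite lee_fin ln_ge0.
    have lc : \int[nu1]_y (ln l)%:E = (ln l)%:E.
      by rewrite integral_cst// -[RHS]mule1; congr (_ * _); exact: probability_setT.
    have mc : measurable_fun [set: E] (fun _ : E => (ln l)%:E) by exact: measurable_cst.
    rewrite !ball_pot_int.
    transitivity (\int[nu1]_(y in (origin_ball 1 : set E)) nker p m z (s *: (y : vec))%R).
      by apply/esym; apply: integral_probability1; [exact: mB|exact: nu1B|exact: mhs|move=> y; exact: h0].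
    transitivity (\int[nu1]_(y in (origin_ball 1 : set E)) (nker p m (l *: z) ((l * s) *: (y : vec))%R + (ln l)%:E)); last first.
      transitivity (\int[nu1]_y (nker p m (l *: z) ((l * s) *: (y : vec))%R + (ln l)%:E)).
        apply: integral_probability1; [exact: mB|exact: nu1B| |].
          by apply: emeasurable_funD; [exact: mhs|exact: mc].
        by move=> y; exact: adde_ge0 (h0 _ _) lnl.
      rewrite ge0_integralD; [|exact: measurableT|move=> y _; exact: h0|exact: mhs|move=> y _; exact: lnl|exact: mc].
      by rewrite lc.
    apply: eq_integral => y; rewrite inE => y1.
    rewrite -scalerA p00 nker0_scale// /nker; case: eqP => // /eqP d0.
    have d1 : (0 < enorm (z - s *: (y : vec)))%R by rewrite lt_neqAle eq_sym d0 enorm_ge0.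
    have yr (c : R) : (0 < c)%R -> (c <= rho)%R -> (enorm (c *: (y : vec)) <= rho)%R.
      move=> c0 cr; rewrite enormZ gtr0_norm//; apply: le_trans cr.
      by rewrite ler_piMr// ltW.
    have dD : (enorm (z - s *: (y : vec)) <= D)%R.
      apply: le_trans rhoD; apply: le_trans (ler_enormD _ _) _.
      by rewrite enormN; have := yr s s0 sr; lra.
    have ldD : (l * enorm (z - s *: (y : vec)) <= D)%R.
      apply: le_trans rhoD.
      rewrite -[X in (X * _)%R](gtr0_norm l0) -enormZ scalerBr scalerA.
      apply: le_trans (ler_enormD _ _) _.
      by rewrite enormN; have := yr _ ls0 lsr; lra.
    rewrite -EFinD; congr EFin; rewrite /profile /raw_profile eqxx.
    have h1 := Hm _ d1 dD.
    have := Hm _ (mulr_gt0 l0 d1) ldD; rewrite lnM ?posrE// => h2.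
    rewrite !max_r//; lra.
  have r00 : (enorm (0%R : vec) <= rho)%R by rewrite enorm0 ltW.
  have l00 : (enorm (l *: (0%R : vec)) <= rho)%R by rewrite scaler0.
  have e1 := H x lxr xr; have e2 := H 0%R l00 r00; rewrite scaler0 in e2.
  have powp (c : R) : (c `^ p = 1)%R by rewrite p00 powRr0.
  rewrite /gap.
  rewrite (powp s).
  rewrite (powp (l * s)%R).
  rewrite [X in X = _]mul1r.
  rewrite [X in _ = X]mul1r.
  rewrite [X in _ = (X - _)%R]e2.
  rewrite [X in _ = (_ - X)%R]e1.
  have key (a b c : R) : (a - b = (a + c) - (b + c))%R by ring.
  exact: key.
have H z : (enorm (l *: z) <= rho)%R -> (enorm z <= rho)%R ->
    ball_u (l * s) (l *: z) = (l `^ (- p) * ball_u s z)%R.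
  move=> lzr zr; have e1 := ball_pot_fin s0 sr zr; have e2 := ball_pot_fin ls0 lsr lzr.
  suff H : ball_pot (l * s) (l *: z) = (l `^ (- p))%:E * ball_pot s z.
    by move: H; rewrite [X in X = _]e2 [X in _ = _ * X]e1 -EFinM => -[].
  rewrite !ball_pot_int -ge0_integralZl; [|exact: measurableT|exact: mhs|move=> y _; exact: h0|by rewrite lee_fin powR_ge0].
  by apply: eq_integral => y _; rewrite m00 -scalerA nkerp_scale.
have r00 : (enorm (0%R : vec) <= rho)%R by rewrite enorm0 ltW.
have l00 : (enorm (l *: (0%R : vec)) <= rho)%R by rewrite scaler0.
have e1 := H x lxr xr; have e2 := H 0%R l00 r00; rewrite scaler0 in e2.
have lp : (l `^ p != 0)%R by rewrite gt_eqF// powR_gt0.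
have key (a b c : R) : (l `^ p * c * (l `^ (- p) * a - l `^ (- p) * b) = c * (a - b))%R.
  by rewrite powRN; field.
rewrite /gap [X in (_ * (X - _))%R]e2 [X in (_ * (_ - X))%R]e1.
rewrite powRM; [|exact: ltW|exact: ltW].
exact: key.
Qed.

Lemma gap_scale (l : R) s x : (0 < l)%R -> (0 < s)%R -> (s <= rho)%R -> (l * s <= rho)%R ->
  (enorm x <= rho)%R -> (enorm (l *: x) <= rho)%R -> gap (l * s)%R (l *: x) = gap s x.
Proof.
move=> l0 s0 sr lsr xr lxr; have [l1|l1] := leP 1%R l; first exact: gap_scale1.
have lV : (1 <= l^-1)%R by rewrite invf_ge1// ltW.
have lN : l != 0%R by rewrite gt_eqF.
have e1 : (l^-1 * (l * s) = s)%R by rewrite mulKf.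
have e2 : (l^-1 *: (l *: x) = x)%R by rewrite scalerA mulVf// scale1r.
have := @gap_scale1 l^-1 (l * s)%R (l *: x) lV (mulr_gt0 l0 s0).
by rewrite e1 e2 => /(_ sr xr) H; exact: esym H.
Qed.

Transparent ball_pot ball_u.

Lemma exists_scaled_potential s : (0 < s)%R -> exists Q : probability E R,
  Q (origin_ball s : set E) = 1 /\ forall x, potential h Q x = ball_pot s x.
Proof.
move=> s0; have [Q [QB QI]] := exists_scaled s0; exists Q; split => // x.
by apply: QI; [exact: h0|exact: measurable_nker_r].
Qed.

Lemma measurable_ball_u : measurable_fun [set: E * R] (fun z : E * R => ball_u z.2 (z.1 : vec)).
Proof.
have m1 : measurable_fun [set: (E * R) * E] (fun z : (E * R) * E => z.1.1 : E).
  by apply: (measurableT_comp (@measurable_fst _ _ E R)); exact: measurable_fst.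
have m2 : measurable_fun [set: (E * R) * E] (fun z : (E * R) * E => (z.1.2 *: (z.2 : vec))%R : E).
  apply: measurable_funZrV => //.
  by apply: (measurableT_comp (@measurable_snd _ _ E R)); exact: measurable_fst.
have mm : measurable_fun [set: (E * R) * E] (fun z : (E * R) * E => h z.1.1 (z.1.2 *: (z.2 : vec))%R).
  exact: (measurableT_comp mh (measurable_fun_pair m1 m2)).
have := measurable_fun_fubini_tonelli_F (m2 := nu1) (fun z : (E * R) * E => h z.1.1 (z.1.2 *: (z.2 : vec))%R) mm.
move=> /(_ (fun _ => h0 _ _)) mF.
exact: (measurableT_comp (@fine_measurable R setT measurableT) mF).
Qed.

End scaled_balls.

Global Opaque ball_pot ball_u.

(** * Moments as integrals of averaged gaps *)

Section layer_cake.
Context {R : realType} {n : nat}.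
Local Open Scope ereal_scope.
Local Notation E := (borel_rV R n).
Local Notation vec := ('rV[R]_n).
Local Notation leb := (@lebesgue_measure R).
Variables (rho : R) (G : R -> vec -> R) (e : vec).
Hypotheses (rho1 : (1 <= rho)%R) (e1 : enorm e = 1%R).
Hypothesis Gz : forall (s : R) (x : vec), (0 < s)%R -> (s <= rho)%R -> (enorm x <= s)%R -> G s x = 0%R.
Hypothesis Gp : forall (s : R) (x : vec), (0 < s)%R -> (s < enorm x)%R -> (enorm x <= rho)%R -> (0 < G s x)%R.
Hypothesis Gscale : forall (l s : R) (x : vec), (0 < l)%R -> (0 < s)%R -> (s <= rho)%R -> (l * s <= rho)%R ->
  (enorm x <= rho)%R -> (enorm (l *: x) <= rho)%R -> G (l * s)%R (l *: x) = G s x.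
Hypothesis Gradial : forall (s : R) (x x' : vec), (0 < s)%R -> enorm x = enorm x' -> G s x = G s x'.
Hypothesis mG : measurable_fun [set: E * R] (fun z : E * R => G z.2 (z.1 : vec)).
Implicit Types (q s t u : R) (x : vec) (sigma tau : probability E R).

Definition weight q s : R := (if (0 < s <= rho) then s `^ (q - 1) else 0)%R.

(** The sign of [G] is known only for radii and points within [rho]; the clamp makes Tonelli
    applicable to all arguments. *)
Definition gapp s x : R := Num.max 0%R (G s x).

Definition layer q x : \bar R := \int[leb]_s (weight q s * gapp s x)%:E.

Definition average (tau : probability E R) s : \bar R := \int[tau]_x (gapp s (x : vec))%:E.

Definition moment (tau : probability E R) q : \bar R := \int[tau]_x (enorm (x : vec) `^ q)%:E.

Let rho0 : (0 < rho)%R.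
Proof. exact: lt_le_trans rho1. Qed.

Let weight_ge0 q s : (0 <= weight q s)%R.
Proof. by rewrite /weight; case: ifP => // _; exact: powR_ge0. Qed.

Let gapp_ge0 s x : (0 <= gapp s x)%R.
Proof. by rewrite /gapp le_max lexx. Qed.

Let wg_ge0 q s x : 0 <= (weight q s * gapp s x)%:E.
Proof. by rewrite lee_fin mulr_ge0. Qed.

Let gapp_small s x : (0 < s)%R -> (s <= rho)%R -> (enorm x <= s)%R -> gapp s x = 0%R.
Proof. by move=> s0 sr xs; rewrite /gapp Gz// maxxx. Qed.

Let gapp_pos s x : (0 < s)%R -> (s < enorm x)%R -> (enorm x <= rho)%R -> (0 < gapp s x)%R.
Proof. by move=> s0 sx xr; rewrite /gapp lt_max Gp// orbT. Qed.

Let measurable_weight q : measurable_fun [set: R] (weight q).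
Proof.
rewrite /weight; apply: measurable_fun_ifT.
- apply: measurable_and.
    by apply: measurable_fun_ltr => //; exact: measurable_cst.
  by apply: measurable_fun_ler => //; exact: measurable_cst.
- exact: measurable_powR.
- exact: measurable_cst.
Qed.

Let measurable_gapp : measurable_fun [set: E * R] (fun z : E * R => gapp z.2 (z.1 : vec)).
Proof. by apply: measurable_maxr => //; exact: measurable_cst. Qed.

Let measurable_gapp_l x : measurable_fun [set: R] (fun s : R => gapp s x).
Proof.
have mz : measurable_fun [set: R] (fun s : R => (x, s) : E * R) by exact: measurable_fun_pair.
exact: (measurableT_comp measurable_gapp mz).
Qed.

Let measurable_gapp_r s : measurable_fun [set: E] (fun x : E => gapp s (x : vec)).
Proof.
have mz : measurable_fun [set: E] (fun x : E => (x, s) : E * R) by exact: measurable_fun_pair.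
exact: (measurableT_comp measurable_gapp mz).
Qed.

Let measurable_wg q : measurable_fun [set: E * R] (fun z : E * R => (weight q z.2 * gapp z.2 (z.1 : vec))%:E).
Proof.
apply/measurable_EFinP; apply: measurable_funM; last exact: measurable_gapp.
exact: (measurableT_comp (measurable_weight q) (@measurable_snd _ _ E R)).
Qed.

Let measurable_wg_l q x : measurable_fun [set: R] (fun s : R => (weight q s * gapp s x)%:E).
Proof.
apply/measurable_EFinP; apply: measurable_funM; last exact: measurable_gapp_l.
exact: measurable_weight.
Qed.

(** Substitute s = |x| u and use homogeneity. The cut at [rho] in the weight does no harm, since the
    gap vanishes for s >= |x|, that is u >= 1. *)
Lemma layerE q x : (0 < q)%R -> (enorm x <= rho)%R ->
  layer q x = (enorm x `^ q)%:E * layer q e.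
Proof.
move=> q0 xr; have [x0|x0] := eqVneq (enorm x) 0%R.
  rewrite x0 powR0 ?gt_eqF// mul0e /layer integral0_eq// => s _.
  rewrite /weight; case: ifP => [/andP[s0 sr]|_]; last by rewrite mul0r.
  by rewrite gapp_small ?mulr0// x0 ltW.
set t := enorm x in x0 xr *.
have t0 : (0 < t)%R by rewrite lt_neqAle eq_sym x0 enorm_ge0.
have er : (enorm e <= rho)%R by rewrite e1.
have te : enorm (t *: e) = t by rewrite enormZ e1 mulr1 gtr0_norm.
have key u : ((weight q (t * u + 0) * gapp (t * u + 0) x) = t `^ (q - 1) * (weight q u * gapp u e))%R.
  rewrite addr0 /weight pmulr_rgt0//.
  have [u0|u0] /= := ltP 0%R u; last by rewrite !mul0r mulr0.
  have [u1|u1] := leP 1%R u.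
    transitivity (0%R : R).
      case: ifP => [tur|_]; last by rewrite mul0r.
      by rewrite gapp_small ?mulr0 ?mulr_gt0// -/t ler_peMr// ltW.
    case: ifP => [ur|_]; last by rewrite mul0r mulr0.
    by rewrite gapp_small ?mulr0// e1.
  have ur : (u <= rho)%R by apply: le_trans rho1; exact: ltW.
  have tur : (t * u <= rho)%R by apply: le_trans xr; rewrite ler_piMr// ltW.
  rewrite ur tur powRM ?ltW// -mulrA; congr (_ * (_ * _))%R.
  rewrite /gapp; congr (Num.max _ _).
  have tu0 : (0 < t * u)%R by rewrite mulr_gt0.
  have ex : enorm x = enorm (t *: e) by rewrite te.
  by rewrite (Gradial tu0 ex) Gscale// te.
have := @ge0_integral_affine R (fun s => (weight q s * gapp s x)%:E) t 0%R x0 (measurable_wg_l q x) (fun s => wg_ge0 q s x).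
under eq_integral do rewrite key EFinM.
rewrite ge0_integralZl; [|exact: measurableT|exact: measurable_wg_l|by move=> u _; exact: wg_ge0|by rewrite lee_fin powR_ge0].
rewrite -/(layer q e) -/(layer q x) gtr0_norm// => H.
have -> : layer q x = t%:E * (t^-1%:E * layer q x).
  by rewrite muleA -EFinM mulfV// mul1e.
rewrite -H muleA -EFinM; congr (_%:E * _).
rewrite -[X in (X * _)%R](powRr1 (ltW t0)) -powRD; last by rewrite x0 implybT.
by rewrite addrC subrK.
Qed.

Lemma layer_gt0 q : 0 < layer q e.
Proof.
apply: (@lt_le_trans _ _ (\int[leb]_(s in `]0%R, 1%R[) (weight q s * gapp s e)%:E)).
  have l01 : 0 < leb `]0%R, 1%R[ by rewrite lebesgue_measure_itv/= lte_fin ltr01 -EFinB subr0.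
  apply: integral_gt0 => //; first exact: (measurable_funTS (measurable_wg_l q e)).
  move=> s; rewrite /= in_itv/= => /andP[s0 s1].
  have sr : (s <= rho)%R by apply: le_trans rho1; exact: ltW.
  by rewrite lte_fin mulr_gt0 ?gapp_pos ?e1// /weight s0 sr powR_gt0.
by apply: ge0_subset_integral => //; exact: measurable_wg_l.
Qed.

Lemma layer_le q a (C : R) : (0 < q - a)%R -> (0 <= C)%R ->
  (forall u, (0 < u)%R -> (u < 1)%R -> (G u e <= C * u `^ (- a))%R) ->
  layer q e <= (C * (q - a)^-1)%:E.
Proof.
move=> qa C0 H.
have pw0 u : 0 <= (C * u `^ (q - a - 1))%:E by rewrite lee_fin mulr_ge0 ?powR_ge0.
have mp : measurable_fun [set: R] (fun u : R => (u `^ (q - a - 1))%:E : \bar R).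
  by apply/measurable_EFinP; exact: measurable_powR.
apply: (@le_trans _ _ (\int[leb]_(u in `]0%R, 1%R]) (C%:E * (u `^ (q - a - 1))%:E))); last first.
  rewrite ge0_integralZl//; last 2 first.
  - exact: measurable_funTS.
  - by move=> u _; rewrite lee_fin powR_ge0.
  by rewrite EFinM lee_wpmul2l// integral_powR01.
rewrite [leRHS]integral_mkcond; apply: ge0_le_integral.
- exact: measurableT.
- by move=> u _; exact: wg_ge0.
- exact: measurable_wg_l.
- apply/(measurable_restrictT _ _).1 => //; apply: measurable_funTS.
  by apply: emeasurable_funM => //; exact: measurable_cst.
move=> u _; rewrite patchE; case: ifPn => [|uN].
  rewrite inE /= in_itv/= => /andP[u0 u1].
  have ur : (u <= rho)%R by exact: le_trans rho1.
  rewrite -EFinM lee_fin /weight u0 ur /=.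
  have [u1'|u1'] := eqVneq u 1%R.
    by rewrite gapp_small ?mulr0 ?mulr_ge0 ?powR_ge0// e1 u1'.
  have ult : (u < 1)%R by rewrite lt_neqAle u1'.
  rewrite mulrC (_ : q - a - 1 = (- a) + (q - 1))%R; last by ring.
  rewrite [X in (_ <= _ * X)%R]powRD; last by apply/implyP => _; rewrite gt_eqF.
  rewrite mulrA; apply: ler_wpM2r; first exact: powR_ge0.
  by rewrite /gapp ge_max H// andbT mulr_ge0 ?powR_ge0.
rewrite lee_fin /weight; case: ifPn => [/andP[u0 ur]|_]; last by rewrite mul0r.
rewrite gapp_small ?mulr0// e1; move: uN; rewrite notin_setE /= in_itv/= u0/= => /negP.
by rewrite -ltNge => /ltW.
Qed.

Lemma average_ge0 tau s : 0 <= average tau s.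
Proof. by apply: integral_ge0 => x _; rewrite lee_fin. Qed.

Let measurable_average tau : measurable_fun [set: R] (average tau).
Proof.
have mH : measurable_fun [set: E * R] (fun z : E * R => (gapp z.2 (z.1 : vec))%:E).
  by apply/measurable_EFinP; exact: measurable_gapp.
have h0 (z : E * R) : 0 <= (gapp z.2 (z.1 : vec))%:E by rewrite lee_fin.
exact: (measurable_fun_fubini_tonelli_G (m1 := tau) (fun z : E * R => (gapp z.2 (z.1 : vec))%:E) mH h0).
Qed.

Let mball : measurable (origin_ball rho : set E).
Proof. by apply: closed_borel; exact: closed_origin_ball. Qed.

Let measurable_moment q : measurable_fun [set: E] (fun x : E => (enorm (x : vec) `^ q)%:E : \bar R).
Proof.
apply/measurable_EFinP.
exact: (measurableT_comp (measurable_powR q) (@measurable_enorm R n)).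
Qed.

Let moment_fun_ge0 q x : 0 <= (enorm x `^ q)%:E.
Proof. by rewrite lee_fin powR_ge0. Qed.

Lemma moment_ge0 tau q : 0 <= moment tau q.
Proof. by apply: integral_ge0 => x _; exact: moment_fun_ge0. Qed.

Lemma moment_fin tau q : (0 < q)%R -> tau (origin_ball rho : set E) = 1 ->
  moment tau q \is a fin_num.
Proof.
move=> q0 tB; rewrite ge0_fin_numE; last exact: moment_ge0.
apply: (@le_lt_trans _ _ (\int[tau]_x (rho `^ q)%:E)).
  apply: (le_integral_full mball tB); [exact: measurable_moment|by move=> x; exact: moment_fun_ge0
    |exact: measurable_cst|by move=> x; rewrite lee_fin powR_ge0|].
  move=> x xr; rewrite lee_fin; apply: ge0_ler_powR; rewrite ?nnegrE ?enorm_ge0 ?(ltW q0) ?(ltW rho0)//.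
rewrite integral_cst//; apply: (@le_lt_trans _ _ ((rho `^ q)%:E * 1)); last by rewrite mule1 ltry.
by rewrite le_eqVlt; apply/orP; left; apply/eqP; congr (_ * _); exact: probability_setT.
Qed.

(** Tonelli applied to [layerE]: comparison of moments reduces to comparison of averaged gaps radius
    by radius. *)
Lemma moment_layer tau q : (0 < q)%R -> tau (origin_ball rho : set E) = 1 ->
  layer q e \is a fin_num ->
  moment tau q * layer q e = \int[leb]_s ((weight q s)%:E * average tau s).
Proof.
move=> q0 tB Nf.
have N0 : 0 <= layer q e by apply: integral_ge0 => s _; exact: wg_ge0.
have ml : measurable_fun [set: E] (fun x : E => layer q (x : vec)).
  exact: (measurable_fun_fubini_tonelli_F (m2 := leb) (fun z : E * R => (weight q z.2 * gapp z.2 (z.1 : vec))%:E) (measurable_wg q) (fun z => wg_ge0 _ _ _)).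
transitivity (\int[tau]_x layer q (x : vec)).
  transitivity (\int[tau]_(x in (origin_ball rho : set E)) layer q (x : vec)); last first.
    by apply: integral_probability1 => // x; apply: integral_ge0 => s _; exact: wg_ge0.
  transitivity (\int[tau]_(x in (origin_ball rho : set E)) ((enorm (x : vec) `^ q)%:E * (fine (layer q e))%:E)); last first.
    by apply: eq_integral => x; rewrite inE => xr; rewrite (fineK Nf) (layerE q0 xr).
  rewrite ge0_integralZr//.
  - rewrite fineK//; congr (_ * _); apply/esym; exact: integral_probability1.
  - exact: measurable_funTS.
  - by rewrite lee_fin fine_ge0.
rewrite /layer.
have := @fubini_tonelli _ _ E (measurableTypeR R) R tau leb (fun z : E * R => (weight q z.2 * gapp z.2 (z.1 : vec))%:E) (measurable_wg q) (fun z => wg_ge0 _ _ _).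
move=> ->; apply: eq_integral => s _ /=.
under eq_integral do rewrite EFinM.
rewrite ge0_integralZl; [by []|exact: measurableT|apply/measurable_EFinP; exact: measurable_gapp_r
  |by move=> x _; rewrite lee_fin|by rewrite lee_fin].
Qed.

(** On an interval of radii where the averages of [sigma] vanish, the whole contribution of [tau] is
    gained; [c] bounds the weight there from below. *)
Lemma moment_lt_layer sigma tau q (r r' c : R) : (0 < q)%R ->
  sigma (origin_ball rho : set E) = 1 -> tau (origin_ball rho : set E) = 1 ->
  layer q e \is a fin_num ->
  (forall s, (0 < s)%R -> (s <= rho)%R -> average sigma s <= average tau s) ->
  (0 <= c)%R ->
  (forall s, (r < s)%R -> (s < r')%R -> (c <= weight q s)%R /\ average sigma s = 0) ->
  moment sigma q * layer q e + c%:E * \int[leb]_(s in `]r, r'[) average tau s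
    <= moment tau q * layer q e.
Proof.
move=> q0 sB tB Nf st c0 H.
rewrite !moment_layer// -ge0_integralZl; [|exact: measurable_itv|exact: (measurable_funTS (measurable_average tau))|by move=> s _; exact: average_ge0|by rewrite lee_fin].
have mw tau' : measurable_fun [set: R] (fun s => (weight q s)%:E * average tau' s).
  by apply: emeasurable_funM => //; apply/measurable_EFinP; exact: measurable_weight.
have wa0 tau' s : 0 <= (weight q s)%:E * average tau' s.
  by rewrite mule_ge0 ?average_ge0// lee_fin.
have mc : measurable_fun [set: R] ((fun s => c%:E * average tau s) \_ `]r, r'[).
  apply/(measurable_restrictT _ _).1 => //; apply: measurable_funTS.
  by apply: emeasurable_funM => //; exact: measurable_cst.
have c0' s : 0 <= ((fun s => c%:E * average tau s) \_ `]r, r'[) s.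
  by rewrite patchE; case: ifP => // _; rewrite mule_ge0 ?average_ge0// lee_fin.
rewrite [X in _ + X]integral_mkcond -ge0_integralD; [|exact: measurableT
  |by move=> s _; exact: wa0|exact: mw|by move=> s _; exact: c0'|exact: mc].
apply: ge0_le_integral; [exact: measurableT|by move=> s _; rewrite adde_ge0
  |by apply: emeasurable_funD; [exact: mw|exact: mc]|exact: mw|].
move=> s _; rewrite patchE; case: ifPn => [|_].
  rewrite inE /= in_itv/= => /andP[rs sr']; have [cw ->] := H s rs sr'.
  by rewrite mule0 add0e lee_wpmul2r ?average_ge0// lee_fin.
rewrite adde0 /weight; case: ifPn => [/andP[s0 sr]|_]; last by rewrite !mul0e.
by rewrite lee_wpmul2l ?lee_fin ?powR_ge0// st.
Qed.

Lemma moment_le sigma tau q : (0 < q)%R ->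
  sigma (origin_ball rho : set E) = 1 -> tau (origin_ball rho : set E) = 1 ->
  layer q e \is a fin_num ->
  (forall s, (0 < s)%R -> (s <= rho)%R -> average sigma s <= average tau s) ->
  moment sigma q <= moment tau q.
Proof.
move=> q0 sB tB Nf st.
have := @moment_lt_layer sigma tau q 0%R 0%R 0%R q0 sB tB Nf st (lexx _).
rewrite mul0e adde0 lee_pmul2r//; last exact: layer_gt0.
by apply => s s0 s0'; have := lt_trans s0 s0'; rewrite ltxx.
Qed.

Lemma average_integral_gt0 tau (r r' : R) : (0 <= r)%R -> (r < r')%R ->
  tau (origin_ball rho : set E) = 1 -> 0 < tau ([set x | (r' <= enorm (x : vec))%R] : set E) ->
  0 < \int[leb]_(s in `]r, r'[) average tau s.
Proof.
move=> r0 rr' tB tr'.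
have lr : 0 < leb `]r, r'[ by rewrite lebesgue_measure_itv/= lte_fin rr' -EFinB lte_fin subr_gt0.
have mr' : measurable ([set x | (r' <= enorm (x : vec))%R] : set E).
  rewrite (_ : mkset _ = (@enorm R n : E -> R) @^-1` `[r', +oo[); last first.
    by apply/seteqP; split => x /=; rewrite in_itv/= andbT.
  by rewrite -[X in measurable X]setTI; apply: measurable_enorm => //.
apply: integral_gt0 => //; first exact: (measurable_funTS (measurable_average tau)).
move=> s; rewrite /= in_itv/= => /andP[rs sr'].
have s0 : (0 < s)%R by exact: le_lt_trans rs.
pose S := (origin_ball rho : set E) `&` [set x | (r' <= enorm (x : vec))%R].
have mS : measurable S by exact: measurableI.
have mg : measurable_fun [set: E] (fun x : E => (gapp s (x : vec))%:E).
  by apply/measurable_EFinP; exact: measurable_gapp_r.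
apply: (@lt_le_trans _ _ (\int[tau]_(x in S) (gapp s (x : vec))%:E)); last first.
  by apply: ge0_subset_integral => // x _; rewrite lee_fin.
apply: integral_gt0 => //.
- exact: measurable_funTS.
- by move=> x [xr xr']; rewrite lte_fin gapp_pos//; exact: lt_le_trans xr'.
- apply: (lt_le_trans tr'); rewrite le_eqVlt; apply/orP; left; apply/eqP.
  by apply/esym; exact: probability_setI1.
Qed.

End layer_cake.

(** * Convergence of (t^a - 1) / a to log t *)

Section difference_quotient.
Context {R : realType}.
Implicit Types (a b t : R).

Let powE a t : 0 < t -> t `^ a = expR (a * ln t).
Proof. by move=> t0; rewrite /powR gt_eqF. Qed.

Lemma powR_quotient_le a b t : 0 < t -> 0 < a -> a <= b ->
  (t `^ a - 1) / a <= (t `^ b - 1) / b.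
Proof.
move=> t0 a0 ab; have b0 : 0 < b by exact: lt_le_trans ab.
rewrite ler_pdivrMr// mulrAC ler_pdivlMr// !powE//.
set L := ln t; set z := expR (a * L).
have z0 : 0 < z by exact: expR_gt0.
have h1 : z * (1 + (b - a) * L) <= expR (b * L).
  have -> : b * L = a * L + (b - a) * L by ring.
  by rewrite expRD ler_pM2l// expR_ge1Dx.
have h2 : z * (1 - a * L) <= 1.
  have E : z * expR (- (a * L)) = 1 by rewrite /z -expRD subrr expR0.
  by rewrite -[leRHS]E ler_pM2l// expR_ge1Dx.
have h3 := ler_wpM2l (ltW a0) h1.
have ba0 : 0 <= b - a by rewrite subr_ge0.
have h4 := ler_wpM2l ba0 h2.
rewrite -subr_ge0 in h3; rewrite -subr_ge0 in h4.
rewrite -subr_ge0; move: (expR (b * L)) h3 h4 => w h3 h4.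
have -> : (w - 1) * a - (z - 1) * b =
  (a * w - a * (z * (1 + (b - a) * L))) + ((b - a) * 1 - (b - a) * (z * (1 - a * L))) by ring.
exact: addr_ge0.
Qed.

Lemma ln_le_powR_quotient a t : 0 < t -> 0 < a -> ln t <= (t `^ a - 1) / a.
Proof.
move=> t0 a0; rewrite ler_pdivlMr// lerBrDr powE// addrC mulrC.
exact: expR_ge1Dx.
Qed.

Lemma powR_quotient_le_ln a t : 0 < t -> 0 < a -> a <= 1 ->
  (t `^ a - 1) / a <= ln t + a * (ln t ^+ 2 * (1 + t)).
Proof.
move=> t0 a0 a1; rewrite ler_pdivrMr//.
set L := ln t.
have z0 : 0 < t `^ a by exact: powR_gt0.
have zt : t `^ a <= 1 + t.
  have [t1|t1] := leP t 1.
    apply: (@le_trans _ _ 1); last by rewrite lerDl ltW.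
    have -> : (1 : R) = 1 `^ a by rewrite powR1.
    by apply: ge0_ler_powR; rewrite ?nnegrE ?(ltW a0) ?(ltW t0).
  apply: (@le_trans _ _ t); last by rewrite lerDr.
  by rewrite -[leRHS](powRr1 (ltW t0)); apply: ler_powR => //; exact: ltW.
have h2 : t `^ a * (1 - a * L) <= 1.
  have E : t `^ a * expR (- (a * L)) = 1 by rewrite powE// -expRD subrr expR0.
  by rewrite -[leRHS]E ler_pM2l// expR_ge1Dx.
have h1 : 1 + a * L <= t `^ a by rewrite powE// expR_ge1Dx.
have L2 : 0 <= a ^+ 2 * L ^+ 2 by rewrite mulr_ge0 ?sqr_ge0.
have h3 := ler_wpM2l L2 zt.
move: (t `^ a) z0 zt h1 h2 h3 => z z0 zt h1 h2 h3.
have [L0|L0] := leP 0 L.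
  have aL0 : 0 <= a * L by rewrite mulr_ge0// ltW.
  have h4 : a * L * (z - 1) <= a * L * (a * L * z) by apply: ler_wpM2l => //; lra.
  have -> : (L + a * (L ^+ 2 * (1 + t))) * a = a * L + a ^+ 2 * L ^+ 2 * (1 + t) by ring.
  have E1 : a * L * (a * L * z) = a ^+ 2 * L ^+ 2 * z by ring.
  rewrite E1 in h4.
  lra.
have aL0 : 0 <= - (a * L) by rewrite -mulrN mulr_ge0 ?oppr_ge0 ?(ltW a0) ?(ltW L0).
have h4 : - (a * L) * (1 - z) <= - (a * L) * (- (a * L)) by apply: ler_wpM2l => //; lra.
have t1 : 0 <= a ^+ 2 * L ^+ 2 * t by rewrite mulr_ge0// ltW.
have -> : (L + a * (L ^+ 2 * (1 + t))) * a = a * L + a ^+ 2 * L ^+ 2 + a ^+ 2 * L ^+ 2 * t by ring.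
have E1 : - (a * L) * (- (a * L)) = a ^+ 2 * L ^+ 2 by ring.
rewrite E1 in h4.
lra.
Qed.

End difference_quotient.

(** * Logarithmic moments as limits of power moments *)

Section log_moment.
Context {R : realType} {n : nat}.
Local Open Scope ereal_scope.
Local Notation E := (borel_rV R n).
Local Notation vec := ('rV[R]_n).
Variable rho : R.
Hypothesis rho1 : (1 <= rho)%R.
Local Notation B := (origin_ball rho : set E).
Implicit Types (sigma tau : probability E R) (x : vec) (j : nat).

(** The shift by [rho] makes -log|x| nonnegative on the ball of radius [rho], as ln t < t; the
    infinite value at the origin is kept. *)
Definition neg_log x : \bar R := maxe 0 (rho%:E - lne (enorm x)%:E).

Definition log_defect tau : \bar R := \int[tau]_x neg_log (x : vec).

Let mB : measurable B.
Proof. by apply: closed_borel; exact: closed_origin_ball. Qed.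

Lemma neg_log_ge0 x : 0 <= neg_log x.
Proof. by rewrite /neg_log le_max lexx. Qed.

Lemma measurable_neg_log : measurable_fun [set: E] (fun x : E => neg_log (x : vec)).
Proof.
apply: measurable_maxe; first exact: measurable_cst.
apply: emeasurable_funB; first exact: measurable_cst.
rewrite (_ : (fun _ => _) = fun x : E => if enorm (x : vec) == 0%R then -oo else (ln (enorm (x : vec)))%:E); last first.
  apply/funext => x; rewrite /=.
  have [->|x0] := eqVneq (enorm (x : vec)) 0%R; first by rewrite lexx.
  by rewrite leNgt lt_neqAle eq_sym x0 enorm_ge0.
apply: measurable_fun_ifT; last 2 first.
- exact: measurable_cst.
- by apply/measurable_EFinP; apply: measurableT_comp; [exact: measurable_ln|exact: measurable_enorm].
by apply: measurable_fun_eqr; [exact: measurable_enorm|exact: measurable_cst].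
Qed.

Lemma neg_logE x : (enorm x <= rho)%R -> neg_log x = rho%:E - lne (enorm x)%:E.
Proof.
move=> xr; rewrite /neg_log; apply/max_idPr.
have [x0|x0] := eqVneq (enorm x) 0%R; first by rewrite x0 le0_lneNy//; exact: leey.
have xp : (0 < enorm x)%R by rewrite lt_neqAle eq_sym x0 enorm_ge0.
rewrite lne_EFin// -EFinB lee_fin subr_ge0.
by apply: le_trans xr; exact/ltW/ln_sublinear.
Qed.

(** This is rho - (|x|^a - 1) / a with a = 1/(j + 1), nonnegative on the ball and increasing in [j],
    so monotone convergence applies. *)
Let approx j x : R := (rho + j.+1%:R - j.+1%:R * (enorm x `^ (j.+1%:R^-1)))%R.

Let approxE j x : approx j x = (rho - (enorm x `^ (j.+1%:R^-1) - 1) / j.+1%:R^-1)%R.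
Proof. by rewrite /approx invrK; ring. Qed.

Let jV j : (0 < j.+1%:R^-1 :> R)%R.
Proof. by rewrite invr_gt0. Qed.

Let jV1 j : (j.+1%:R^-1 <= 1 :> R)%R.
Proof. by rewrite invf_le1// ler1n. Qed.

Let approx_ge0 j x : (enorm x <= rho)%R -> (0 <= approx j x)%R.
Proof.
move=> xr; rewrite approxE subr_ge0.
have [x0|x0] := eqVneq (enorm x) 0%R.
  rewrite x0 powR0 ?gt_eqF// sub0r mulN1r; apply: (@le_trans _ _ 0%R).
    by rewrite oppr_le0 invr_ge0 ltW.
  exact: le_trans rho1.
have xp : (0 < enorm x)%R by rewrite lt_neqAle eq_sym x0 enorm_ge0.
apply: (le_trans (powR_quotient_le xp (jV j) (jV1 j))).
by rewrite divr1 powRr1 ?enorm_ge0//; lra.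
Qed.

Let approx_mono x i j : (i <= j)%N -> (approx i x <= approx j x)%R.
Proof.
move=> ij; have [x0|x0] := eqVneq (enorm x) 0%R.
  by rewrite /approx x0 !powR0 ?gt_eqF// !mulr0 !subr0 lerD2l ler_nat.
have xp : (0 < enorm x)%R by rewrite lt_neqAle eq_sym x0 enorm_ge0.
rewrite !approxE lerD2l lerN2; apply: powR_quotient_le => //.
by rewrite lef_pV2 ?posrE// ler_nat.
Qed.

Let approx_cvg x : (enorm x <= rho)%R -> (approx j x)%:E @[j --> \oo] --> neg_log x.
Proof.
move=> xr; rewrite neg_logE//.
have [x0|x0] := eqVneq (enorm x) 0%R.
  have -> : rho%:E - lne (enorm x)%:E = +oo by rewrite x0 le0_lneNy.
  apply/cvgeyPge => A.
  near=> j; rewrite lee_fin /approx x0 powR0 ?gt_eqF// mulr0 subr0.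
  have : (A <= j%:R)%R by near: j; exact: nbhs_infty_ger.
  by rewrite -natr1; have := rho1; lra.
have xp : (0 < enorm x)%R by rewrite lt_neqAle eq_sym x0 enorm_ge0.
rewrite lne_EFin// -EFinB; apply: cvg_EFin; first exact: nearW.
set C := (ln (enorm x) ^+ 2 * (1 + enorm x))%R.
apply: (@squeeze_cvgr _ _ _ _ (fun j => rho - ln (enorm x) - harmonic j * C)%R (fun=> rho - ln (enorm x))%R).
- apply: nearW => j; rewrite /= approxE; apply/andP; split.
    by rewrite -addrA lerD2l -opprD lerN2; exact: powR_quotient_le_ln.
  by rewrite lerD2l lerN2; exact: ln_le_powR_quotient.
- rewrite -[X in _ --> X]subr0; apply: cvgB; first exact: cvg_cst.
  rewrite -(mul0r C); apply: cvgMl; exact: cvg_harmonic.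
- exact: cvg_cst.
Unshelve. all: by end_near. Qed.

Lemma integral_approx tau j : tau B = 1 ->
  \int[tau]_(x in B) (approx j x)%:E
    = (rho + j.+1%:R - j.+1%:R * fine (moment tau j.+1%:R^-1))%:E.
Proof.
move=> tB; set a := j.+1%:R^-1%R.
have Mf : moment tau a \is a fin_num by apply: (@moment_fin _ _ rho _ _ _ _) => //; exact: jV.
have mp : measurable_fun [set: E] (fun x : E => (enorm (x : vec) `^ a)%R : R).
  exact: (measurableT_comp (measurable_powR a) (@measurable_enorm R n)).
have map : measurable_fun B (fun x : E => (approx j (x : vec))%:E).
  apply: measurable_funTS; apply/measurable_EFinP; apply: measurable_funB; first exact: measurable_cst.
  by apply: measurable_funM => //; exact: measurable_cst.
have mj : measurable_fun B (fun x : E => (j.+1%:R * (enorm (x : vec) `^ a))%:E).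
  apply: measurable_funTS; apply/measurable_EFinP.
  by apply: measurable_funM => //; exact: measurable_cst.
have I2 : \int[tau]_(x in B) (j.+1%:R * (enorm (x : vec) `^ a))%:E = (j.+1%:R * fine (moment tau a))%:E.
  under eq_integral do rewrite EFinM.
  rewrite ge0_integralZl; [|exact: mB|by apply: measurable_funTS; apply/measurable_EFinP
    |by move=> x _; rewrite lee_fin powR_ge0|by rewrite lee_fin].
  rewrite EFinM fineK//; congr (_ * _); apply: integral_probability1 => //.
    by apply/measurable_EFinP.
  by move=> x; rewrite lee_fin powR_ge0.
have : \int[tau]_(x in B) ((approx j (x : vec))%:E + (j.+1%:R * (enorm (x : vec) `^ a))%:E) = (rho + j.+1%:R)%:E.
  transitivity (\int[tau]_(x in B) (rho + j.+1%:R)%:E).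
    by apply: eq_integral => x _; rewrite -EFinD subrK.
  by rewrite integral_cst// -[RHS]mule1; congr (_ * _).
rewrite ge0_integralD; [|exact: mB|by move=> x xr; rewrite lee_fin approx_ge0|exact: map
  |by move=> x _; rewrite lee_fin mulr_ge0 ?powR_ge0|exact: mj].
rewrite I2 => H; have /eqP := esym H; rewrite -sube_eq//; last first.
  exact: fin_num_adde_defl.
by move=> /eqP <-; rewrite -EFinB.
Qed.

Lemma log_defect_cvg tau : tau B = 1 ->
  (rho + j.+1%:R - j.+1%:R * fine (moment tau j.+1%:R^-1))%:E @[j --> \oo] --> log_defect tau.
Proof.
move=> tB.
have mA j : measurable_fun B (fun x : E => (approx j (x : vec))%:E).
  apply: measurable_funTS; apply/measurable_EFinP; apply: measurable_funB; first exact: measurable_cst.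
  apply: measurable_funM; first exact: measurable_cst.
  exact: (measurableT_comp (measurable_powR _) (@measurable_enorm R n)).
have A0 j x : B x -> 0 <= (approx j x)%:E by move=> xr; rewrite lee_fin approx_ge0.
have Am x : B x -> {homo (fun j => (approx j x)%:E) : i j / (i <= j)%N >-> i <= j}.
  by move=> _ i j ij; rewrite lee_fin approx_mono.
have := @cvg_monotone_convergence _ _ _ tau _ mB _ mA A0 Am.
under eq_fun do rewrite integral_approx//.
suff -> : \int[tau]_(x in B) limn (fun j => (approx j x)%:E) = log_defect tau by [].
rewrite /log_defect -(integral_probability1 mB tB measurable_neg_log); last by move=> x; exact: neg_log_ge0.
by apply: eq_integral => x; rewrite inE => xr; apply: cvg_lim => //; exact: approx_cvg.
Qed.

(** Multiplication by j + 1, the inverse of the exponent, turns a gap proportional to the exponent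
    into the fixed gap [d], which survives the limit. *)
Lemma log_defect_le sigma tau (d : R) : sigma B = 1 -> tau B = 1 ->
  (forall j, fine (moment sigma j.+1%:R^-1) + d / j.+1%:R <= fine (moment tau j.+1%:R^-1))%R ->
  log_defect tau + d%:E <= log_defect sigma.
Proof.
move=> sB tB H; have H2 := log_defect_cvg sB.
have H1 : ((rho + j.+1%:R - j.+1%:R * fine (moment tau j.+1%:R^-1))%:E + d%:E) @[j --> \oo] --> log_defect tau + d%:E.
  apply: cvgeD; [exact: fin_num_adde_defl|exact: log_defect_cvg|exact: cvg_cst].
rewrite -(cvg_lim _ H1)// -(cvg_lim _ H2)//; apply: lee_lim.
- exact: cvgP H1.
- exact: cvgP H2.
apply: nearW => j; rewrite -EFinD lee_fin.
have j0 : (0 < j.+1%:R :> R)%R by [].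
have := ler_wpM2l (ltW j0) (H j); rewrite mulrDr mulrCA mulfV ?mulr1 ?gt_eqF//.
lra.
Qed.

Lemma integral_lneV (K : set E) tau : measurable K -> K `<=` B -> tau K = 1 ->
  \int[tau]_(x in K) lne (enorm (x : vec))%:E^-1 = log_defect tau - rho%:E.
Proof.
move=> mK KB tK.
rewrite -(integral_subcst mK tK measurable_neg_log _ (le_trans ler01 rho1)); last by move=> x; exact: neg_log_ge0.
apply: eq_integral => x; rewrite inE => /KB xr; rewrite neg_logE//.
have [x0|x0] := eqVneq (enorm (x : vec)) 0%R.
  by rewrite x0 inver eqxx (le0_lneNy (lexx 0)).
have xp : (0 < enorm (x : vec))%R by rewrite lt_neqAle eq_sym x0 enorm_ge0.
rewrite inver (negbTE x0) !lne_EFin ?invr_gt0// -!EFinB lnV ?posrE//; congr EFin; ring.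
Qed.

Lemma integral_lne (K : set E) tau : measurable K -> K `<=` B -> tau K = 1 ->
  \int[tau]_(x in K) lne (enorm (x : vec))%:E = - (log_defect tau - rho%:E).
Proof.
move=> mK KB tK; have r0 : (0 <= rho)%R by exact: le_trans rho1.
rewrite -(integral_subcst mK tK measurable_neg_log _ r0); last by move=> x; exact: neg_log_ge0.
rewrite -integralN.
  apply: eq_integral => x; rewrite inE => /KB xr; rewrite neg_logE//.
  have [x0|x0] := eqVneq (enorm (x : vec)) 0%R.
    by rewrite x0 le0_lneNy// oppeNy addey// addye.
  have xp : (0 < enorm (x : vec))%R by rewrite lt_neqAle eq_sym x0 enorm_ge0.
  by rewrite lne_EFin// -!EFinB -EFinN; congr EFin; ring.
apply: fin_num_adde_defl; rewrite fin_numN ge0_fin_numE; last by apply: integral_ge0.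
apply: (@le_lt_trans _ _ (\int[tau]_(x in K) rho%:E)).
  apply: ge0_le_integral => //.
  - apply: measurable_funeneg; apply: emeasurable_funB; last exact: measurable_cst.
    by apply: measurable_funTS; exact: measurable_neg_log.
  - move=> x _; rewrite funenegE fin_num_oppeB// ge_max lee_fin r0 andbT addeC.
    by rewrite -[leRHS]adde0 leeD2l// oppe_le0 neg_log_ge0.
rewrite integral_cst//; apply: (@le_lt_trans _ _ (rho%:E * 1)); last by rewrite mule1 ltry.
by rewrite le_eqVlt; apply/orP; left; apply/eqP; congr (_ * _).
Qed.

End log_moment.

Section integral_bounds.
Context d (T : measurableType d) (R : realType).
Local Open Scope ereal_scope.
Variables (P : probability T R) (S : set T) (f : T -> \bar R) (c : R).
Hypotheses (mS : measurable S) (PS : P S = 1) (mf : measurable_fun setT f)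
  (f0 : forall x, 0 <= f x).

Let intc : \int[P]_(x in S) c%:E = c%:E.
Proof. by rewrite integral_cst// -[RHS]mule1; congr (_ * _). Qed.

Lemma integral_eq_on : (forall x, S x -> f x = c%:E) -> \int[P]_x f x = c%:E.
Proof.
move=> fc; rewrite -(integral_probability1 mS PS mf f0) -[RHS]intc.
by apply: eq_integral => x; rewrite inE => /fc.
Qed.

Lemma integral_le_on : (forall x, S x -> f x <= c%:E) -> \int[P]_x f x <= c%:E.
Proof.
move=> fc; rewrite -(integral_probability1 mS PS mf f0) -[leRHS]intc.
by apply: ge0_le_integral => //; exact: measurable_funTS.
Qed.

Lemma integral_lt_on A : measurable A -> 0 < P A -> (forall x, S x -> f x <= c%:E) ->
  (forall x, S x -> A x -> f x < c%:E) -> \int[P]_x f x < c%:E.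
Proof.
move=> mA PA fc fA; have H := integral_le_on fc.
rewrite lt_neqAle H andbT; apply/eqP => E.
have ff x : S x -> f x \is a fin_num.
  by move=> Sx; rewrite ge0_fin_numE//; apply: (le_lt_trans (fc _ Sx)); rewrite ltry.
have g0 x : S x -> 0 <= c%:E - f x by move=> Sx; rewrite sube_ge0 ?fc// ff.
have mfS : measurable_fun S f by exact: measurable_funTS.
have mg : measurable_fun S (fun x => c%:E - f x) by apply: emeasurable_funB => //; exact: measurable_cst.
have gpos : 0 < \int[P]_(x in S) (c%:E - f x).
  apply: (@lt_le_trans _ _ (\int[P]_(x in S `&` A) (c%:E - f x))).
    apply: integral_gt0.
    - exact: measurableI.
    - by apply: measurable_funS mg => // x [].
    - by move=> x [Sx Ax]; rewrite sube_gt0 fA.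
    - apply: (lt_le_trans PA); rewrite le_eqVlt; apply/orP; left; apply/eqP.
      by apply/esym; exact: probability_setI1.
  by apply: ge0_subset_integral => //; exact: measurableI.
have : \int[P]_(x in S) (f x + (c%:E - f x)) = c%:E.
  rewrite -[RHS]intc; apply: eq_integral => x; rewrite inE => Sx.
  by rewrite addeC subeK// ff.
rewrite ge0_integralD//; rewrite integral_probability1// E => H2.
move: H2 gpos; case: (\int[P]_(x in S) (c%:E - f x)) => [i| |]//.
by rewrite -EFinD lte_fin => -[] /eqP; rewrite -[X in _ == X]addr0 (inj_eq (addrI c)) => /eqP ->; rewrite ltxx.
Qed.

End integral_bounds.

(** * Comparison of the averages of two equilibrium measures *)

Section equilibrium.
Context {R : realType} {n : nat}.
Local Open Scope ereal_scope.
Local Notation E := (borel_rV R n).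
Local Notation vec := ('rV[R]_n).
Variables (p m rho : R).
Hypotheses (n0 : (0 < n)%N) (pn : p = (n%:R - 1)%R) (rho1 : (1 <= rho)%R)
  (adm : admissible p m (n%:R * (2 * rho + 2))).
Variable nu1 : probability E R.
Hypothesis Hnu1 : ball_measure p nu1.
Local Notation h := (@nker R n p m : E -> E -> \bar R).
Local Notation G := (gap p m nu1).
Local Notation B r := (origin_ball r : set E).
Implicit Types (x y : vec) (s r : R) (K : set E) (sigma tau mu nu Q : probability E R).

Let rho0 : (0 < rho)%R. Proof. exact: lt_le_trans rho1. Qed.

Let h0 (x y : E) : 0 <= h x y. Proof. exact: nker_ge0. Qed.

Let hC (x y : E) : h x y = h y x. Proof. exact: nkerC. Qed.

Let mh : measurable_fun [set: E * E] (fun z : E * E => h z.1 z.2).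
Proof. exact: measurable_nker. Qed.

Let mpot tau : measurable_fun [set: E] (potential h tau).
Proof. exact: measurable_potential. Qed.

Let pot0 tau x : 0 <= potential h tau x.
Proof. exact: potential_ge0. Qed.

Let mB r : measurable (B r).
Proof. by apply: closed_borel; exact: closed_origin_ball. Qed.

Let box x : (enorm x <= rho)%R -> (`|x| <= rho)%R.
Proof. exact: le_trans (ler_norm_enorm _). Qed.

Let prob_mono tau K r : measurable K -> K `<=` B r -> tau K = 1 -> tau (B r) = 1.
Proof.
move=> mK KB tK; apply/eqP; rewrite eq_le probability_le1//=.
apply: (@le_trans _ _ (tau K)); last by apply: le_measure; rewrite ?inE.
by rewrite le_eqVlt; apply/orP; left; apply/eqP; exact: esym.
Qed.

Let energyE K tau : minimizer h K tau -> exists V : R, mutual h tau tau = V%:E.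
Proof.
move=> [_ H _]; exists (fine (mutual h tau tau)); rewrite fineK// ge0_fin_numE//.
exact: mutual_ge0.
Qed.

(** The set of points of [K] where the potential is at most the energy has full mass, and the
    maximum principle accepts it as a carrier, closed or not. *)
Lemma minimizer_potential_le K tau x : measurable K -> K `<=` B rho -> minimizer h K tau ->
  (`|x| <= rho)%R -> potential h tau x <= mutual h tau tau.
Proof.
move=> mK KB Hm xr; have [V VE] := energyE Hm.
have V0 : (0 <= V)%R by rewrite -lee_fin -VE; exact: mutual_ge0.
have ae := minimizer_potential_ae h0 hC mh mK Hm.
rewrite VE in ae *.
apply: (max_principle n0 pn (ltW rho0) adm _ _ ae V0 _ xr).
- apply: measurableI => //; rewrite -[X in measurable X]setTI.
  exact: emeasurable_fun_infty_c.
- by move=> y [/KB yr _]; exact: box.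
- by move=> y [].
Qed.

Let mutual_scaled tau s Q : tau (B s) = 1 -> (0 < s)%R -> (s <= rho)%R ->
  (forall x, potential h Q x = ball_pot p m nu1 s x) -> mutual h tau Q = (ball_u p m nu1 s 0)%:E.
Proof.
move=> tB s0 sr potQ; rewrite /mutual; apply: (integral_eq_on (mB s) tB (mpot Q) (pot0 Q)) => x xs.
by rewrite potQ; exact: (ball_potE n0 pn rho1 adm Hnu1 s0 sr xs).
Qed.

(** Uniqueness of minimisers is bypassed: pairing [sigma] with the explicit measure [Q], the first
    variation and the bound on the potential of [sigma] give both inequalities between the energies,
    so [Q] is a minimiser too. *)
Lemma ball_energy r sigma : (0 < r)%R -> (r <= rho)%R -> minimizer h (B r) sigma ->
  mutual h sigma sigma = (ball_u p m nu1 r 0)%:E /\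
  exists Q, [/\ minimizer h (B r) Q, mutual h Q Q = (ball_u p m nu1 r 0)%:E
    & forall x, potential h Q x = ball_pot p m nu1 r x].
Proof.
move=> r0 rr Hs; have [sB soo smin] := Hs.
have [Q [QB potQ]] := exists_scaled_potential m Hnu1 r0.
have QQ := mutual_scaled QB r0 rr potQ; have sQ := mutual_scaled sB r0 rr potQ.
have Brho : B r `<=` B rho by move=> x /= xr; exact: le_trans rr.
have e : mutual h sigma sigma = (ball_u p m nu1 r 0)%:E.
  apply/eqP; rewrite eq_le; apply/andP; split.
    rewrite -sQ; apply: (minimizer_mutual_ge h0 hC mh (mB r) Hs QB).
    by rewrite QQ ltry.
  have [V VE] := energyE Hs.
  rewrite -sQ (mutualC h0 hC mh) VE; apply: (integral_le_on (mB r) QB (mpot sigma) (pot0 sigma)).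
  by move=> x xr; rewrite -VE; apply: (minimizer_potential_le (mB r) Brho Hs); apply: box; exact: Brho.
split => //; exists Q; split => //; split => //; first by rewrite QQ ltry.
by move=> P PB; rewrite QQ -e; exact: smin.
Qed.

Let mgapp s : measurable_fun [set: E] (fun x : E => (gapp G s (x : vec))%:E).
Proof.
apply/measurable_EFinP; apply: measurable_maxr; first exact: measurable_cst.
apply: measurable_funM; first exact: measurable_cst.
have mz (f : E -> E) : measurable_fun setT f -> measurable_fun [set: E] (fun x : E => ball_u p m nu1 s (f x : vec)).
  move=> mf; have mp : measurable_fun [set: E] (fun x : E => (f x, s) : E * R) by exact: measurable_fun_pair.
  exact: (measurableT_comp (measurable_ball_u p m nu1) mp).
by apply: measurable_funB; apply: mz; [exact: measurable_cst|exact: measurable_id].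
Qed.

Lemma measurable_gap : measurable_fun [set: E * R] (fun z : E * R => G z.2 (z.1 : vec)).
Proof.
apply: measurable_funM.
  exact: (measurableT_comp (measurable_powR p) (@measurable_snd _ _ E R)).
apply: measurable_funB; last exact: measurable_ball_u.
have mp : measurable_fun [set: E * R] (fun z : E * R => ((0%R : vec), z.2) : E * R).
  by apply: measurable_fun_pair; [exact: measurable_cst|exact: measurable_snd].
exact: (measurableT_comp (measurable_ball_u p m nu1) mp).
Qed.

(** Averaging the gap turns it into a mutual energy; the additive form avoids a subtraction of
    extended reals. *)
Lemma average_gap tau s Q : tau (B rho) = 1 -> (0 < s)%R -> (s <= rho)%R ->
  (forall x, potential h Q x = ball_pot p m nu1 s x) ->
  average G tau s + (s `^ p)%:E * mutual h tau Q = (s `^ p * ball_u p m nu1 s 0)%:E.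
Proof.
move=> tB s0 sr potQ.
have sp : 0 <= (s `^ p)%:E by rewrite lee_fin powR_ge0.
have m2 : measurable_fun [set: E] (fun x : E => (s `^ p)%:E * potential h Q x).
  have mc : measurable_fun [set: E] (fun _ : E => (s `^ p)%:E) by exact: measurable_cst.
  exact: (emeasurable_funM mc (mpot Q)).
have p2 x : 0 <= (s `^ p)%:E * potential h Q x by exact: mule_ge0.
have g0 x : 0 <= (gapp G s x)%:E by rewrite lee_fin le_max lexx.
rewrite /average /mutual -ge0_integralZl; [|exact: measurableT|exact: mpot|by move=> x _; exact: pot0|exact: sp].
rewrite -ge0_integralD; [|exact: measurableT|by move=> x _; exact: g0|exact: mgapp|by move=> x _; exact: p2|exact: m2].
apply: (integral_eq_on (mB rho) tB).
- by apply: emeasurable_funD; [exact: mgapp|exact: m2].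
- by move=> x; exact: adde_ge0 (g0 x) (p2 x).
move=> x xr; rewrite potQ.
rewrite [X in _ + _ * X](ball_pot_fin n0 pn rho1 adm Hnu1 s0 sr xr) -EFinM -EFinD; congr EFin.
rewrite /gapp max_r; last exact: (gap_ge0 n0 pn rho1 adm Hnu1 s0 sr xr).
have key (a b c : R) : (c * (a - b) + c * b = c * a)%R by ring.
exact: key.
Qed.

Lemma average_outside sigma r s : sigma (B r) = 1 -> (0 < s)%R -> (s <= rho)%R -> (r <= s)%R ->
  average G sigma s = 0.
Proof.
move=> sB s0 sr rs; apply: (integral_eq_on (mB r) sB).
- exact: mgapp.
- by move=> x; rewrite lee_fin le_max lexx.
move=> x xr; congr EFin; rewrite /gapp (gap_eq0 n0 pn rho1 adm Hnu1 s0 sr) ?maxxx//.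
exact: le_trans rs.
Qed.

(** For s >= r the left side is 0. For s < r let [Q] be the ball measure of radius s and V the
    common energy: the potential of [tau] is at most V, so its mutual energy with [Q] is at most V,
    while the first variation for [sigma] gives at least V. A smaller mutual energy means a larger
    average. *)
Lemma average_le K tau r sigma : measurable K -> K `<=` B rho -> minimizer h K tau ->
  (0 < r)%R -> (r <= rho)%R -> minimizer h (B r) sigma ->
  mutual h sigma sigma = mutual h tau tau ->
  forall s, (0 < s)%R -> (s <= rho)%R -> average G sigma s <= average G tau s.
Proof.
move=> mK KB Ht r0 rr Hs e s s0 sr.
have [tK _ _] := Ht; have [sB _ _] := Hs.
have Brho : B r `<=` B rho by move=> x /= xr; exact: le_trans rr.
have tB := prob_mono mK KB tK; have sB' := prob_mono (mB r) Brho sB.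
have [rs|sr'] := leP r s; first by rewrite (average_outside sB s0 sr rs) average_ge0.
have [Q [QB potQ]] := exists_scaled_potential m Hnu1 s0.
have QQ := mutual_scaled QB s0 sr potQ.
have [V VE] := energyE Ht.
have Bs : B s `<=` B rho by move=> x /= xs; exact: le_trans sr.
have H1 : mutual h tau Q <= V%:E.
  rewrite (mutualC h0 hC mh); apply: (integral_le_on (mB s) QB (mpot tau) (pot0 tau)) => x xs.
  by rewrite -VE; apply: (minimizer_potential_le mK KB Ht); apply: box; exact: Bs.
have H2 : V%:E <= mutual h sigma Q.
  rewrite -VE -e; apply: (minimizer_mutual_ge h0 hC mh (mB r) Hs); last by rewrite QQ ltry.
  by apply: (prob_mono (mB s) _ QB) => x /= xs; apply: le_trans (ltW sr').
have At := average_gap tB s0 sr potQ; have As := average_gap sB' s0 sr potQ.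
have tQf : mutual h tau Q \is a fin_num.
  by rewrite ge0_fin_numE ?mutual_ge0//; apply: le_lt_trans H1 _; rewrite ltry.
have cf : (s `^ p)%:E * mutual h tau Q \is a fin_num by rewrite fin_numM.
rewrite -(leeD2rE _ _ cf) At -As leeD2l// lee_wpmul2l ?lee_fin ?powR_ge0//.
exact: le_trans H2.
Qed.

End equilibrium.

Lemma powR_le1 {R : realType} (t a : R) : 0 <= t -> t <= 1 -> 0 <= a -> t `^ a <= 1.
Proof.
move=> t0 t1 a0; have := @ge0_ler_powR R a a0 t 1.
by rewrite !nnegrE powR1; apply.
Qed.

(** * Moment inequalities and the equality cases *)

Section equality_case.
Context {R : realType} {n : nat}.
Local Open Scope ereal_scope.
Local Notation E := (borel_rV R n).
Local Notation vec := ('rV[R]_n).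
Variables (p m rho : R).
Hypotheses (n0 : (0 < n)%N) (pn : p = (n%:R - 1)%R) (rho1 : (1 <= rho)%R)
  (m0 : (0 <= m)%R) (adm : admissible p m (n%:R * (2 * rho + 2))).
Variables (nu1 : probability E R) (e : vec).
Hypotheses (Hnu1 : ball_measure p nu1) (e1 : enorm e = 1%R).
Local Notation h := (@nker R n p m : E -> E -> \bar R).
Local Notation G := (gap p m nu1).
Local Notation B r := (origin_ball r : set E).
Implicit Types (x y : vec) (s r : R) (K : set E) (sigma tau mu nu Q P : probability E R).

Let p0 : (0 <= p)%R.
Proof. by rewrite pn subr_ge0 ler1n. Qed.

Let rho0 : (0 < rho)%R. Proof. exact: lt_le_trans rho1. Qed.

Let h0 (x y : E) : 0 <= h x y. Proof. exact: nker_ge0. Qed.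

Let hC (x y : E) : h x y = h y x. Proof. exact: nkerC. Qed.

Let mh : measurable_fun [set: E * E] (fun z : E * E => h z.1 z.2).
Proof. exact: measurable_nker. Qed.

Let mpot tau : measurable_fun [set: E] (potential h tau).
Proof. exact: measurable_potential. Qed.

Let pot0 tau x : 0 <= potential h tau x.
Proof. exact: potential_ge0. Qed.

Let mB r : measurable (B r).
Proof. by apply: closed_borel; exact: closed_origin_ball. Qed.

Let box x : (enorm x <= rho)%R -> (`|x| <= rho)%R.
Proof. exact: le_trans (ler_norm_enorm _). Qed.

Let prob_mono tau K r : measurable K -> K `<=` B r -> tau K = 1 -> tau (B r) = 1.
Proof.
move=> mK KB tK; apply/eqP; rewrite eq_le probability_le1//=.
apply: (@le_trans _ _ (tau K)); last by apply: le_measure; rewrite ?inE.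
by rewrite le_eqVlt; apply/orP; left; apply/eqP; exact: esym.
Qed.

Let energyE K tau : minimizer h K tau -> exists V : R, mutual h tau tau = V%:E.
Proof.
move=> [_ H _]; exists (fine (mutual h tau tau)); rewrite fineK// ge0_fin_numE//.
exact: mutual_ge0.
Qed.

Let Gz s x : (0 < s)%R -> (s <= rho)%R -> (enorm x <= s)%R -> G s x = 0%R.
Proof. exact: (gap_eq0 n0 pn rho1 adm Hnu1). Qed.

Let Gp s x : (0 < s)%R -> (s < enorm x)%R -> (enorm x <= rho)%R -> (0 < G s x)%R.
Proof. exact: (gap_gt0 n0 pn rho1 adm Hnu1). Qed.

Let Gscale (l s : R) x : (0 < l)%R -> (0 < s)%R -> (s <= rho)%R -> (l * s <= rho)%R ->
  (enorm x <= rho)%R -> (enorm (l *: x) <= rho)%R -> G (l * s)%R (l *: x) = G s x.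
Proof. exact: (gap_scale n0 pn rho1 adm Hnu1). Qed.

Let Gradial s x x' : (0 < s)%R -> enorm x = enorm x' -> G s x = G s x'.
Proof.
move=> s0 xx'; have E := ball_u_radial m Hnu1 s0 xx'.
by rewrite /gap [X in (_ * (_ - X))%R = _]E.
Qed.

Let mG : measurable_fun [set: E * R] (fun z : E * R => G z.2 (z.1 : vec)).
Proof. exact: measurable_gap. Qed.

Let G_le s x : (0 < s)%R -> (G s x <= s `^ p * ball_u p m nu1 s 0)%R.
Proof.
move=> s0; rewrite /gap; apply: ler_wpM2l; first exact: powR_ge0.
by rewrite gerBl; exact: ball_u_ge0.
Qed.

Let u1_ge0 : (0 <= ball_u p m nu1 1 0)%R.
Proof. exact: ball_u_ge0. Qed.

(** For p > 0 homogeneity bounds the gap by the constant u_1(0), and the integral of s^(q-1) over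
    ]0, 1] is 1/q. *)
Lemma layer_le_inv q : p != 0%R -> (0 < q)%R ->
  layer rho G q e <= (ball_u p m nu1 1 0 * q^-1)%:E.
Proof.
move=> pn0 q0; have q0' : (0 < q - 0)%R by rewrite subr0.
have := layer_le rho1 e1 Gz mG q0' u1_ge0.
rewrite subr0; apply => u u0 u1.
rewrite oppr0 powRr0 mulr1; apply: le_trans (G_le _ u0) _.
by rewrite le_eqVlt; apply/orP; left; apply/eqP; exact: (ball_u_scale n0 pn rho1 adm Hnu1 pn0 u0).
Qed.

(** For p = 0 the gap may blow up like -log s at small radii; this is absorbed by the power
    s^(-q/2), half of the available exponent. *)
Lemma layer_fin q : (0 < q)%R -> layer rho G q e \is a fin_num.
Proof.
move=> q0; rewrite ge0_fin_numE; last exact/ltW/(layer_gt0 rho1 e1 Gp mG).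
have [p00|pn0] := eqVneq p 0%R; last first.
  by apply: le_lt_trans (layer_le_inv pn0 q0) _; rewrite ltry.
have q2 : (0 < q - q / 2)%R by lra.
have a0 : (0 < q / 2)%R by lra.
have C0 : (0 <= ball_u p m nu1 1 0 + (q / 2)^-1)%R by rewrite addr_ge0// invr_ge0 ltW.
apply: le_lt_trans (layer_le rho1 e1 Gz mG q2 C0 _) _; last by rewrite ltry.
move=> u u0 u1; apply: le_trans (G_le _ u0) _.
have up : (u `^ p = 1)%R by rewrite p00 powRr0.
rewrite up mul1r; apply: le_trans (ball_u0_le n0 pn rho1 adm Hnu1 p00 u0 (ltW u1)) _.
have l1 := ln_le_powR u0 a0.
have ge1 : (1 <= u `^ (- (q / 2)))%R.
  rewrite powRN invf_ge1 ?powR_gt0//.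
  exact: powR_le1 (ltW u0) (ltW u1) (ltW a0).
have l2 := ler_wpM2l u1_ge0 ge1.
move: (ball_u p m nu1 1 0) l2 => v; rewrite mulr1 => l2.
by rewrite mulrDl; apply: lerD.
Qed.

Lemma ball_full tau r : (forall r', (r < r')%R -> tau ([set x | (r' <= enorm (x : vec))%R] : set E) = 0) ->
  tau (B r) = 1.
Proof.
move=> H; have mr r' : measurable ([set x | (r' <= enorm (x : vec))%R] : set E).
  rewrite (_ : mkset _ = (@enorm R n : E -> R) @^-1` `[r', +oo[); last first.
    by apply/seteqP; split => x /=; rewrite in_itv/= andbT.
  by rewrite -[X in measurable X]setTI; apply: measurable_enorm => //.
pose F j := [set x | (r + j.+1%:R^-1 <= enorm (x : vec))%R] : set E.
have E0 : ~` (B r) = \bigcup_j F j.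
  apply/seteqP; split => [x /= /negP|x [j _]]; rewrite /origin_ball /F /=.
    rewrite -ltNge => rx; have [j] := ltr_add_invr rx; rewrite /= => jx.
    by exists j => //; exact: ltW.
  by move=> jx /= xr; move: (le_trans jx xr); rewrite gerDl leNgt invr_gt0 ltr0Sn.
have N0 : tau (~` (B r)) = 0.
  apply: measure_negligible; first exact: measurableC.
  rewrite E0; apply: negligible_bigcup => j; exists (F j); split => //.
    exact: mr.
  by apply: H; rewrite ltrDl invr_gt0.
by have := probability_setC tau (measurableC (mB r)); rewrite setCK N0 sube0.
Qed.

Section same_energy.
Variables (K : set vec) (mu nu : probability E R) (r : R).
Hypotheses (cK : compact K) (KB : K `<=` origin_ball rho) (r0 : (0 < r)%R) (rr : (r <= rho)%R)
  (Hmu : minimizer h (K : set E) mu) (Hnu : minimizer h (B r) nu)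
  (munu : mutual h nu nu = mutual h mu mu).

Let mK : measurable (K : set E).
Proof. exact: compact_borel. Qed.

Let muK : mu (K : set E) = 1. Proof. by case: Hmu. Qed.

Let nuB : nu (B r) = 1. Proof. by case: Hnu. Qed.

Let Brho : B r `<=` B rho.
Proof. by move=> x /= xr; exact: le_trans rr. Qed.

Let mu_rho : mu (B rho) = 1.
Proof. exact: prob_mono muK. Qed.

Let nu_rho : nu (B rho) = 1.
Proof. exact: prob_mono nuB. Qed.

Let averages := average_le n0 pn rho1 adm Hnu1 mK KB Hmu r0 rr Hnu munu.

Lemma ball_moment_le q : (0 < q)%R -> moment nu q <= moment mu q.
Proof.
move=> q0.
exact: (moment_le rho1 e1 Gz Gp Gscale Gradial mG q0 nu_rho mu_rho (layer_fin q0) averages).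
Qed.

(** If [mu] is carried by the ball it is also a minimiser for the ball, so the inequality applies
    with the two measures exchanged. *)
Lemma ball_moment_eq q : mu (B r) = 1 -> (0 < q)%R -> moment nu q = moment mu q.
Proof.
move=> muB q0; apply/eqP; rewrite eq_le ball_moment_le//=.
have Hmu' : minimizer h (B r) mu.
  have [_ moo _] := Hmu; have [_ _ nmin] := Hnu.
  by split => // Q QB; rewrite -munu; exact: nmin.
have av := average_le n0 pn rho1 adm Hnu1 (mB r) Brho Hnu r0 rr Hmu' (esym munu).
exact: (moment_le rho1 e1 Gz Gp Gscale Gradial mG q0 mu_rho nu_rho (layer_fin q0) av).
Qed.

(** For some r' > r the set |x| >= r' has positive mass, so for r < s < r' the averages of [mu] are
    positive while those of [nu] vanish. The gap [k] does not depend on q, which the limit q to 0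
    requires. *)
Lemma ball_moment_gap : mu (B r) <> 1 -> exists2 k : R, (0 < k)%R &
  forall q, (0 < q)%R -> (q <= 2)%R ->
    moment nu q * layer rho G q e + k%:E <= moment mu q * layer rho G q e.
Proof.
move=> muB.
have [r' [rr' mr']] : exists r', (r < r')%R /\ 0 < mu ([set x | (r' <= enorm (x : vec))%R] : set E).
  apply: contrapT => H; apply: muB; apply: ball_full => r' rr'.
  apply/eqP; rewrite eq_le measure_ge0 andbT leNgt; apply/negP => mr'.
  by apply: H; exists r'.
have r'0 : (0 < r')%R by exact: lt_trans rr'.
have r'rho : (r' <= rho)%R.
  rewrite leNgt; apply/negP => rho_r'; move: mr'; apply/negP; rewrite -leNgt.
  have <- : mu (~` (B rho)) = 0 by exact: probability1_setC.
  apply: le_measure; rewrite ?inE.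
  - rewrite (_ : mkset _ = (@enorm R n : E -> R) @^-1` `[r', +oo[); last first.
      by apply/seteqP; split => x /=; rewrite in_itv/= andbT.
    by rewrite -[X in measurable X]setTI; apply: measurable_enorm => //.
  - exact: measurableC.
  - move=> x /= r'x; rewrite /origin_ball /= => xr.
    by have := lt_le_trans rho_r' (le_trans r'x xr); rewrite ltxx.
(* For r < s < r' and q <= 2 one has s^(q-1) = s^q / s >= w^2 / r', because w <= 1 and w <= r. *)
pose w := Num.min 1%R r; pose c := (w ^+ 2 / r')%R.
have w0 : (0 < w)%R by rewrite /w lt_min ltr01.
have w1 : (w <= 1)%R by rewrite /w ge_min lexx.
have wr : (w <= r)%R by rewrite /w ge_min lexx orbT.
have c0 : (0 < c)%R by rewrite divr_gt0// exprn_gt0.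
pose eta := \int[@lebesgue_measure R]_(s in `]r, r'[) average G mu s.
have eta0 : 0 < eta by exact: (average_integral_gt0 Gp mG (ltW r0) rr' mu_rho mr').
have H q : (0 < q)%R -> (q <= 2)%R ->
    moment nu q * layer rho G q e + c%:E * eta <= moment mu q * layer rho G q e.
  move=> q0 q2.
  apply: (moment_lt_layer rho1 e1 Gz Gscale Gradial mG q0 nu_rho mu_rho (layer_fin q0) averages (ltW c0)).
  move=> s rs sr'; have s0 : (0 < s)%R by exact: lt_trans rs.
  have srho : (s <= rho)%R by exact: le_trans (ltW sr') r'rho.
  split; last exact: (average_outside n0 pn rho1 adm Hnu1 nuB s0 srho (ltW rs)).
  rewrite /weight s0 srho /= powRD; last by apply/implyP => _; rewrite gt_eqF.
  rewrite powR_inv1 ?(ltW s0)//; apply: ler_pM.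
  - exact: exprn_ge0 (ltW w0).
  - by rewrite invr_ge0 ltW.
  - apply: (@le_trans _ _ (w `^ q)%R); last first.
      by apply: ge0_ler_powR; rewrite ?nnegrE ?(ltW q0) ?(ltW w0) ?(ltW s0)//; apply: le_trans wr (ltW rs).
    have -> : (w ^+ 2 = w `^ q * w `^ (2%:R - q))%R.
      rewrite -powRD; last by apply/implyP => _; rewrite gt_eqF.
      by rewrite addrC subrK powR_mulrn// ltW.
    rewrite ler_piMr ?powR_ge0//.
    by apply: powR_le1; rewrite ?subr_ge0 ?(ltW w0).
  - by rewrite lef_pV2 ?posrE// ltW.
have k0 : 0 < c%:E * eta by rewrite mule_gt0.
have H1 := H 1%R ltr01 (ler1n _ 2).
have kf : c%:E * eta \is a fin_num.
  rewrite ge0_fin_numE ?(ltW k0)//; apply: (@le_lt_trans _ _ (moment mu 1 * layer rho G 1 e)).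
    apply: le_trans H1; rewrite leeDr// mule_ge0 ?moment_ge0//.
    exact/ltW/(layer_gt0 rho1 e1 Gp mG).
  by rewrite -ge0_fin_numE ?fin_numM ?layer_fin ?(moment_fin rho1 ltr01 mu_rho)// mule_ge0 ?moment_ge0//; exact/ltW/(layer_gt0 rho1 e1 Gp mG).
exists (fine (c%:E * eta)); first by rewrite fine_gt0// k0 -ge0_fin_numE ?(ltW k0).
by move=> q q0 q2; rewrite (fineK kf); exact: H.
Qed.

(** Here [mu] is carried by the closed set F = K meet B, off which its potential is below V. Its
    mutual energy with the ball measure [Q] is V, so [Q] cannot charge the complement of [F]. The
    potential of [Q] is then below V off [F], yet equals V on the ball: the ball lies in [F]. *)
Lemma ball_structure : mu (B r) = 1 ->
  origin_ball r `<=` K /\ forall Z' tau, compact Z' -> Z' `<=` K `\` origin_ball r ->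
    tau (Z' : set E) = 1 -> mutual h tau tau = +oo.
Proof.
move=> muB; have [V VE] := energyE Hmu.
have [nuE [Q [HQ QE potQ]]] := ball_energy n0 pn rho1 adm Hnu1 r0 rr Hnu.
have uV : ball_u p m nu1 r 0 = V by apply: EFin_inj; rewrite -nuE munu.
rewrite uV in nuE QE; have [QB _ _] := HQ.
pose F : set vec := K `&` origin_ball r.
have cF : closed F.
  by apply: closedI; [apply: compact_closed => //; exact: norm_hausdorff|exact: closed_origin_ball].
have mF : measurable (F : set E) by exact: closed_borel.
have Frho y : (F y -> `|y| <= rho)%R by move=> [/KB yr _]; exact: box.
have muF : mu (F : set E) = 1.
  by transitivity (mu (B r)) => //; exact: probability_setI1.
have mu_le x : (`|x| <= rho)%R -> potential h mu x <= V%:E.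
  by move=> xr; rewrite -VE; exact: (minimizer_potential_le n0 pn rho1 adm mK KB Hmu).
have mu_lt x := potential_lt n0 pn (ltW rho0) adm cF Frho muF mu_le (x := x).
have muQ : mutual h mu Q = V%:E.
  rewrite /mutual; apply: (integral_eq_on (mB r) muB (mpot Q) (pot0 Q)) => x xr.
  by rewrite potQ -uV; exact: (ball_potE n0 pn rho1 adm Hnu1 r0 rr xr).
have QF : Q (F : set E) = 1.
  have [QF0|QF0] := eqVneq (Q (~` (F : set E))) 0.
    by have := probability_setC Q (measurableC mF); rewrite setCK QF0 sube0.
  have QF1 : 0 < Q (~` (F : set E)) by rewrite lt_neqAle eq_sym QF0 measure_ge0.
  have : mutual h Q mu < V%:E.
    apply: (integral_lt_on (mB r) QB (mpot mu) (pot0 mu) (measurableC mF) QF1).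
      by move=> x xr; apply: mu_le; apply: box; exact: Brho.
    by move=> x xr Fx; apply: mu_lt => //; apply: box; exact: Brho.
  by rewrite (mutualC h0 hC mh) muQ ltxx.
have Q_le x : (`|x| <= rho)%R -> potential h Q x <= V%:E.
  by move=> xr; rewrite -QE; exact: (minimizer_potential_le n0 pn rho1 adm (mB r) Brho HQ).
split=> [x xr|Z' tau cZ ZK tZ].
  apply: contrapT => Kx.
  have Fx : ~ F x by move=> [].
  have := potential_lt n0 pn (ltW rho0) adm cF Frho QF Q_le (box (Brho xr)) Fx.
  by rewrite potQ (ball_potE n0 pn rho1 adm Hnu1 r0 rr xr) uV ltxx.
(* A measure of finite energy on K minus the ball would have mutual energy at least V with [mu] by
   the first variation, but less than V because the potential of [mu] is below V there. *)
apply/eqP; rewrite -leye_eq leNgt; apply/negP => too.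
have mZ : measurable (Z' : set E) by exact: compact_borel.
have tK : tau (K : set E) = 1.
  apply/eqP; rewrite eq_le probability_le1//=; apply: (@le_trans _ _ (tau (Z' : set E))).
    by rewrite le_eqVlt; apply/orP; left; apply/eqP; exact: esym.
  by apply: le_measure; rewrite ?inE// => x /ZK[].
have := minimizer_mutual_ge h0 hC mh mK Hmu tK too.
rewrite VE (mutualC h0 hC mh) leNgt; apply/negP; rewrite negbK.
have Zrho x : Z' x -> (`|x| <= rho)%R by move=> /ZK[/KB xr _]; exact: box.
apply: (integral_lt_on mZ tZ (mpot mu) (pot0 mu) measurableT).
- by apply: lt_le_trans lte01 _; rewrite le_eqVlt; apply/orP; left; apply/eqP; apply/esym; exact: probability_setT.
- by move=> x /Zrho; exact: mu_le.
- move=> x Zx _; apply: mu_lt; first exact: Zrho.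
  by move=> [_ xr]; have [] := ZK _ Zx.
Qed.

Let jV j : (0 < j.+1%:R^-1 :> R)%R. Proof. by rewrite invr_gt0. Qed.

Lemma log_defect_ball_le : log_defect rho mu <= log_defect rho nu.
Proof.
rewrite -[X in X <= _]adde0; apply: (log_defect_le rho1 nu_rho mu_rho) => j.
rewrite mul0r addr0; apply: fine_le; last exact: ball_moment_le.
- exact: (moment_fin rho1 (jV j) nu_rho).
- exact: (moment_fin rho1 (jV j) mu_rho).
Qed.

Lemma log_defect_ball_eq : mu (B r) = 1 -> log_defect rho mu = log_defect rho nu.
Proof.
move=> muB; apply/eqP; rewrite eq_le log_defect_ball_le/=.
rewrite -[X in X <= _]adde0; apply: (log_defect_le rho1 mu_rho nu_rho) => j.
by rewrite mul0r addr0 (ball_moment_eq muB (jV j)).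
Qed.

(** Since -ln t <= t^(-p) / p, the logarithm is dominated by the kernel seen from the origin, and
    the potential of [nu] at the origin is at most its energy. *)
Lemma log_defect_ball_fin : p != 0%R -> log_defect rho nu < +oo.
Proof.
move=> pn0; have pp : (0 < p)%R by rewrite lt_neqAle eq_sym pn0.
have m00 : m = 0%R by case: adm => [[p00]|[]//]; rewrite p00 eqxx in pn0.
have [V VE] := energyE Hnu.
have z0 : (`|0%R : vec| <= rho)%R by rewrite normr0 ltW.
have U0 := minimizer_potential_le n0 pn rho1 adm (mB r) Brho Hnu z0.
have pi0 : 0 <= p^-1%:E by rewrite lee_fin invr_ge0.
have mf : measurable_fun [set: E] (fun x : E => p^-1%:E * h 0%R x).
  have mc : measurable_fun [set: E] (fun _ : E => p^-1%:E) by exact: measurable_cst.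
  by apply: (emeasurable_funM mc); exact: measurable_nker_r.
have f0 x : 0 <= p^-1%:E * h 0%R x by exact: mule_ge0.
have r00 : 0 <= rho%:E by rewrite lee_fin ltW.
have mr : measurable_fun [set: E] (fun _ : E => rho%:E) by exact: measurable_cst.
apply: (@le_lt_trans _ _ (\int[nu]_x (rho%:E + p^-1%:E * h 0%R x))).
  apply: (le_integral_full (mB r) nuB).
  - exact: measurable_neg_log.
  - by move=> x; exact: neg_log_ge0.
  - exact: (emeasurable_funD mr mf).
  - by move=> x; exact: adde_ge0.
  move=> x xr; rewrite neg_logE//; last exact: Brho.
  apply: leeD2l; rewrite /nker sub0r enormN.
  have [x0|x0] := eqVneq (enorm x) 0%R.
    by rewrite gt0_muley ?lte_fin ?invr_gt0// leey.
  have xp : (0 < enorm x)%R by rewrite lt_neqAle eq_sym x0 enorm_ge0.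
  rewrite lne_EFin// -EFinN -EFinM lee_fin; apply: le_trans (ln_le_powR xp pp) _.
  rewrite ler_wpM2l ?invr_ge0// /profile /raw_profile (negbTE pn0) m00 addr0.
  by rewrite le_max lexx orbT.
rewrite ge0_integralD; [|exact: measurableT|by move=> x _; exact: r00|exact: mr|by move=> x _; exact: f0|exact: mf].
rewrite ge0_integralZl; [|exact: measurableT|exact: measurable_nker_r|by move=> x _; exact: h0|exact: pi0].
have -> : \int[nu]_x rho%:E = rho%:E.
  by apply: (integral_eq_on (mB r) nuB mr).
apply: (@le_lt_trans _ _ (rho%:E + p^-1%:E * V%:E)); last by rewrite -EFinM -EFinD ltry.
by apply: leeD2l; apply: lee_wpmul2l => //; rewrite -VE.
Qed.

(** The moments differ by at least k / N_q with N_q <= C / q by [layer_le_inv], hence by at least (k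
    / C) q: exactly the rate that [log_defect_le] carries to the limit. *)
Lemma log_defect_ball_lt : p != 0%R -> mu (B r) <> 1 -> log_defect rho mu < log_defect rho nu.
Proof.
move=> pn0 muB; have [k k0 H] := ball_moment_gap muB.
have nf := log_defect_ball_fin pn0.
pose C := (ball_u p m nu1 1 0 + 1)%R.
have C0 : (0 < C)%R by rewrite /C; move: u1_ge0; set u := ball_u _ _ _ _ _ => u0; lra.
have kC : (0 < k / C)%R by rewrite divr_gt0.
have D : log_defect rho mu + (k / C)%:E <= log_defect rho nu.
  apply: (log_defect_le rho1 nu_rho mu_rho) => j; set q := (j.+1%:R^-1)%R.
  have q0 : (0 < q)%R by exact: jV.
  have q2 : (q <= 2)%R.
    by apply: (@le_trans _ _ 1%R); [rewrite invf_le1// ler1n|rewrite ler1n].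
  have Nf := layer_fin q0; have N0 := layer_gt0 rho1 e1 Gp mG q.
  have NC : (fine (layer rho G q e) <= C / q)%R.
    rewrite -lee_fin fineK//; apply: le_trans (layer_le_inv pn0 q0) _.
    by rewrite lee_fin ler_wpM2r ?invr_ge0 ?(ltW q0)// lerDl.
  have M1 := moment_fin rho1 q0 nu_rho; have M2 := moment_fin rho1 q0 mu_rho.
  have := H q q0 q2; rewrite -(fineK Nf) -(fineK M1) -(fineK M2) -!EFinM -EFinD lee_fin.
  have {N0} : (0 < fine (layer rho G q e))%R by rewrite fine_gt0// N0 -ge0_fin_numE ?(ltW N0).
  move: (fine (layer rho G q e)) NC (fine (moment nu q)) (fine (moment mu q)) => N NC a b N0 ab.
  have kqC : (k / C * q <= k / N)%R.
    rewrite -mulrA ler_pM2l// mulrC -[leRHS]mul1r ler_pdivlMr// mulrAC.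
    by rewrite ler_pdivrMr// mul1r mulrC -ler_pdivlMr.
  have kN : (k / N <= b - a)%R by rewrite ler_pdivrMr//; lra.
  by rewrite -lerBrDl; exact: le_trans kqC kN.
rewrite lt_neqAle log_defect_ball_le andbT; apply/eqP => E.
move: nf D; rewrite E; have : 0 <= log_defect rho nu by apply: integral_ge0 => x _; exact: neg_log_ge0.
case: (log_defect rho nu) => [l| |]// _ _; rewrite -EFinD lee_fin; lra.
Qed.

End same_energy.

(** -log|x| is the logarithmic kernel with pole at the origin, so for the explicit minimiser [Q] the
    logarithmic moment is a potential at the centre, equal to the energy. [log_defect_ball_eq]
    transfers this from [Q] to any minimiser [nu]. *)
Lemma log_defect_ball_energy nu r : p = 0%R -> (0 < r)%R -> (r <= rho)%R ->
  minimizer h (B r) nu -> log_defect rho nu - rho%:E = mutual h nu nu - m%:E.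
Proof.
move=> p00 r0 rr Hnu; have [nuE [Q [HQ QE potQ]]] := ball_energy n0 pn rho1 adm Hnu1 r0 rr Hnu.
have Brho : B r `<=` B rho by move=> x /= xr; exact: le_trans rr.
have cB : compact (origin_ball r : set vec) by exact: compact_origin_ball.
have [QB _ _] := HQ.
have QQ : mutual h nu nu = mutual h Q Q by rewrite nuE QE.
rewrite -(log_defect_ball_eq cB Brho r0 rr HQ Hnu QQ QB) QQ QE.
rewrite -(integral_lneV rho1 (mB r) Brho QB).
have e0 : (enorm (0%R : vec) <= r)%R by rewrite enorm0 ltW.
rewrite -(ball_potE n0 pn rho1 adm Hnu1 r0 rr e0) -potQ.
rewrite -(integral_subcst (mB r) QB (measurable_nker_r p m (0%R : vec)) (h0 0%R) m0).
apply: eq_integral => x; rewrite inE => xr.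
have z0 : (`|0%R : vec| <= rho)%R by rewrite normr0 ltW.
rewrite -(nker_pkernel adm z0 (box (Brho _ xr))) /pkernel p00 eqxx /log_kernel.
by rewrite sub0r enormN.
Qed.

(** For r' > r the part of [K] in |x| >= r' is a compact subset of [Z]. If [mu] charged it, the
    normalised restriction would have finite energy, contradicting capacity zero. *)
Lemma full_of_structure (K Z : set vec) mu r : compact K -> K `<=` origin_ball rho ->
  minimizer h (K : set E) mu -> K = origin_ball r `|` Z -> inner_cap_zero p Z -> mu (B r) = 1.
Proof.
move=> cK KB Hmu KE Z0; have mK : measurable (K : set E) by exact: compact_borel.
have [muK moo _] := Hmu.
apply: ball_full => r' rr'.
pose F : set vec := [set x | (r' <= enorm x)%R].
have cF : closed F.
  rewrite (_ : F = @enorm R n @^-1` [set t | (r' <= t)%R])//.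
  by apply: closed_comp => [x _|]; [exact: continuous_enorm|exact: closed_ge].
have mF : measurable (F : set E) by exact: closed_borel.
have cKF : compact (K `&` F).
  by apply: (subclosed_compact _ cK) => //; apply: closedI => //; apply: compact_closed => //; exact: norm_hausdorff.
have mKF : measurable (K `&` F : set E) by exact: measurableI.
have KFZ : K `&` F `<=` Z.
  move=> x [Kx Fx]; move: Kx; rewrite KE => -[xr|//].
  by have := le_lt_trans (le_trans Fx xr) rr'; rewrite ltxx.
have cap0 := Z0 _ cKF KFZ.
have <- : mu (K `&` F : set E) = mu (F : set E) by exact: probability_setI1.
apply: contrapT => c0'.
pose c := fine (mu (K `&` F : set E)).
have cE : mu (K `&` F : set E) = c%:E by rewrite fineK// fin_num_measure.
have c0 : (0 < c)%R.
  rewrite lt_neqAle; apply/andP; split; last by rewrite -lee_fin -cE measure_ge0.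
  by apply/eqP => c00; apply: c0'; rewrite cE -c00.
have [P [PE PI]] := restriction_probability mKF c0 cE.
have PKF : P (K `&` F : set E) = 1.
  transitivity (c^-1%:E * c%:E); last by rewrite -EFinM mulVf// gt_eqF.
  by rewrite PE// setIid; congr (_ * _).
have ci : 0 <= c^-1%:E by rewrite lee_fin invr_ge0 ltW.
have le_int (f : E -> \bar R) : measurable_fun setT f -> (forall x, 0 <= f x) ->
    \int[P]_x f x <= c^-1%:E * \int[mu]_x f x.
  by move=> mf f0; rewrite PI// lee_wpmul2l// ge0_subset_integral.
have KFr x : (K `&` F) x -> (`|x| <= rho)%R by move=> [/KB xr _]; exact: box.
apply: (cap_gt0_mutual m0 adm cKF KFr PKF _ cap0).
have mhx x : measurable_fun [set: E] (h x) by exact: measurable_nker_r.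
have pP x : potential h P x <= c^-1%:E * potential h mu x by exact: le_int.
apply: (@le_lt_trans _ _ (c^-1%:E * (c^-1%:E * mutual h mu mu))); last first.
  have [V VE] := energyE Hmu; rewrite VE -!EFinM; exact: ltry.
apply: (@le_trans _ _ (\int[P]_x (c^-1%:E * potential h mu x))).
  apply: ge0_le_integral; [exact: measurableT|by move=> x _; exact: pot0|exact: mpot| |by move=> x _; exact: pP].
  by apply: emeasurable_funM; [exact: measurable_cst|exact: mpot].
rewrite ge0_integralZl; [|exact: measurableT|exact: mpot|by move=> x _; exact: pot0|exact: ci].
by apply: lee_wpmul2l => //; exact: (le_int _ (mpot mu) (pot0 mu)).
Qed.

End equality_case.

(** * Assembly for the capacities of the statement *)

Section main.
Context {R : realType} {n : nat}.
Local Open Scope ereal_scope.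
Local Notation E := (borel_rV R n).
Local Notation vec := ('rV[R]_n).
Implicit Types (K : set vec) (mu nu : probability E R) (p r : R).

Lemma pkernel_diag p (x : vec) : pkernel p x x = +oo.
Proof.
rewrite /pkernel; case: eqP => [_|/eqP p0]; rewrite /log_kernel /riesz_kernel subrr enorm0.
  by rewrite inver eqxx.
by rewrite powR0// inver eqxx.
Qed.

(** For r <= 0 the ball contains at most the origin, where the kernel is infinite, so its energy
    would be infinite. *)
Lemma equilibrium_radius_gt0 p r nu : equilibrium_measure p (origin_ball r) nu -> (0 < r)%R.
Proof.
move=> [nuB Boo nuE]; rewrite ltNge; apply/negP => r0.
have B0 (x : vec) : origin_ball r x -> x = 0%R.
  move=> xr; apply/eqP; rewrite -enorm_eq0 eq_le enorm_ge0 andbT.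
  exact: le_trans r0.
have mB : measurable (origin_ball r : set E) by apply: closed_borel; exact: closed_origin_ball.
have coo : \int[nu]_(x in (origin_ball r : set E)) +oo = +oo.
  by rewrite integral_cst//; transitivity (+oo * 1 : \bar R); [congr (_ * _)|rewrite mule1].
move: Boo; rewrite -nuE; suff -> : kernel_energy (pkernel p) (origin_ball r) nu = +oo by rewrite ltxx.
rewrite /kernel_energy -[RHS]coo; apply: eq_integral => x; rewrite inE => /B0 ->.
rewrite -[RHS]coo; apply: eq_integral => y; rewrite inE => /B0 ->.
exact: pkernel_diag.
Qed.

Lemma compact_in_ball K : compact K -> exists M : R, K `<=` origin_ball M.
Proof.
move=> cK; have [M [_ HM]] := compact_bounded cK.
exists (n%:R * (M + 1))%R => x Kx; rewrite /origin_ball /=.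
apply: le_trans (enorm_le x) _; rewrite ler_wpM2l//.
by apply: (HM (M + 1)%R) => //; rewrite ltrDl.
Qed.

Lemma exists_unit_vector : (0 < n)%N -> exists e : vec, enorm e = 1%R.
Proof.
move=> n0; pose i0 := Ordinal n0; exists (delta_mx ord0 i0).
rewrite /enorm (bigD1 i0)//= mxE !eqxx expr1n big1 ?addr0 ?sqrtr1// => j ji.
by rewrite mxE (negbTE ji) andbF expr0n.
Qed.

Lemma integral_moment (P : probability E R) (S : set E) (q : R) : measurable S -> P S = 1 ->
  \int[P]_(x in S) (enorm (x : vec) `^ q)%:E = moment P q.
Proof.
move=> mS PS; apply: integral_probability1 => //; last by move=> x; rewrite lee_fin powR_ge0.
apply/measurable_EFinP; exact: (measurableT_comp (measurable_powR q) (@measurable_enorm R n)).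
Qed.

Lemma probability_ball_mono (r rho : R) nu : (r <= rho)%R ->
  nu (origin_ball r : set E) = 1 -> nu (origin_ball rho : set E) = 1.
Proof.
move=> rr nuB; have mB t : measurable (origin_ball t : set E).
  by apply: closed_borel; exact: closed_origin_ball.
apply/eqP; rewrite eq_le probability_le1//=.
apply: (@le_trans _ _ (nu (origin_ball r : set E))).
  by rewrite le_eqVlt; apply/orP; left; apply/eqP; exact: esym.
by apply: le_measure; rewrite ?inE// => x /= xr; exact: le_trans rr.
Qed.

Lemma ereal_addr_gt (a : \bar R) (k : R) : a \is a fin_num -> (0 < k)%R -> ~ (a + k%:E <= a).
Proof. by case: a => // a _ k0; rewrite -EFinD lee_fin gerDl leNgt k0. Qed.

Lemma exponent_neq0 p : (2 <= n)%N -> p = (n%:R - 1)%R -> p != 0%R.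
Proof. by move=> n2 ->; rewrite gt_eqF// subr_gt0 ltr1n. Qed.

Lemma exponent_eq0 p : n = 1%N -> p = (n%:R - 1)%R -> p = 0%R.
Proof. by move=> -> ->; rewrite subrr. Qed.

Lemma sube_injr (x y : \bar R) (c : R) : x - c%:E = y - c%:E -> x = y.
Proof. by move=> /(congr1 (fun z => z + c%:E)); rewrite !subeK. Qed.

Lemma box_size_ge1 (rho : R) : (0 < n)%N -> (1 <= rho)%R -> (1 <= n%:R * (2 * rho + 2))%R.
Proof.
move=> n0 rho1; apply: (@le_trans _ _ (1 * (2 * rho + 2))%R); first by lra.
by apply: ler_wpM2r; [lra|rewrite ler1n].
Qed.

Lemma exists_admissible p (rho : R) : (0 < n)%N -> p = (n%:R - 1)%R -> (1 <= rho)%R ->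
  exists2 m : R, (0 <= m)%R & admissible p m (n%:R * (2 * rho + 2)).
Proof.
move=> n0 pn rho1; have D1 := box_size_ge1 n0 rho1.
have [n1|n1] := eqVneq n 1%N.
  (* The least constant making m - ln t at least 1 up to the largest distance considered. *)
  exists (1 + ln (n%:R * (2 * rho + 2)))%R; first by rewrite addr_ge0// ln_ge0.
  left; split; first by rewrite pn n1 subrr.
  by move=> t t0 tD; rewrite -addrA lerDl subr_ge0 ler_ln ?posrE//; exact: lt_le_trans tD.
exists 0%R => //; right; split => //; rewrite pn subr_gt0 ltr1n.
by rewrite ltn_neqAle eq_sym n1.
Qed.

Lemma equilibrium_moments p K r mu nu : (0 < n)%N -> p = (n%:R - 1)%R -> compact K ->
  cap p K = cap p (origin_ball r : set vec) ->
  equilibrium_measure p K mu -> equilibrium_measure p (origin_ball r) nu ->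
  (forall q : R, (0 < q)%R -> (q <= 2)%R ->
     \int[nu]_(x in origin_ball r) (enorm x `^ q)%:E <= \int[mu]_(x in K) (enorm x `^ q)%:E
     /\ (\int[mu]_(x in K) (enorm x `^ q)%:E
           = \int[nu]_(x in origin_ball r) (enorm x `^ q)%:E
         <-> exists Z, K = origin_ball r `|` Z /\ inner_cap_zero p Z))
  /\ \int[nu]_(x in origin_ball r) lne (enorm x)%:E <= \int[mu]_(x in K) lne (enorm x)%:E
  /\ ((2 <= n)%N ->
       (\int[mu]_(x in K) lne (enorm x)%:E = \int[nu]_(x in origin_ball r) lne (enorm x)%:E
        <-> exists Z, K = origin_ball r `|` Z /\ inner_cap_zero p Z))
  /\ (n = 1%N ->
       (\int[mu]_(x in K) lne (enorm x)%:E = \int[nu]_(x in origin_ball r) lne (enorm x)%:E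
        <-> origin_regular K mu)).
Proof.
move=> n0 pn cK cap_eq mu_eq nu_eq.
have r0 := equilibrium_radius_gt0 nu_eq.
have [M KM] := compact_in_ball cK.
have [e e1] := exists_unit_vector n0.
have [nu1 Hnu1] := @exists_ball_measure R n n0; rewrite -pn in Hnu1.
(* A single scale containing [K] and the ball; the kernel constant [m] is chosen for it. *)
pose rho := Num.max 1%R (Num.max r M).
have rho1 : (1 <= rho)%R by rewrite /rho le_max lexx.
have rr : (r <= rho)%R by rewrite /rho !le_max lexx orbT.
have KB : K `<=` origin_ball rho.
  by move=> x /KM xM; apply: le_trans xM _; rewrite /rho !le_max lexx !orbT.
have rho0 : (0 <= rho)%R by exact: le_trans rho1.
have [m m0 adm] := exists_admissible n0 pn rho1.
move: (rho) rho1 rr KB rho0 m m0 adm => {rho} rho rho1 rr KB rho0 m m0 adm.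
have Brho : (origin_ball r : set vec) `<=` origin_ball rho by move=> x /= xr; exact: le_trans rr.
have cB : compact (origin_ball r : set vec) by exact: compact_origin_ball.
have Kbox (x : vec) : K x -> (`|x| <= rho)%R by move=> /KB; exact: le_trans (ler_norm_enorm _).
have Bbox (x : vec) : origin_ball r x -> (`|x| <= rho)%R by move=> /Brho; exact: le_trans (ler_norm_enorm _).
have p0 : (0 <= p)%R by rewrite pn subr_ge0 ler1n.
have [Hmu muE] := equilibrium_minimizer m0 adm cK Kbox mu_eq.
have [Hnu nuE] := equilibrium_minimizer m0 adm cB Bbox nu_eq.
have munu : mutual (nker p m : E -> E -> \bar R) nu nu = mutual (nker p m : E -> E -> \bar R) mu mu.
  apply: (@sube_injr _ _ m).
  transitivity (min_energy (pkernel p) (origin_ball r : set vec)); first exact: esym nuE.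
  by transitivity (min_energy (pkernel p) K); [apply: esym; exact: cap_inj|exact: muE].
have mK : measurable (K : set E) by exact: compact_borel.
have mB : measurable (origin_ball r : set E) by exact: compact_borel.
have [muK _ _] := Hmu; have [nuB _ _] := Hnu.
(* Both equality criteria involving the shape of [K] pass through this condition on [mu]; the
   witness for [Z] is [K] minus the ball. *)
have fullP : mu (origin_ball r : set E) = 1 <-> exists Z, K = origin_ball r `|` Z /\ inner_cap_zero p Z.
  split=> [muB|[Z [KE Z0]]].
    have [BK H] := ball_structure n0 pn rho1 adm Hnu1 cK KB r0 rr Hmu Hnu munu muB.
    exists (K `\` origin_ball r); split; first by rewrite setDUK.
    move=> Z' cZ ZZ; apply: (cap_eq0_mutual m0 adm cZ); first by move=> x /ZZ[/Kbox].
    by move=> tau; exact: H.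
  exact: (full_of_structure m0 adm cK KB Hmu KE Z0).
have lnmu := integral_lne rho1 mK KB muK; have lnnu := integral_lne rho1 mB Brho nuB.
have lnE : \int[mu]_(x in (K : set E)) lne (enorm (x : vec))%:E = \int[nu]_(x in (origin_ball r : set E)) lne (enorm (x : vec))%:E
    <-> log_defect rho mu = log_defect rho nu.
  rewrite lnmu lnnu; split=> [/eqP|->//].
  by rewrite eqe_opp => /eqP; exact: sube_injr.
have deq muB := log_defect_ball_eq n0 pn rho1 adm Hnu1 e1 cK KB r0 rr Hmu Hnu munu muB.
split; last split; last split.
- move=> q q0 q2; rewrite (integral_moment q mK muK) (integral_moment q mB nuB).
  split; first exact: (ball_moment_le n0 pn rho1 adm Hnu1 e1 cK KB r0 rr Hmu Hnu munu q0).
  rewrite -fullP; split=> [meq|muB].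
    apply: contrapT => muB.
    have [k k0 H] := ball_moment_gap n0 pn rho1 adm Hnu1 e1 cK KB r0 rr Hmu Hnu munu muB.
    have := H q q0 q2; rewrite meq.
    have nuR := probability_ball_mono rr nuB.
    apply: (ereal_addr_gt _ k0); apply: fin_numM; first exact: (moment_fin rho1 q0 nuR).
    exact: (layer_fin n0 pn rho1 adm Hnu1 e1 q0).
  by apply/esym; exact: (ball_moment_eq n0 pn rho1 adm Hnu1 e1 cK KB r0 rr Hmu Hnu munu muB q0).
- rewrite [X in X <= _]lnnu [X in _ <= X]lnmu leeN2; apply: leeD2r.
  exact: (log_defect_ball_le n0 pn rho1 adm Hnu1 e1 cK KB r0 rr Hmu Hnu munu).
- move=> n2; rewrite lnE -fullP; split=> [leq|]; last exact: deq.
  apply: contrapT => muB.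
  have pn0 := exponent_neq0 n2 pn.
  have := log_defect_ball_lt n0 pn rho1 adm Hnu1 e1 cK KB r0 rr Hmu Hnu munu pn0 muB.
  rewrite leq => lt; move: (lt); rewrite ltxx; exact: notF.
- move=> n1; have p00 := exponent_eq0 n1 pn.
  rewrite lnE /origin_regular.
  have -> : log_energy K = log_defect rho nu - rho%:E.
    rewrite (log_defect_ball_energy n0 pn rho1 m0 adm Hnu1 e1 p00 r0 rr Hnu) munu -muE.
    by rewrite /log_energy /pkernel p00 eqxx.
  have -> : \int[mu]_(x in (K : set E)) lne (enorm (x : vec))%:E^-1 = log_defect rho mu - rho%:E.
    exact: (integral_lneV rho1 mK KB muK).
  by split=> [->//|]; exact: sube_injr.
Qed.

End main.

Unset Implicit Arguments.
Local Open Scope ereal_scope.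

Theorem theorem1p2 (R : realType) (n : nat) (n_ge1 : (1 <= n)%N)
    (K : set 'rV[R]_n) (K_compact : compact K) (r : R)
    (mu nu : probability (borel_rV R n) R)
    (p := (n%:R - 1)%R : R) (B := origin_ball r : set 'rV[R]_n)
    (cap_eq : cap p K = cap p B) (cap_gt0 : 0 < cap p B)
    (mu_eq : equilibrium_measure p K mu) (nu_eq : equilibrium_measure p B nu) :
  (forall q : R, (0 < q)%R -> (q <= 2)%R ->
     \int[mu]_(x in K) (enorm x `^ q)%:E >= \int[nu]_(x in B) (enorm x `^ q)%:E
     /\ (\int[mu]_(x in K) (enorm x `^ q)%:E
           = \int[nu]_(x in B) (enorm x `^ q)%:E
         <-> exists Z, K = B `|` Z /\ inner_cap_zero p Z))
  /\ \int[mu]_(x in K) lne (enorm x)%:E >= \int[nu]_(x in B) lne (enorm x)%:E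
  /\ ((2 <= n)%N ->
       (\int[mu]_(x in K) lne (enorm x)%:E = \int[nu]_(x in B) lne (enorm x)%:E
        <-> exists Z, K = B `|` Z /\ inner_cap_zero p Z))
  /\ (n = 1%N ->
       (\int[mu]_(x in K) lne (enorm x)%:E = \int[nu]_(x in B) lne (enorm x)%:E
        <-> origin_regular K mu)).

Proof.
exact: (equilibrium_moments n_ge1 erefl K_compact cap_eq mu_eq nu_eq).
Qed.
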